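(* Let $m_1\ge 2$, $m_2\ge 2$, $m=m_1+m_2$, let $r_1,r_2>0$ with $r_1^2+r_2^2=1$, and let $n_1+n_2=n-1$. Let $\varphi_1:M_1^{m_1}\to\mathbb S^{n_1}(r_1)$ and $\varphi_2:M_2^{m_2}\to\mathbb S^{n_2}(r_2)$ be two non-minimal $PMC$ submanifolds such that $M^m=M_1^{m_1}\times M_2^{m_2}$ is proper biharmonic in $\mathbb S^n$ via $\iota\circ\varphi$, where $\varphi=\varphi_1\times\varphi_2$. Let $H^{\iota\circ\varphi}$ be the mean curvature vector field of $\iota\circ\varphi$. (1) If $m_1>2$ or $m_2>2$, then $\left|H^{\iota\circ\varphi}\right|\in\left(0,\frac{m-4}{m}\right]\cup\{1\}$. (2) If $m_1=m_2=2$, then $\varphi_1$ and $\varphi_2$ are pseudo-umbilical, that is, $\left|H^{\iota\circ\varphi}\right|=1$.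
   Context: Manifolds are smooth and connected; a submanifold of $N$ is an isometric immersion $\varphi:M^m\to N$. $\mathbb S^n(r)$ is the Euclidean sphere of radius $r$ centered at the origin of $\mathbb R^{n+1}$, $\mathbb S^n=\mathbb S^n(1)$. $B$ is the second fundamental form, $A_\eta$ the shape operator in the normal direction $\eta$ ($\langle A_\eta X,Y\rangle=\langle B(X,Y),\eta\rangle$), $\nabla^\perp$ the normal connection, $H=\frac1m\operatorname{trace}B$ the mean curvature vector field. The submanifold is minimal if $H=0$, $PMC$ if $\nabla^\perp H=0$, pseudo-umbilical if $A_H=|H|^2\operatorname{Id}$. The tension field is $\tau(\varphi)=mH$, and the bitension field is $\tau_2(\varphi)=-\Delta^\varphi\tau(\varphi)-\operatorname{trace}R^N(d\varphi(\cdot),\tau(\varphi))d\varphi(\cdot)$, where $\Delta^\varphi=-\operatorname{trace}(\nabla^\varphi\nabla^\varphi-\nabla^\varphi_{\nabla})$ is the rough Laplacian on sections of $\varphi^{-1}TN$ and $R^N(X,Y)Z=\nabla_X\nabla_YZ-\nabla_Y\nabla_XZ-\nabla_{[X,Y]}Z$. The submanifold is biharmonic if $\tau_2(\varphi)=0$ and proper biharmonic if it is biharmonic and not minimal. $\iota:\mathbb S^{n_1}(r_1)\times\mathbb S^{n_2}(r_2)\to\mathbb S^n$ is the canonical inclusion, induced by $\mathbb R^{n+1}=\mathbb R^{n_1+1}\oplus\mathbb R^{n_2+1}$, and $M_1\times M_2$ carries the product metric. *)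

(* Defs.v *)
From mathcomp Require Import all_boot all_order all_algebra.
From mathcomp Require Import all_classical all_reals all_analysis.

Set Implicit Arguments.
Unset Strict Implicit.
Unset Printing Implicit Defensive.

Import Order.TTheory GRing.Theory Num.Theory.
Import numFieldNormedType.Exports.

Local Open Scope classical_set_scope.
Local Open Scope ring_scope.

(* The norm of 'rV[R]_n in MathComp-Analysis is the sup norm.  It has the same
   topology and derivatives as the Euclidean norm, which is [enorm]. *)
Definition dot (R : realType) (n : nat) (u v : 'rV[R]_n) : R :=
  (u *m v^T) 0 0.

Definition enorm (R : realType) (n : nat) (u : 'rV[R]_n) : R :=
  Num.sqrt (dot u u).

Definition partial (R : realType) (m : nat) (W : normedModType R)
    (i : 'I_m) (f : 'rV[R]_m -> W) : 'rV[R]_m -> W :=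
  fun x => 'D_(delta_mx 0 i) f x.

(* C^oo on the open set U: all iterated partial derivatives exist and are
   continuous at the points of U. *)
Definition smooth_on (R : realType) (m : nat) (W : normedModType R)
    (U : set 'rV[R]_m) (f : 'rV[R]_m -> W) : Prop :=
  forall (s : seq 'I_m) (x : 'rV[R]_m), U x ->
    let g := foldr (@partial R m W) f s in
    {for x, continuous g} /\
    forall i : 'I_m, derivable g x (delta_mx 0 i).

(* [chart a] maps the open set [source a] of the manifold onto the open set
   [target a] of R^m, with inverse [param a]; both are total functions whose
   values outside these sets are irrelevant.  [metric a x] is the matrix of the
   coefficients g_ij at the point with coordinates x. *)
Record rmanifold_data (R : realType) (m : nat) := RManifoldData {
  carrier :> topologicalType ;
  chart_index : Type ;
  source : chart_index -> set carrier ;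
  target : chart_index -> set 'rV[R]_m ;
  chart : chart_index -> carrier -> 'rV[R]_m ;
  param : chart_index -> 'rV[R]_m -> carrier ;
  metric : chart_index -> 'rV[R]_m -> 'M[R]_m
}.

Section Manifold.
Variables (R : realType) (m : nat) (M : rmanifold_data R m).

Definition transition (a b : chart_index M) : 'rV[R]_m -> 'rV[R]_m :=
  chart b \o param a.

Definition overlap (a b : chart_index M) : set 'rV[R]_m :=
  target a `&` param a @^-1` source b.

Record is_smooth_manifold : Prop := {
  manifold_nonempty : [set: M] !=set0 ;
  manifold_hausdorff : hausdorff_space M ;
  manifold_second_countable : @second_countable M ;
  manifold_connected : connected [set: M] ;
  charts_cover : forall p : M, exists a, source a p ;
  source_open : forall a : chart_index M, open (source a) ;
  target_open : forall a : chart_index M, open (target a) ;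
  chart_in_target : forall (a : chart_index M) p,
    source a p -> target a (chart a p) ;
  param_in_source : forall (a : chart_index M) x,
    target a x -> source a (param a x) ;
  chartK : forall (a : chart_index M) p,
    source a p -> param a (chart a p) = p ;
  paramK : forall (a : chart_index M) x,
    target a x -> chart a (param a x) = x ;
  chart_continuous : forall a : chart_index M,
    {within source a, continuous (chart a)} ;
  param_continuous : forall a : chart_index M,
    {within target a, continuous (param a)} ;
  transition_smooth : forall a b : chart_index M,
    smooth_on (overlap a b) (transition a b)
}.

Record is_riemannian_metric : Prop := {
  metric_smooth : forall a : chart_index M, smooth_on (target a) (metric a) ;
  metric_sym : forall (a : chart_index M) x,
    target a x -> (metric a x)^T = metric a x ;
  metric_pos : forall (a : chart_index M) x, target a x ->
    forall v : 'rV[R]_m, v != 0 -> 0 < (v *m metric a x *m v^T) 0 0 ;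
  metric_transition : forall (a b : chart_index M) x, overlap a b x ->
    let J := \matrix_(i < m, j < m) partial i (transition a b) x 0 j in
    metric a x = J *m metric b (transition a b x) *m J^T
}.

Definition is_riemannian_manifold : Prop :=
  is_smooth_manifold /\ is_riemannian_metric.

End Manifold.

Definition prod_manifold (R : realType) (m1 m2 : nat)
    (M1 : rmanifold_data R m1) (M2 : rmanifold_data R m2) :
    rmanifold_data R (m1 + m2) :=
  @RManifoldData R (m1 + m2) (carrier M1 * carrier M2)%type
    (chart_index M1 * chart_index M2)%type
    (fun a => source a.1 `*` source a.2)
    (fun a => [set x | target a.1 (lsubmx x) /\ target a.2 (rsubmx x)])
    (fun a p => row_mx (chart a.1 p.1) (chart a.2 p.2))
    (fun a x => (param a.1 (lsubmx x), param a.2 (rsubmx x)))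
    (fun a x => block_mx (metric a.1 (lsubmx x)) 0
                         0 (metric a.2 (rsubmx x))).

Section Sphere.
Variables (R : realType) (N : nat) (r : R).
Implicit Types (p q u v w : 'rV[R]_N) (X Y Z : 'rV[R]_N -> 'rV[R]_N).

(* S^(N-1)(r), for r > 0. *)
Definition sphere : set 'rV[R]_N := [set p | dot p p = r ^+ 2].

Definition sphere_proj p v : 'rV[R]_N := v - (dot v p / r ^+ 2) *: p.

(* The Levi-Civita connection of the sphere.  Vector fields on the sphere are
   given by functions on R^N; as X is tangent, the value on the sphere depends
   only on the restrictions of X and Y to the sphere. *)
Definition sphere_connection X Y : 'rV[R]_N -> 'rV[R]_N :=
  fun p => sphere_proj p ('D_(X p) Y p).

Definition lie_bracket X Y : 'rV[R]_N -> 'rV[R]_N :=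
  fun p => 'D_(X p) Y p - 'D_(Y p) X p.

Definition sphere_curvature_fields X Y Z : 'rV[R]_N -> 'rV[R]_N :=
  fun p => sphere_connection X (sphere_connection Y Z) p
         - sphere_connection Y (sphere_connection X Z) p
         - sphere_connection (lie_bracket X Y) Z p.

(* R(u, v)w for u, v, w tangent at p: by tensoriality any tangent extensions of
   u, v, w may be used; we take their projections to the tangent spaces. *)
Definition sphere_curvature p u v w : 'rV[R]_N :=
  sphere_curvature_fields (sphere_proj ^~ u) (sphere_proj ^~ v)
                          (sphere_proj ^~ w) p.

End Sphere.

(* Geometry, in coordinates, of an isometric immersion into the sphere of
   radius r of R^N: F is the local expression of the immersion and g that of
   the metric. *)
Section Local.
Variables (R : realType) (m N : nat) (r : R).
Variables (g : 'rV[R]_m -> 'M[R]_m) (F : 'rV[R]_m -> 'rV[R]_N).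
Implicit Types (i j k l : 'I_m) (x : 'rV[R]_m) (V : 'rV[R]_m -> 'rV[R]_N).

Definition christoffel k i j x : R :=
  2^-1 * \sum_l invmx (g x) k l *
    (partial i (fun y => g y j l) x + partial j (fun y => g y i l) x
     - partial l (fun y => g y i j) x).

Definition metric_trace (b : 'I_m -> 'I_m -> 'rV[R]_N) x : 'rV[R]_N :=
  \sum_i \sum_j invmx (g x) i j *: b i j.

Definition pullback_connection i V : 'rV[R]_m -> 'rV[R]_N :=
  fun x => sphere_proj r (F x) (partial i V x).

(* B(d_i, d_j) = nabla^F_i (dF d_j) - dF (nabla_i d_j) *)
Definition second_fundamental_form i j x : 'rV[R]_N :=
  pullback_connection i (partial j F) x
  - \sum_k christoffel k i j x *: partial k F x.

Definition mean_curvature x : 'rV[R]_N :=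
  m%:R^-1 *: metric_trace (fun i j => second_fundamental_form i j x) x.

Definition tangent_part x (w : 'rV[R]_N) : 'rV[R]_N :=
  metric_trace (fun i j => dot w (partial i F x) *: partial j F x) x.

Definition normal_connection i V x : 'rV[R]_N :=
  pullback_connection i V x - tangent_part x (pullback_connection i V x).

(* In the basis d_1, ..., d_m, the shape operator acts on row vectors of
   components by right multiplication by this matrix. *)
Definition shape_operator x (eta : 'rV[R]_N) : 'M[R]_m :=
  (\matrix_(i, j) dot (second_fundamental_form i j x) eta) *m invmx (g x).

Definition tension x : 'rV[R]_N := m%:R *: mean_curvature x.

Definition rough_laplacian V x : 'rV[R]_N :=
  - metric_trace (fun i j =>
      pullback_connection i (pullback_connection j V) x
      - \sum_k christoffel k i j x *: pullback_connection k V x) x.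

Definition bitension x : 'rV[R]_N :=
  - rough_laplacian tension x
  - metric_trace (fun i j =>
      sphere_curvature r (F x) (partial i F x) (tension x) (partial j F x)) x.

End Local.

Section Submanifold.
Variables (R : realType) (m N : nat) (r : R) (M : rmanifold_data R m).
Variable phi : M -> 'rV[R]_N.

Definition local_rep (a : chart_index M) : 'rV[R]_m -> 'rV[R]_N :=
  phi \o param a.

(* Isometric immersions of M into the sphere of radius r; immersivity follows
   from [submanifold_isometric] as the metric is positive definite. *)
Record is_submanifold : Prop := {
  submanifold_sphere : forall p : M, sphere r (phi p) ;
  submanifold_smooth : forall a, smooth_on (target a) (local_rep a) ;
  submanifold_isometric : forall (a : chart_index M) x, target a x ->
    forall i j : 'I_m, metric a x i j =
      dot (partial i (local_rep a) x) (partial j (local_rep a) x)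
}.

Definition mean_curvature_in (a : chart_index M) : 'rV[R]_m -> 'rV[R]_N :=
  mean_curvature r (metric a) (local_rep a).

Definition minimal : Prop :=
  forall (a : chart_index M) x, target a x -> mean_curvature_in a x = 0.

Definition PMC : Prop :=
  forall (a : chart_index M) x, target a x -> forall i : 'I_m,
    normal_connection r (metric a) (local_rep a) i (mean_curvature_in a) x = 0.

Definition pseudo_umbilical : Prop :=
  forall (a : chart_index M) x, target a x ->
    shape_operator r (metric a) (local_rep a) x (mean_curvature_in a x)
    = (enorm (mean_curvature_in a x) ^+ 2)%:M.

Definition biharmonic : Prop :=
  forall (a : chart_index M) x, target a x ->
    bitension r (metric a) (local_rep a) x = 0.

Definition proper_biharmonic : Prop := biharmonic /\ ~ minimal.

(* |H| is the constant function h on M. *)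
Definition mean_curvature_norm_eq (h : R) : Prop :=
  forall (a : chart_index M) x, target a x -> enorm (mean_curvature_in a x) = h.

End Submanifold.

Definition prod_map (T1 T2 U1 U2 : Type) (f1 : T1 -> U1) (f2 : T2 -> U2)
    (p : T1 * T2) : U1 * U2 := (f1 p.1, f2 p.2).

(* S^n1(r1) x S^n2(r2) -> S^n with n + 1 = (n1 + 1) + (n2 + 1), that is,
   n1 + n2 = n - 1. *)
Definition sphere_prod_incl (R : realType) (n1 n2 : nat)
    (p : 'rV[R]_n1.+1 * 'rV[R]_n2.+1) : 'rV[R]_(n1.+1 + n2.+1) :=
  row_mx p.1 p.2.

(* Main.v *)
(* Put m = m1 + m2, s_i = r_i^2 and a_i = m - m_i / s_i.  Write H_i for the mean
   curvature vector and A_i for its shape operator on the i-th factor, let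
   tau = (m1 H1 + a_1 phi1, m2 H2 + a_2 phi2) be the tension field of the product,
   and T = |tau|^2.  With Delta the Laplacian applied to vector-valued functions,
   the biharmonic equation is Delta tau - T psi + m tau = 0.  Its i-th component
   says Delta H_i = - (a_i + m) H_i + (m_i |H_i|^2 / s_i) phi_i and
   T = a_i^2 + m_i^2 |H_i|^2 / s_i; so T depends only on the point of each factor
   and is a constant q^2.  Pairing with H_i gives |A_i|^2 = (a_i + m) |H_i|^2, which
   is constant, so the Simons identity for the parallel field H_i contains
   |nabla A_i|^2 >= 0 and otherwise only traces of powers of A_i.  In terms of
   L_i = (m_i A_i - a_i) / q the outcome is tr L_i^2 = m_i, tr L_i^3 <= tr L_i and
   tr L_1 + tr L_2 = q.  If L_i is not the identity then
   tr ((L_i - 1)^2 (L_i + 1)) <= 0 yields a direction with Rayleigh quotient <= -1,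
   whence tr L_i <= m_i - 2.  Since L_i is the identity exactly when q = m, either
   |H| = q / m = 1 and both factors are pseudo-umbilical, or q <= m - 4.

   The differential geometry is done in the ring of smooth functions on a
   coordinate domain, with commuting derivations.  Instead of the coordinate
   fields one uses the tangential parts of the standard basis of the ambient
   Euclidean space: they sum the Laplacian without Christoffel symbols and split
   on a product. *)
From HB Require Import structures.
Require Import Defs.
From mathcomp Require Import all_boot all_order all_algebra.
From mathcomp Require Import all_classical all_reals all_analysis.
From mathcomp Require Import ring lra.
Import Order.TTheory GRing.Theory Num.Theory.
Import numFieldNormedType.Exports.
Local Open Scope classical_set_scope.
Local Open Scope ring_scope.
Set Implicit Arguments.
Unset Strict Implicit.
Unset Printing Implicit Defensive.

(** * Smooth functions *)

(** The constant 2 lost on each factor is best seen on eigenvalues x_j of L_i on the tangent space: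
    the sum of (x_j - 1)^2 (x_j + 1) is at most 0, so unless all x_j are 1 some x_j <= -1; as the
    sum of (x_j - 1)^2 is 2 m_i - 2 tr L_i, the latter is then at least 4. The proof does without
    diagonalisation: a row of L_i - P_i, with P_i the tangent projection, replaces the eigenvector.
    For this the shape operators are extended by zero to the ambient space, P_i plays the identity
    and tr P_i = m_i.

    The Simons identity is pointwise, without integration: |A_i|^2 is constant, so its Laplacian
    vanishes. The Codazzi equation and the symmetry of the second fundamental form both come from
    one commutator formula for tangential derivations, applied to H_i and to the position. The terms
    quadratic in the derivative of the projection cancel, which is why only traces of powers of A_i
    remain.

    The factors interact through T alone, which occurs in both component equations; r_1^2 + r_2^2 =
    1 turns its two expressions into tr L_1 + tr L_2 = q. *)

Section FiniteOrder.
Variables (R : realType) (m : nat).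

(** Counting derivatives instead of listing their indices makes the closure properties below
    inductions on the order. *)
Fixpoint smooth_upto (W : normedModType R) (k : nat) (U : set 'rV[R]_m)
    (f : 'rV[R]_m -> W) : Prop :=
  (forall x, U x -> {for x, continuous f} /\
     forall i : 'I_m, derivable f x (delta_mx 0 i)) /\
  if k is k'.+1 then forall i : 'I_m, smooth_upto k' U (partial i f) else True.

(** [foldr] applies the last index of the sequence first, hence [rcons] in both directions. *)
Lemma smooth_uptoP (W : normedModType R) U (f : 'rV[R]_m -> W) :
  smooth_on U f <-> forall k, smooth_upto k U f.
Proof.
split=> [sf k|sf s].
  elim: k f sf => [|k IH] f sf; split=> //; try exact: (sf [::]).
  move=> i; apply: IH => s x Ux.
  by have := sf (rcons s i) x Ux; rewrite foldr_rcons.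
elim/last_ind: s f sf => [|s i IH] f sf x Ux; first by have [/(_ x Ux)] := sf 0.
by rewrite foldr_rcons; apply: IH => // k; have [_ /(_ i)] := sf k.+1.
Qed.

Variable U : set 'rV[R]_m.
Hypothesis openU : open U.

Lemma eq_on_near (W : normedModType R) (f g : 'rV[R]_m -> W) x :
  {in U, f =1 g} -> U x -> {near x, f =1 g}.
Proof.
move=> fg Ux; apply: filterS (open_nbhs_nbhs (conj openU Ux)) => y Uy.
by apply: fg; rewrite inE.
Qed.

Lemma eq_on_partial (W : normedModType R) (f g : 'rV[R]_m -> W) i :
  {in U, f =1 g} -> {in U, partial i f =1 partial i g}.
Proof. by move=> fg x; rewrite inE => Ux; apply/near_eq_derive/eq_on_near. Qed.

Lemma eq_on_smooth_upto (W : normedModType R) (f g : 'rV[R]_m -> W) k :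
  {in U, f =1 g} -> smooth_upto k U f -> smooth_upto k U g.
Proof.
have fg0 (f' g' : 'rV[R]_m -> W) x : {in U, f' =1 g'} -> U x ->
    {for x, continuous f'} /\ (forall i : 'I_m, derivable f' x (delta_mx 0 i)) ->
    {for x, continuous g'} /\ (forall i : 'I_m, derivable g' x (delta_mx 0 i)).
  move=> f'g' Ux [cf df]; have nfg := eq_on_near f'g' Ux; split.
    rewrite /prop_for /continuous_at -(nbhs_singleton nfg).
    exact: (cvg_trans (near_eq_cvg nfg) cf).
  by move=> i; apply: near_eq_derivable (df i).
elim: k f g => [|k IH] f g fg [f0 fS]; split.
- by move=> x Ux; exact: (fg0 f g x fg Ux (f0 x Ux)).
- exact: I.
- by move=> x Ux; exact: (fg0 f g x fg Ux (f0 x Ux)).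
- by move=> i; apply: IH (fS i); exact: eq_on_partial.
Qed.

Lemma eq_on_smooth (W : normedModType R) (f g : 'rV[R]_m -> W) :
  {in U, f =1 g} -> smooth_on U f -> smooth_on U g.
Proof.
by move=> fg /smooth_uptoP sf; apply/smooth_uptoP => k; apply: eq_on_smooth_upto (sf k).
Qed.

Implicit Types f g : 'rV[R]_m -> R.

Lemma smooth_uptoW (W : normedModType R) (f : 'rV[R]_m -> W) k :
  smooth_upto k.+1 U f -> smooth_upto k U f.
Proof.
elim: k f => [|k IH] f [f0 fS]; split=> // i; apply: IH; exact: fS.
Qed.

Lemma smooth_upto_cst k (c : R) : smooth_upto k U (cst c).
Proof.
have cst0 d x : {for x, continuous (cst d : 'rV[R]_m -> R)} /\
    forall i : 'I_m, derivable (cst d : 'rV[R]_m -> R) x (delta_mx 0 i).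
  by split=> [|i]; [exact: cst_continuous|exact: derivable_cst].
elim: k c => [|k IH] c; split=> [x _|] //; try exact: cst0.
move=> i.
rewrite (_ : partial i _ = cst 0) //.
by apply/funext => x; rewrite /partial derive_cst.
Qed.

(** The pointwise content of one level of [smooth_upto]; continuity of the derivatives is not part
    of it. *)
Definition C1_at f x :=
  {for x, continuous f} /\ forall i : 'I_m, derivable f x (delta_mx 0 i).

Lemma C1_atD f g x : C1_at f x -> C1_at g x -> C1_at (f + g) x.
Proof.
move=> [cf df] [cg dg]; split; first exact: (cvgD cf cg).
by move=> i; exact: (derivableD (df i) (dg i)).
Qed.

Lemma C1_atN f x : C1_at f x -> C1_at (- f) x.
Proof.
move=> [cf df]; split; first exact: (cvgN cf).
by move=> i; exact: (derivableN (df i)).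
Qed.

Lemma C1_atM f g x : C1_at f x -> C1_at g x -> C1_at (f * g) x.
Proof.
move=> [cf df] [cg dg]; split; first exact: (cvgM cf cg).
by move=> i; exact: (derivableM (df i) (dg i)).
Qed.

Lemma C1_atV f x : f x != 0 -> C1_at f x -> C1_at (fun x => (f x)^-1) x.
Proof.
move=> fx0 [cf df]; split; first exact: (cvgV fx0 cf).
by move=> i; exact: (derivableV fx0 (df i)).
Qed.

Lemma smooth_uptoD k f g :
  smooth_upto k U f -> smooth_upto k U g -> smooth_upto k U (f + g).
Proof.
have fg0 f' g' : smooth_upto 0 U f' -> smooth_upto 0 U g' ->
    forall x, U x -> C1_at (f' + g') x.
  by move=> [f0 _] [g0 _] x Ux; apply: C1_atD; [exact: f0|exact: g0].
elim: k f g => [|k IH] f g [f0 fS] [g0 gS]; split;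
  [exact: fg0|exact: I|exact: fg0|].
move=> i; apply: eq_on_smooth_upto (IH _ _ (fS i) (gS i)) => x.
rewrite inE => Ux; have [_ df] := f0 x Ux; have [_ dg] := g0 x Ux.
by rewrite /partial (deriveD (df i) (dg i)).
Qed.

Lemma smooth_uptoN k f : smooth_upto k U f -> smooth_upto k U (- f).
Proof.
have f0' f' : smooth_upto 0 U f' -> forall x, U x -> C1_at (- f') x.
  by move=> [f0 _] x Ux; apply: C1_atN; exact: f0.
elim: k f => [|k IH] f [f0 fS]; split; [exact: f0'|exact: I|exact: f0'|].
move=> i; apply: eq_on_smooth_upto (IH _ (fS i)) => x.
by rewrite inE => Ux; have [_ df] := f0 x Ux; rewrite /partial (deriveN (df i)).
Qed.

(** A derivative of the product still contains an undifferentiated factor, which enters the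
    induction through [smooth_uptoW]. *)
Lemma smooth_uptoM k f g :
  smooth_upto k U f -> smooth_upto k U g -> smooth_upto k U (f * g).
Proof.
have fg0 f' g' : smooth_upto 0 U f' -> smooth_upto 0 U g' ->
    forall x, U x -> C1_at (f' * g') x.
  by move=> [f0 _] [g0 _] x Ux; apply: C1_atM; [exact: f0|exact: g0].
elim: k f g => [|k IH] f g fk gk; move: (fk) (gk) => [f0 fS] [g0 gS]; split;
  [exact: fg0|exact: I|exact: fg0|].
move=> i; apply: (@eq_on_smooth_upto _ (f * partial i g + g * partial i f)).
  move=> x; rewrite inE => Ux; have [_ df] := f0 x Ux; have [_ dg] := g0 x Ux.
  by rewrite /partial (deriveM (df i) (dg i)).
by apply: (smooth_uptoD (IH _ _ (smooth_uptoW fk) (gS i))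
                        (IH _ _ (smooth_uptoW gk) (fS i))).
Qed.

(** The derivative of the inverse contains the inverse again, twice, but at the lower order supplied
    by the induction. *)
Lemma smooth_uptoV k f : (forall x, U x -> f x != 0) ->
  smooth_upto k U f -> smooth_upto k U (fun x => (f x)^-1).
Proof.
move=> fn0.
have f0' : smooth_upto 0 U f -> forall x, U x -> C1_at (fun x => (f x)^-1) x.
  by move=> [f0 _] x Ux; apply: C1_atV; [exact: fn0|exact: f0].
elim: k => [|k IH] fk; move: (fk) => [f0 fS]; split;
  [exact: f0'|exact: I|exact: f0'|].
have {}IH := IH (smooth_uptoW fk).
move=> i; apply: (@eq_on_smooth_upto _
    (- (partial i f * ((fun x => (f x)^-1) * (fun x => (f x)^-1))))).
  move=> x; rewrite inE => Ux; have [_ df] := f0 x Ux.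
  rewrite /partial (deriveV (fn0 _ Ux) (df i)).
  rewrite -[LHS]/(- (_ * (_ * _))) -[RHS]/(_ * _) mulNr mulrC.
  by rewrite -exprVn expr2.
exact: (smooth_uptoN (smooth_uptoM (fS i) (smooth_uptoM IH IH))).
Qed.

End FiniteOrder.

(** * Symmetry of second derivatives *)

Section Schwarz.
Variables (R : realType) (V : normedModType R).
Implicit Types (f : V -> R) (x y u v : V) (h : R).

Lemma is_derive_line f y u s : derivable f (s *: u + y) u ->
  is_derive s 1 (fun t : R => f (t *: u + y)) ('D_u f (s *: u + y)).
Proof.
have E : (fun h : R => h^-1 *: (((fun t : R => f (t *: u + y)) \o shift s) (h *: 1)
           - f (s *: u + y))) =
         (fun h : R => h^-1 *: ((f \o shift (s *: u + y)) (h *: u) - f (s *: u + y))).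
  apply/funext => h /=; congr (_ *: (f _ - _)).
  by rewrite scalerDl [h *: 1]mulr1 addrA.
by move=> df; split; rewrite /derivable /derive E.
Qed.

Lemma MVT_line f y u h : 0 < h ->
  (forall s : R, 0 <= s <= h -> derivable f (s *: u + y) u) ->
  exists2 c : R, 0 <= c <= h & f (h *: u + y) - f y = h * 'D_u f (c *: u + y).
Proof.
move=> h0 df.
have [||c ch] := @MVT_segment R (fun t => f (t *: u + y))
    (fun t => 'D_u f (t *: u + y)) 0 h (ltW h0).
- move=> s; rewrite in_itv /= => /andP[s0 sh]; apply: is_derive_line; apply: df.
  by rewrite !ltW.
- apply: continuous_in_subspaceT => s /[1!inE] /= sh.
  have [ds _] := @is_derive_line f y u s (df s ltac:(by move: sh; rewrite in_itv)).
  exact/differentiable_continuous/derivable1_diffP.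
rewrite scale0r add0r subr0 => E; exists c; first by move: ch; rewrite in_itv.
by rewrite E mulrC.
Qed.

(** The mean value theorem is applied along [u] to the difference of [f] and its translate by
    [h *: v], then along [v] to the derivative ['D_u f]. Only directional derivatives occur. *)
Lemma MVT_square f x u v h : 0 < h ->
  (forall s t : R, 0 <= s <= h -> 0 <= t <= h ->
     derivable f (s *: u + (t *: v + x)) u /\
     derivable ('D_u f) (t *: v + (s *: u + x)) v) ->
  exists c d : R, [/\ 0 <= c <= h, 0 <= d <= h &
   f (h *: u + (h *: v + x)) - f (h *: u + x) - f (h *: v + x) + f x =
   h * (h * 'D_v ('D_u f) (d *: v + (c *: u + x)))].
Proof.
move=> h0 df.
have hh : 0 <= h <= h by rewrite lexx ltW.
have h00 : 0 <= (0 : R) <= h by rewrite lexx ltW.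
have shiftE s : (fun k : R => k^-1 *: (((fun y => f (y + h *: v)) \o shift (s *: u + x)) (k *: u)
      - f (s *: u + x + h *: v))) =
    (fun k : R => k^-1 *: ((f \o shift (s *: u + (h *: v + x))) (k *: u)
      - f (s *: u + (h *: v + x)))).
  by apply/funext => k /=; rewrite -!addrA [x + _]addrC.
have d1 s : 0 <= s <= h -> derivable (fun y => f (y + h *: v)) (s *: u + x) u.
  by move=> sh; have [+ _] := df s h sh hh; rewrite /derivable shiftE.
have d2 s : 0 <= s <= h -> derivable f (s *: u + x) u.
  by move=> sh; have [+ _] := df s 0 sh h00; rewrite scale0r add0r.
have [c ch E] := @MVT_line (fun y => f (y + h *: v) - f y) x u h h0
   (fun s sh => derivableB (d1 s sh) (d2 s sh)).
have [d dh E2] := @MVT_line ('D_u f) (c *: u + x) v h h0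
   (fun t th => proj2 (df c t ch th)).
exists c, d; split=> //; rewrite -E2.
move: E; rewrite [in RHS](deriveB (d1 c ch) (d2 c ch)).
rewrite {1}/derive shiftE -/(derive f (c *: u + (h *: v + x)) u).
rewrite [c *: u + (_ + _)]addrCA -!addrA => <-.
by rewrite [x + h *: v]addrC; ring.
Qed.

(* Each mixed derivative at [x] is a limit of values of it at points where it
   equals the same second difference quotient of [f]. *)
Lemma derive_commute f x u v (U : set V) : open U -> U x ->
  (forall y, U y -> [/\ derivable f y u, derivable f y v,
     derivable ('D_u f) y v & derivable ('D_v f) y u]) ->
  {for x, continuous ('D_v ('D_u f))} -> {for x, continuous ('D_u ('D_v f))} ->
  'D_v ('D_u f) x = 'D_u ('D_v f) x.
Proof.
move=> oU Ux df cvu cuv; apply/eqP; rewrite -subr_eq0 -normr_le0.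
apply/ler_addgt0Pr => e e0; rewrite add0r.
have e2 : 0 < e / 2 by rewrite divr_gt0.
have nU := open_nbhs_nbhs (conj oU Ux).
have n1 : \forall y \near x, `|'D_v ('D_u f) x - 'D_v ('D_u f) y| <= e / 2.
  exact: (cvgrPdist_le _ _).1 cvu _ e2.
have n2 : \forall y \near x, `|'D_u ('D_v f) x - 'D_u ('D_v f) y| <= e / 2.
  exact: (cvgrPdist_le _ _).1 cuv _ e2.
have [r /= r0 xr] := (nbhs_ballP _ _).1 (filterI nU (filterI n1 n2)).
(* The summand 1 keeps [M] positive when [u] and [v] both vanish; with [h = r / (2 M)] the whole
   parallelogram lies in the ball of radius [r]. *)
pose M := `|u| + `|v| + 1.
have M0 : 0 < M by rewrite ltr_wpDl// addr_ge0.
pose h := r / (2 * M).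
have h0 : 0 < h by rewrite divr_gt0 // mulr_gt0.
have hr c d : 0 <= c <= h -> 0 <= d <= h -> ball x r (d *: v + (c *: u + x)).
  move=> /andP[c0 ch] /andP[d0 dh].
  rewrite -ball_normE /ball_ /= addrA opprD addrCA subrr addr0 normrN.
  rewrite (le_lt_trans (ler_normD _ _))// !normrZ !ger0_norm//.
  rewrite (@le_lt_trans _ _ (h * (`|u| + `|v|)))//.
    by rewrite mulrDr addrC lerD// ler_wpM2r.
  rewrite (@lt_trans _ _ (h * M))//; first by rewrite ltr_pM2l// ltrDl.
  by rewrite /h invfM mulrA mulfVK ?gt_eqF// ltr_pdivrMr// ltr_pMr// ltr1n.
have hr' c d : 0 <= c <= h -> 0 <= d <= h -> ball x r (d *: u + (c *: v + x)).
  by move=> ch dh; rewrite addrCA; exact: hr.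
have [|c1 [d1 [c1h d1h E1]]] := @MVT_square f x u v h h0.
  move=> s t sh th; have [U1 _] := xr _ (hr' _ _ th sh).
  have [U2 _] := xr _ (hr _ _ sh th).
  have [D1 _ _ _] := df _ U1; have [_ _ D2 _] := df _ U2.
  exact: conj D1 D2.
have [|c2 [d2 [c2h d2h E2]]] := @MVT_square f x v u h h0.
  move=> s t sh th; have [U1 _] := xr _ (hr _ _ th sh).
  have [U2 _] := xr _ (hr' _ _ sh th).
  have [_ D1 _ _] := df _ U1; have [_ _ _ D2] := df _ U2.
  exact: conj D1 D2.
have eq_scaled (A P Q : R) : A = h * (h * P) -> A = h * (h * Q) -> P = Q.
  have hn0 : h != 0 by rewrite gt_eqF.
  by move=> -> /(mulfI hn0)/(mulfI hn0).
have near_eq (A B P : R) : `|A - P| <= e / 2 -> `|B - P| <= e / 2 -> `|A - B| <= e.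
  move=> AP BP; rewrite -(subrKA P) (le_trans (ler_normD _ _))//.
  by rewrite (splitr e) lerD// distrC.
rewrite [h *: v + (_ + _)]addrCA [X in X + f x]addrAC in E2.
have E := eq_scaled _ _ _ E1 E2.
have [_ [l1 _]] := xr _ (hr _ _ c1h d1h).
have [_ [_ l2]] := xr _ (hr' _ _ c2h d2h).
by apply: near_eq l1 _; rewrite [X in _ - X]E; exact: l2.
Qed.

End Schwarz.

Lemma partialC (R : realType) (m : nat) (U : set 'rV[R]_m) (f : 'rV[R]_m -> R)
    (i j : 'I_m) x : open U -> smooth_on U f -> U x ->
  partial i (partial j f) x = partial j (partial i f) x.
Proof.
move=> oU sf Ux; apply: (@derive_commute _ _ f x _ _ U) => //.
- move=> y Uy; split.
  + by have [_] := sf [::] y Uy; exact.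
  + by have [_] := sf [::] y Uy; exact.
  + by have [_] := sf [:: j] y Uy; exact.
  + by have [_] := sf [:: i] y Uy; exact.
- by have [] := sf [:: i; j] x Ux.
- by have [] := sf [:: j; i] x Ux.
Qed.

(* Smooth functions on [U] are represented by their extensions by 0, so that
   equality on [U] is equality and the ring laws hold unconditionally. *)
Definition smooth_ext0 (R : realType) (m : nat) (U : set 'rV[R]_m) :
    {pred ('rV[R]_m -> R)} :=
  fun f => `[< smooth_on U f /\ forall x, ~ U x -> f x = 0 >].

Record smfun (R : realType) (m : nat) (U : set 'rV[R]_m) (openU : open U) :=
  SmFun { smfun_val :> 'rV[R]_m -> R ; _ : smfun_val \in smooth_ext0 U }.

HB.instance Definition _ R m U openU :=
  [isSub for @smfun_val R m U openU].
HB.instance Definition _ R m U openU :=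
  [Choice of @smfun R m U openU by <:].

(** * The differential ring of smooth functions on an open set *)

Section SmoothRing.
Variables (R : realType) (m : nat) (U : set 'rV[R]_m) (openU : open U).
Notation A := (smfun openU).
Implicit Types (f g : 'rV[R]_m -> R) (a b : A) (i j : 'I_m).

Lemma smooth_ext0P f :
  reflect (smooth_on U f /\ forall x, ~ U x -> f x = 0) (f \in smooth_ext0 U).
Proof. exact: asboolP. Qed.

Lemma smooth_ext0_zmod : zmod_closed (smooth_ext0 U).
Proof.
split=> [|f g /smooth_ext0P[sf f0] /smooth_ext0P[sg g0]]; apply/smooth_ext0P.
  split=> //; apply/smooth_uptoP => k; exact: smooth_upto_cst.
split=> [|x Ux]; last by rewrite -[LHS]/(f x - g x) f0// g0// subr0.
move/smooth_uptoP: sf => sf; move/smooth_uptoP: sg => sg.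
apply/smooth_uptoP => k.
exact: smooth_uptoD openU _ _ _ (sf k) (smooth_uptoN openU (sg k)).
Qed.

HB.instance Definition _ :=
  GRing.isZmodClosed.Build ('rV[R]_m -> R) (smooth_ext0 U) smooth_ext0_zmod.
HB.instance Definition _ := [SubChoice_isSubZmodule of A by <:].

Lemma smooth_ext0M f g :
  f \in smooth_ext0 U -> g \in smooth_ext0 U -> f * g \in smooth_ext0 U.
Proof.
move=> /smooth_ext0P[sf f0] /smooth_ext0P[sg g0]; apply/smooth_ext0P.
split=> [|x Ux]; last by rewrite -[LHS]/(f x * g x) f0// mul0r.
move/smooth_uptoP: sf => sf; move/smooth_uptoP: sg => sg.
apply/smooth_uptoP => k; exact: smooth_uptoM openU _ _ _ (sf k) (sg k).
Qed.

Definition ext0 f : 'rV[R]_m -> R := fun x => if `[< U x >] then f x else 0.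

Lemma ext0E f x : U x -> ext0 f x = f x.
Proof. by rewrite /ext0 => Ux; case: asboolP. Qed.

Lemma ext0_out f x : ~ U x -> ext0 f x = 0.
Proof. by rewrite /ext0 => Ux; case: asboolP. Qed.

Lemma ext0_smooth f : smooth_on U f -> ext0 f \in smooth_ext0 U.
Proof.
move=> sf; apply/smooth_ext0P; split; last exact: ext0_out.
by apply: (eq_on_smooth openU _ sf) => x /[1!inE] Ux; rewrite ext0E.
Qed.

Definition smfun_of f (sf : smooth_on U f) : A := SmFun openU (ext0_smooth sf).

Lemma smfun_ofE f (sf : smooth_on U f) x : U x -> smfun_of sf x = f x.
Proof. exact: ext0E. Qed.

Lemma smfun_smooth a : smooth_on U a.
Proof. by case: a => f /= /smooth_ext0P[]. Qed.

Lemma smfun_out a x : ~ U x -> a x = 0.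
Proof. by case: a => f /= /smooth_ext0P[_]; exact. Qed.

Lemma smfunP a b : (forall x, U x -> a x = b x) -> a = b.
Proof.
move=> ab; apply/val_inj/funext => x.
by case: (pselect (U x)) => Ux; [exact: ab|rewrite /= !smfun_out].
Qed.

Lemma smooth_cst (c : R) : smooth_on U (cst c).
Proof. by apply/smooth_uptoP => k; exact: smooth_upto_cst. Qed.

Definition scst (c : R) : A := smfun_of (smooth_cst c).

Lemma scstE c x : U x -> scst c x = c.
Proof. exact: smfun_ofE. Qed.

Definition smul a b : A := SmFun openU (smooth_ext0M (valP a) (valP b)).

Lemma smulE a b x : smul a b x = a x * b x. Proof. by []. Qed.
Lemma saddE a b x : (a + b) x = a x + b x. Proof. by []. Qed.

Fact smulA : associative smul.
Proof. by move=> a b c; apply: smfunP => x Ux; rewrite !smulE mulrA. Qed.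
Fact smulC : commutative smul.
Proof. by move=> a b; apply: smfunP => x Ux; rewrite !smulE mulrC. Qed.
Fact smul1 : left_id (scst 1) smul.
Proof. by move=> a; apply: smfunP => x Ux; rewrite smulE scstE// mul1r. Qed.
Fact smulD : left_distributive smul +%R.
Proof. by move=> a b c; apply: smfunP => x Ux; rewrite !smulE !saddE mulrDl. Qed.

(** For empty [U] this is the zero ring, so 1 = 0 has to be allowed. *)
HB.instance Definition _ :=
  GRing.Zmodule_isComPzRing.Build A smulA smulC smul1 smulD.

(** The unit of the ring is the indicator function of [U], so evaluation is a ring morphism only at
    points of [U]; hence the proof argument. *)
Definition ev x (Ux : U x) : A -> R := fun a => a x.

Fact ev_zmod x (Ux : U x) : zmod_morphism (ev Ux). Proof. by []. Qed.
Fact ev_monoid x (Ux : U x) : monoid_morphism (ev Ux).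
Proof. by split=> //; exact: scstE. Qed.

HB.instance Definition _ x (Ux : U x) :=
  GRing.isZmodMorphism.Build A R (ev Ux) (ev_zmod Ux).
HB.instance Definition _ x (Ux : U x) :=
  GRing.isMonoidMorphism.Build A R (ev Ux) (ev_monoid Ux).

Lemma evP a b : (forall x (Ux : U x), ev Ux a = ev Ux b) -> a = b.
Proof. by move=> ab; apply: smfunP => x Ux; exact: (ab x Ux). Qed.

Lemma partial_smooth i f : smooth_on U f -> smooth_on U (partial i f).
Proof.
move=> /smooth_uptoP sf; apply/smooth_uptoP => k.
by have [_ /(_ i)] := sf k.+1.
Qed.

Definition sder i a : A := smfun_of (partial_smooth i (smfun_smooth a)).

Lemma sderE i a x : U x -> sder i a x = partial i a x.
Proof. exact: smfun_ofE. Qed.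

Lemma smooth_derivable f i x : smooth_on U f -> U x ->
  derivable f x (delta_mx 0 i).
Proof. by move=> sf Ux; have [_] := sf [::] x Ux; exact. Qed.

Fact sder_zmod i : zmod_morphism (sder i).
Proof.
move=> a b; apply: smfunP => x Ux.
rewrite -[RHS]/(sder i a x - sder i b x) !(sderE i _ Ux) /partial.
by rewrite -(deriveB (smooth_derivable (i := i) (smfun_smooth a) Ux)
                     (smooth_derivable (i := i) (smfun_smooth b) Ux)).
Qed.

HB.instance Definition _ i := GRing.isZmodMorphism.Build A A (sder i) (sder_zmod i).

Lemma sderM i a b : sder i (a * b) = sder i a * b + a * sder i b.
Proof.
apply: smfunP => x Ux.
rewrite -[RHS]/(sder i a x * b x + a x * sder i b x) !(sderE i _ Ux) /partial.
rewrite (deriveM (smooth_derivable (i := i) (smfun_smooth a) Ux)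
                 (smooth_derivable (i := i) (smfun_smooth b) Ux)).
by rewrite addrC mulrC.
Qed.

Lemma partial_smfun_of f (sf : smooth_on U f) i x : U x ->
  partial i (smfun_of sf) x = partial i f x.
Proof.
move=> Ux; apply: (eq_on_partial openU); last by rewrite inE.
by move=> y /[1!inE] Uy; exact: smfun_ofE.
Qed.

Lemma sderC i j a : sder i (sder j a) = sder j (sder i a).
Proof.
apply: smfunP => x Ux; rewrite (sderE i _ Ux) (sderE j _ Ux).
rewrite (partial_smfun_of _ i Ux) (partial_smfun_of _ j Ux).
exact: (partialC i j openU (smfun_smooth a) Ux).
Qed.

Lemma sder_scst i c : sder i (scst c) = 0.
Proof.
apply: smfunP => x Ux; rewrite (sderE i _ Ux) (partial_smfun_of _ i Ux).
by rewrite /partial derive_cst.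
Qed.

Lemma scst_zmod : zmod_morphism scst.
Proof.
by move=> c d; apply: smfunP => x Ux; rewrite -[RHS]/(scst c x - scst d x) !scstE.
Qed.

Lemma scst_monoid : monoid_morphism scst.
Proof.
by split=> // c d; apply: smfunP => x Ux; rewrite -[RHS]/(scst c x * scst d x) !scstE.
Qed.

HB.instance Definition _ := GRing.isZmodMorphism.Build R A scst scst_zmod.
HB.instance Definition _ := GRing.isMonoidMorphism.Build R A scst scst_monoid.

Lemma ev_scst x (Ux : U x) c : ev Ux (scst c) = c. Proof. exact: scstE. Qed.

(** The form in which characteristic zero enters the abstract theory of immersions: derivatives of
    squared lengths produce a term twice. *)
Lemma smfun_double_eq0 a : a + a = 0 -> a = 0.
Proof.
move=> a0; apply: evP => x Ux; rewrite rmorph0.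
by have /(congr1 (ev Ux)) := a0; rewrite rmorphD rmorph0 => ?; lra.
Qed.

Lemma smooth_inv a : (forall x, U x -> a x != 0) ->
  smooth_on U (fun x => (a x)^-1).
Proof.
move=> a0; have /smooth_uptoP sa := smfun_smooth a.
by apply/smooth_uptoP => k; exact: smooth_uptoV.
Qed.

End SmoothRing.

Arguments ev : simpl never.
Arguments sder : simpl never.
Arguments scst : simpl never.
Arguments smfun_of : simpl never.

(** * The Simons identity *)

Lemma map_mx_leibniz (A : comPzRingType) (D : {additive A -> A})
    (DM : forall a b, D (a * b) = D a * b + a * D b)
    p q r (X : 'M[A]_(p, q)) (Y : 'M[A]_(q, r)) :
  map_mx D (X *m Y) = map_mx D X *m Y + X *m map_mx D Y.
Proof.
apply/matrixP => i j; rewrite !mxE raddf_sum -big_split /=.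
by apply: eq_bigr => k _; rewrite DM !mxE.
Qed.

Section Simons.
(** In the application [D al] differentiates along the tangential part of the al-th ambient basis
    vector, [P] is the tangent projection, [F] the position, [H] a parallel normal field and [S] its
    shape operator, extended by zero. [D_comm] is then the Lie bracket of two such fields, computed
    in ambient coordinates. *)
Variables (A : comPzRingType) (N : nat) (D : 'I_N -> {additive A -> A}).
Hypothesis DM : forall al a b, D al (a * b) = D al a * b + a * D al b.
Variables (P S : 'M[A]_N) (F H : 'rV[A]_N) (kap th mu c : A).
Hypothesis P_sym : P^T = P.
Hypothesis P_idem : P *m P = P.
Hypothesis P_D : forall al f, \sum_ga P al ga * D ga f = D al f.
Hypothesis D_comm : forall al be f, D al (D be f) - D be (D al f) =
  \sum_ga (D al (P be ga) - D be (P al ga)) * D ga f.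
Hypothesis DF : forall al be, D al (F 0 be) = P al be.

Local Notation b ga := (map_mx (D ga) P).
Local Notation DS ga := (map_mx (D ga) S).

Let map_mxM_D ga p q r (X : 'M[A]_(p, q)) (Y : 'M[A]_(q, r)) :
  map_mx (D ga) (X *m Y) = map_mx (D ga) X *m Y + X *m map_mx (D ga) Y.
Proof. exact: (map_mx_leibniz (@DM ga)). Qed.

Lemma proj_der ga : b ga = b ga *m P + P *m b ga.
Proof. by rewrite -{1}P_idem map_mxM_D. Qed.

(** Compressing the derivative of [P *m P = P] by [P] on both sides gives twice the term on the
    right. Thus the derivative of the projection exchanges tangent and normal directions. *)
Lemma PbP ga : P *m b ga *m P = 0.
Proof.
have := congr1 (fun M => P *m M *m P) (proj_der ga).
rewrite /= mulmxDr mulmxDl !mulmxA P_idem -[_ *m P *m P]mulmxA P_idem.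
by move/esym; rewrite -[RHS]addr0 => /addrI.
Qed.

Lemma b_sym ga : (b ga)^T = b ga.
Proof. by rewrite map_trmx P_sym. Qed.

(** Row [al] of [P *m b ga] is the second fundamental form of the tangential parts of the basis
    vectors [al] and [ga]. By [D_comm] for the coordinates of [F] its antisymmetric part factors
    through [b] times [P], and [PbP] kills the compression. *)
Lemma second_form_sym al ga ep :
  (P *m b ga) al ep = (P *m b al) ga ep.
Proof.
have PE x y : (P *m b x) y ep = \sum_x' \sum_y' P x x' * (P y y' * D x' (P y' ep)).
  rewrite mxE.
  under eq_bigr => y' _ do rewrite mxE -P_D big_distrr /=.
  by rewrite exchange_big /=; do 2!apply: eq_bigr => ? _; rewrite mulrCA.
have zero x y : \sum_x' \sum_y' P x x' * (P y y' * \sum_ze D x' (P y' ze) * P ze ep) = 0.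
  rewrite big1 // => x' _; rewrite -big_distrr /=.
  have /matrixP/(_ y ep) := PbP x'; rewrite -mulmxA !mxE => PbP0.
  rewrite (eq_bigr (fun y' => P y y' * (b x' *m P) y' ep)) ?PbP0 ?mulr0 //.
  by move=> y' _; rewrite mxE; congr (_ * _); apply: eq_bigr => z _; rewrite !mxE.
apply/eqP; rewrite -subr_eq0 !PE [X in _ - X]exchange_big /=.
rewrite -sumrB; under eq_bigr => x' _ do rewrite -sumrB.
rewrite (eq_bigr (fun x' => \sum_y' P ga x' * (P al y' * \sum_ze D x' (P y' ze) * P ze ep)
   - \sum_y' P ga x' * (P al y' * \sum_ze D y' (P x' ze) * P ze ep))).
  rewrite sumrB zero sub0r exchange_big /= oppr_eq0; apply/eqP.
  rewrite -[RHS](zero al ga).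
  by do 2!apply: eq_bigr => ? _; rewrite mulrCA.
move=> x' _; rewrite -sumrB; apply: eq_bigr => y' _.
rewrite [P al y' * (P ga x' * _)]mulrCA -!mulrBr.
have := D_comm x' y' (F 0 ep); rewrite !DF => ->.
rewrite -sumrB; congr (_ * (_ * _)); apply: eq_bigr => ze _.
by rewrite DF mulrBl.
Qed.

(** [D ze] sees only the tangential part of the index [ze], so [b al] may be replaced by
    [b al *m P], the transpose of [P *m b al], to which [second_form_sym] applies. *)
Lemma second_form_swap (f : 'I_N -> A) al :
  \sum_ze \sum_ga D al (P ga ze) * D ze (f ga) =
  \sum_ze \sum_ga (P *m b ze) al ga * D ze (f ga).
Proof.
transitivity (\sum_ze' \sum_ga (b al *m P) ga ze' * D ze' (f ga)).
  rewrite exchange_big [RHS]exchange_big /=; apply: eq_bigr => ga _.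
  transitivity (\sum_ze \sum_ze' D al (P ga ze) * (P ze ze' * D ze' (f ga))).
    by apply: eq_bigr => ze _; rewrite -(P_D ze (f ga)) big_distrr.
  rewrite exchange_big /=; apply: eq_bigr => ze' _.
  by rewrite mxE big_distrl /=; apply: eq_bigr => ze _; rewrite mulrA mxE.
apply: eq_bigr => ze _; apply: eq_bigr => ga _; congr (_ * _).
have -> : b al *m P = (P *m b al)^T by rewrite trmx_mul b_sym P_sym.
by rewrite [LHS]mxE second_form_sym.
Qed.

(** Commutes a divergence with differentiation along the tangent vector [u], held undifferentiated.
    One half of the commutator vanishes by [PbP]; [second_form_swap] rewrites the other. *)
Lemma div_comm (u : 'rV[A]_N) (f : 'I_N -> A) : u *m P = u ->
  \sum_ga \sum_al u 0 al * D ga (D al (f ga)) =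
  \sum_al u 0 al * D al (\sum_ga D ga (f ga))
  - \sum_ze \sum_ga (u *m b ze) 0 ga * D ze (f ga).
Proof.
move=> uP.
have ubP ga ze : \sum_al u 0 al * \sum_ze' D ga (P al ze') * P ze' ze = 0.
  transitivity ((u *m (b ga *m P)) 0 ze).
    rewrite [RHS]mxE; apply: eq_bigr => al _; congr (_ * _); rewrite [RHS]mxE.
    by apply: eq_bigr => ze' _; rewrite mxE.
  by rewrite -{1}uP -mulmxA [P *m _]mulmxA PbP mulmx0 mxE.
have E1 ga : \sum_al u 0 al * D ga (D al (f ga)) =
   \sum_al u 0 al * D al (D ga (f ga))
   - \sum_al u 0 al * \sum_ze D al (P ga ze) * D ze (f ga).
  have E al : D ga (D al (f ga)) = D al (D ga (f ga))
       + (\sum_ze D ga (P al ze) * D ze (f ga) - \sum_ze D al (P ga ze) * D ze (f ga)).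
    rewrite -sumrB -[LHS](subrK (D al (D ga (f ga)))) D_comm addrC; congr (_ + _).
    by apply: eq_bigr => ze _; rewrite mulrBl.
  under eq_bigr => al _ do rewrite E mulrDr mulrBr.
  rewrite big_split sumrB /= [X in _ + (X - _)](_ : _ = 0) ?sub0r //.
  transitivity (\sum_ze (\sum_al u 0 al * \sum_ze' D ga (P al ze') * P ze' ze) * D ze (f ga)).
    under eq_bigr => al _.
      under eq_bigr => ze' _ do rewrite -(P_D ze' (f ga)) big_distrr /=.
      rewrite exchange_big big_distrr /=.
    over.
    rewrite exchange_big /=; apply: eq_bigr => ze _.
    rewrite big_distrl /=; apply: eq_bigr => al _.
    rewrite -mulrA; congr (_ * _); rewrite big_distrl /=.
    by apply: eq_bigr => ze' _; rewrite mulrA.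
  by rewrite big1 // => ze _; rewrite ubP mul0r.
rewrite (eq_bigr _ (fun ga _ => E1 ga)) sumrB; congr (_ - _).
  rewrite exchange_big /=; apply: eq_bigr => al _.
  by rewrite raddf_sum big_distrr.
transitivity (\sum_al u 0 al * \sum_ze \sum_ga D al (P ga ze) * D ze (f ga)).
  rewrite exchange_big /=; apply: eq_bigr => al _.
  by rewrite -big_distrr exchange_big.
under eq_bigr => al _ do rewrite second_form_swap big_distrr /=.
rewrite exchange_big /=; apply: eq_bigr => ze _.
under eq_bigr => al _ do rewrite big_distrr /=.
rewrite exchange_big /=; apply: eq_bigr => ga _.
rewrite -{2}uP -mulmxA [in RHS]mxE big_distrl /=.
by apply: eq_bigr => al _; rewrite mulrA.
Qed.

(** No normal term appears because the field is parallel. In view of [DH] and [DF], [divS]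
    prescribes minus the Laplacian of [H] and [divP] the Laplacian of [F]. *)
Hypothesis DH : forall al be, D al (H 0 be) = - S al be.
Hypothesis S_sym : S^T = S.
Hypothesis SP : S *m P = S.
Hypothesis Dkap : forall al, D al kap = 0.
Hypothesis Dth : forall al, D al th = 0.
Hypothesis Dmu : forall al, D al mu = 0.
Hypothesis Dc : forall al, D al c = 0.
Hypothesis divS : forall be,
  \sum_ga D ga (S ga be) = kap * H 0 be - th * F 0 be.
Hypothesis divP : forall be,
  \sum_ga D ga (P ga be) = mu * H 0 be - c * F 0 be.
Hypothesis trSDS : forall ga, \tr (S *m DS ga) = 0.

(** The covariant derivative of the shape operator. *)
Let E ga := P *m DS ga *m P.

Lemma PS : P *m S = S.
Proof. by apply: trmx_inj; rewrite trmx_mul P_sym S_sym SP. Qed.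

(** Differentiating S = P S P: two off-diagonal blocks come from the motion of the projection, the
    tangential block is the covariant derivative. *)
Lemma DS_split ga : DS ga = b ga *m S + (S *m b ga + E ga).
Proof.
rewrite -{1}PS map_mxM_D; congr (_ + _).
by rewrite -{1}SP map_mxM_D mulmxDr mulmxA mulmxA PS addrC.
Qed.

Lemma SbP ga : S *m b ga *m P = 0.
Proof. by rewrite -SP -!mulmxA [P *m (_ *m P)]mulmxA PbP mulmx0. Qed.

Lemma PbS ga : P *m b ga *m S = 0.
Proof. by rewrite -PS mulmxA PbP mul0mx. Qed.

Lemma SbS ga : S *m b ga *m S = 0.
Proof. by rewrite -[X in _ *m X]PS mulmxA SbP mul0mx. Qed.

Lemma SbE ga : S *m b ga *m E ga = 0.
Proof. by rewrite /E !mulmxA SbP !mul0mx. Qed.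

Lemma EbS ga : E ga *m b ga *m S = 0.
Proof. by rewrite /E -!mulmxA [P *m (_ *m S)]mulmxA PbS !mulmx0. Qed.

(** The squared norm of [b ga *m S]; it occurs with opposite signs in [tr_DSDS] and [tr_SDDS]. *)
Let X ga := \tr (S *m b ga *m b ga *m S).

Lemma tr_SbDS ga : \tr (S *m b ga *m DS ga) = X ga.
Proof.
by rewrite DS_split !mulmxDr SbE addr0 [_ *m (S *m _)]mulmxA SbS mul0mx addr0 mulmxA.
Qed.

Lemma tr_bSDS ga : \tr (b ga *m S *m DS ga) = X ga.
Proof.
rewrite DS_split !mulmxDr !linearD /=.
have -> : \tr (b ga *m S *m (b ga *m S)) = 0.
  by rewrite -mulmxA [S *m (_ *m S)]mulmxA SbS mulmx0 linear0.
have -> : \tr (b ga *m S *m E ga) = 0.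
  by rewrite mxtrace_mulC mulmxA EbS linear0.
by rewrite add0r addr0 mxtrace_mulC !mulmxA.
Qed.

Lemma tr_DSDS ga : \tr (DS ga *m DS ga) = X ga *+ 2 + \tr (E ga *m E ga).
Proof.
rewrite {1}DS_split !mulmxDl !linearD /= tr_bSDS tr_SbDS mulr2n -addrA.
congr (_ + (_ + _)).
rewrite DS_split !mulmxDr !linearD /=.
rewrite [\tr (E ga *m (b ga *m S))](_ : _ = 0) ?add0r; last first.
  by rewrite mulmxA EbS linear0.
rewrite [\tr (E ga *m (S *m _))](_ : _ = 0) ?add0r //.
by rewrite mxtrace_mulC SbE linear0.
Qed.

(** Obtained by differentiating once more the vanishing trace of [S *m S *m b ga]. *)
Lemma tr_SSDb ga : \tr (S *m S *m map_mx (D ga) (b ga)) = - (X ga *+ 2).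
Proof.
have tr0 : \tr (S *m S *m b ga) = 0.
  by rewrite -mulmxA mxtrace_mulC SbS linear0.
have : D ga (\tr (S *m S *m b ga)) = 0 by rewrite tr0 raddf0.
have -> : D ga (\tr (S *m S *m b ga)) = \tr (map_mx (D ga) (S *m S *m b ga)).
  by rewrite /mxtrace raddf_sum; apply: eq_bigr => i _; rewrite [RHS]mxE.
rewrite !map_mxM_D mulmxDl !linearD /=.
have -> : \tr (DS ga *m S *m b ga) = X ga.
  by rewrite -mulmxA mxtrace_mulC tr_SbDS.
have -> : \tr (S *m DS ga *m b ga) = X ga.
  by rewrite mxtrace_mulC mulmxA tr_bSDS.
by rewrite -mulr2n => /eqP; rewrite addrC addr_eq0 => /eqP.
Qed.

Lemma mxtrace_mul (B C : 'M[A]_N) :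
  \tr (B *m C) = \sum_i \sum_j B i j * C j i.
Proof. by apply: eq_bigr => i _; rewrite mxE. Qed.

(* By the Codazzi equation [D_ga S_(al,be)] is [D_al S_(ga,be)] up to the
   commutator of [D_ga] and [D_al]; W1, ..., W5 are the sums that arise when
   this is substituted into [D_ga (D_ga S)]. *)
Lemma tr_SDDS :
  \sum_ga \tr (S *m map_mx (D ga) (DS ga)) =
  - (kap * \tr (S *m S)) - th * \tr S + mu * \tr (S *m S *m S)
  + c * \tr (S *m S) - \sum_ga X ga *+ 2.
Proof.
have S_C i j : S i j = S j i by rewrite -{1}S_sym mxE.
have P_C i j : P i j = P j i by rewrite -{1}P_sym mxE.
(* [D_comm] for the coordinates of [H], whose first derivatives are the entries of [- S]. *)
have codazzi ga al be : D ga (S al be) =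
    D al (S ga be) + \sum_ep (D ga (P al ep) - D al (P ga ep)) * S ep be.
  have := D_comm ga al (H 0 be); rewrite !DH !raddfN /= opprK.
  under eq_bigr => ep _ do rewrite DH mulrN.
  by rewrite sumrN -[X in _ = _ + X]opprK => <-; ring.
(* The rows of [S] are tangent vectors, so [div_comm] brings in the divergence of [S]; [divS]
   supplies the terms with [kap] and [th]. *)
have W1 : \sum_be \sum_ga \sum_al S be al * D ga (D al (S ga be)) =
    - (kap * \tr (S *m S)) - th * \tr S - \sum_ga X ga.
  have rowP be : row be S *m P = row be S by rewrite -row_mul SP.
  have E1 be : \sum_ga \sum_al S be al * D ga (D al (S ga be)) =
      \sum_al S be al * (- kap * S al be - th * P al be)
      - \sum_ga \sum_al (S *m b ga) be al * DS ga al be.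
    have := div_comm (fun ga => S ga be) (rowP be).
    under eq_bigr => ga _ do under eq_bigr => al _ do rewrite mxE.
    move=> ->; congr (_ - _); last first.
      by do 2!apply: eq_bigr => ? _; rewrite -row_mul !mxE.
    apply: eq_bigr => al _; rewrite mxE divS raddfB /= !DM Dkap Dth DH DF.
    by rewrite !mul0r !add0r mulNr mulrN.
  rewrite (eq_bigr _ (fun be _ => E1 be)) sumrB; congr (_ - _); last first.
    rewrite exchange_big /=; apply: eq_bigr => ga _.
    by rewrite -tr_SbDS mxtrace_mul.
  rewrite -[X in _ - th * \tr X]SP !mxtrace_mul !big_distrr /= -sumrN -sumrB.
  apply: eq_bigr => be _; rewrite !big_distrr /= -sumrN -sumrB.
  by apply: eq_bigr => al _; rewrite P_C; ring.
(* The same with the rows of [S *m S] and the divergence of [P]; [divP] supplies the terms with [mu]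
   and [c]. *)
have W2 : \sum_ep \sum_ga \sum_al (S *m S) ep al * D ga (D al (P ga ep)) =
    - (mu * \tr (S *m S *m S)) - c * \tr (S *m S) - \sum_ga X ga.
  have rowP ep : row ep (S *m S) *m P = row ep (S *m S).
    by rewrite -row_mul -mulmxA SP.
  have E1 ep : \sum_ga \sum_al (S *m S) ep al * D ga (D al (P ga ep)) =
      \sum_al (S *m S) ep al * (- mu * S al ep - c * P al ep)
      - \sum_ga \sum_al (S *m S *m b ga) ep al * b ga al ep.
    have := div_comm (fun ga => P ga ep) (rowP ep).
    under eq_bigr => ga _ do under eq_bigr => al _ do rewrite mxE.
    move=> ->; congr (_ - _); last first.
      by do 2!apply: eq_bigr => ? _; rewrite -row_mul ![row _ _ _ _]mxE [b _ _ _]mxE.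
    apply: eq_bigr => al _; rewrite [row _ _ _ _]mxE divP raddfB /= !DM Dmu Dc DH DF.
    by rewrite !mul0r !add0r mulNr mulrN.
  rewrite (eq_bigr _ (fun ep _ => E1 ep)) sumrB; congr (_ - _); last first.
    rewrite exchange_big /=; apply: eq_bigr => ga _.
    by rewrite /X mxtrace_mulC !mulmxA mxtrace_mul.
  rewrite -[X in _ - c * \tr (_ *m X)]SP mulmxA [\tr (S *m S *m S)]mxtrace_mul.
  rewrite [\tr (S *m S *m P)]mxtrace_mul !big_distrr /= -sumrN -sumrB.
  apply: eq_bigr => ep _; rewrite !big_distrr /= -sumrN -sumrB.
  by apply: eq_bigr => al _; ring.
(* Both halves of the commutator give the same sum, by [second_form_swap]. *)
have W3 : \sum_be \sum_ga \sum_al S be al *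
      \sum_ep (D ga (P al ep) - D al (P ga ep)) * D ga (S ep be) = 0.
  have E1 be : \sum_al S be al *
      \sum_ga \sum_ep D al (P ga ep) * D ga (S ep be) =
      \sum_ga \sum_ep (S *m b ga) be ep * D ga (S ep be).
    have E2 al : \sum_ga \sum_ep D al (P ga ep) * D ga (S ep be) =
        \sum_ga \sum_ep (P *m b ga) al ep * D ga (S ep be).
      rewrite -second_form_swap; do 2!apply: eq_bigr => ? _.
      by rewrite P_C.
    under eq_bigr => al _ do rewrite E2 big_distrr /=.
    rewrite exchange_big /=; apply: eq_bigr => ga _.
    under eq_bigr => al _ do rewrite big_distrr /=.
    rewrite exchange_big /=; apply: eq_bigr => ep _.
    have -> : S *m b ga = S *m (P *m b ga) by rewrite mulmxA SP.
    rewrite [(S *m _) be ep]mxE big_distrl /=.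
    by apply: eq_bigr => al _; rewrite mulrA.
  rewrite big1 // => be _.
  have -> : \sum_ga \sum_al S be al *
      (\sum_ep (D ga (P al ep) - D al (P ga ep)) * D ga (S ep be)) =
      \sum_ga \sum_ep (S *m b ga) be ep * D ga (S ep be) -
      \sum_al S be al * \sum_ga \sum_ep D al (P ga ep) * D ga (S ep be).
    have -> : \sum_al S be al * \sum_ga \sum_ep D al (P ga ep) * D ga (S ep be) =
        \sum_ga \sum_al S be al * \sum_ep D al (P ga ep) * D ga (S ep be).
      under eq_bigr => al _ do rewrite big_distrr /=.
      by rewrite exchange_big.
    rewrite -sumrB; apply: eq_bigr => ga _.
    under eq_bigr => al _.
      under eq_bigr => ep _ do rewrite mulrBl.
      rewrite sumrB mulrBr.
    over.
    rewrite sumrB; congr (_ - _).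
    under eq_bigr => al _ do rewrite big_distrr /=.
    rewrite exchange_big /=; apply: eq_bigr => ep _.
    rewrite [in RHS]mxE big_distrl /=.
    by apply: eq_bigr => al _; rewrite mxE mulrA.
  by rewrite E1 subrr.
have triple (B : 'M[A]_N) : \tr (S *m S *m B) =
    \sum_be \sum_al S be al * \sum_ep B al ep * S ep be.
  rewrite -mulmxA mxtrace_mulC -mulmxA.
  rewrite mxtrace_mul; do 2!apply: eq_bigr => ? _.
  by rewrite mxE.
have W4 : \sum_be \sum_ga \sum_al S be al *
      \sum_ep D ga (D ga (P al ep)) * S ep be = - \sum_ga X ga *+ 2.
  rewrite exchange_big -sumrN /=; apply: eq_bigr => ga _.
  rewrite -tr_SSDb triple; do 2!apply: eq_bigr => ? _.
  by congr (_ * _); apply: eq_bigr => ? _; rewrite !mxE.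
have W5 : \sum_be \sum_ga \sum_al S be al *
      \sum_ep D ga (D al (P ga ep)) * S ep be =
    - (mu * \tr (S *m S *m S)) - c * \tr (S *m S) - \sum_ga X ga.
  rewrite -W2 exchange_big [RHS]exchange_big /=; apply: eq_bigr => ga _.
  pose B := \matrix_(al, ep) D ga (D al (P ga ep)).
  transitivity (\tr (S *m S *m B)).
    rewrite triple; do 2!apply: eq_bigr => ? _.
    by congr (_ * _); apply: eq_bigr => ? _; rewrite [B _ _]mxE.
  rewrite mxtrace_mul; do 2!apply: eq_bigr => ? _.
  by rewrite [B _ _]mxE.
have W ga : \tr (S *m map_mx (D ga) (DS ga)) =
    \sum_be \sum_al S be al * (D ga (D al (S ga be)) +
     (\sum_ep D ga (D ga (P al ep)) * S ep be -
      \sum_ep D ga (D al (P ga ep)) * S ep be +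
      \sum_ep (D ga (P al ep) - D al (P ga ep)) * D ga (S ep be))).
  rewrite mxtrace_mul; do 2!apply: eq_bigr => ? _; congr (_ * _).
  rewrite !mxE [in LHS]codazzi raddfD raddf_sum /=; congr (_ + _).
  rewrite -sumrB -big_split /=; apply: eq_bigr => ep _.
  by rewrite DM raddfB /= mulrBl.
transitivity (\sum_be \sum_ga \sum_al S be al * D ga (D al (S ga be)) +
  (\sum_be \sum_ga \sum_al S be al * \sum_ep D ga (D ga (P al ep)) * S ep be -
   \sum_be \sum_ga \sum_al S be al * \sum_ep D ga (D al (P ga ep)) * S ep be +
   \sum_be \sum_ga \sum_al S be al *
      \sum_ep (D ga (P al ep) - D al (P ga ep)) * D ga (S ep be))).
  rewrite (eq_bigr _ (fun ga _ => W ga)) exchange_big /=.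
  rewrite -sumrB -!big_split /=; apply: eq_bigr => be _.
  rewrite -sumrB -!big_split /=; apply: eq_bigr => ga _.
  rewrite -sumrB -!big_split /=; apply: eq_bigr => al _.
  by rewrite !mulrDr mulrN.
rewrite W1 W3 W4 W5 sumrMnl; ring.
Qed.

(** The Laplacian of half the trace of [S *m S] is zero; it splits into the squared norm of the
    derivative of [S] and the product of [S] with its Laplacian, and the terms [X] cancel between
    the two. *)
Theorem simons_identity :
  \sum_ga \tr (E ga *m E ga) =
  kap * \tr (S *m S) + th * \tr S - mu * \tr (S *m S *m S) - c * \tr (S *m S).
Proof.
have : \sum_ga D ga (\tr (S *m DS ga)) = 0.
  by rewrite big1 // => ga _; rewrite trSDS raddf0.
have EW ga : D ga (\tr (S *m DS ga)) =
    \tr (DS ga *m DS ga) + \tr (S *m map_mx (D ga) (DS ga)).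
  rewrite -linearD -map_mxM_D /mxtrace raddf_sum.
  by apply: eq_bigr => i _; rewrite [RHS]mxE.
rewrite (eq_bigr _ (fun ga _ => EW ga)) big_split /= tr_SDDS.
rewrite (eq_bigr _ (fun ga _ => tr_DSDS ga)) big_split /= => E0.
move: E0; set x := \sum_ga X ga *+ 2; set e := \sum_ga \tr (E ga *m E ga).
move=> E0.
apply/eqP; rewrite -subr_eq0 -{}E0; apply/eqP; ring.
Qed.

End Simons.

(** * Isometric immersions into spheres *)

Section InnerProduct.
Variables (A : comPzRingType) (n : nat).
Implicit Types (u v w : 'rV[A]_n) (a : A).

(** [dot] over an arbitrary commutative ring; over the reals the two are convertible. *)
Definition ip u v : A := (u *m v^T) 0 0.

Lemma ipE u v : ip u v = \sum_k u 0 k * v 0 k.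
Proof. by rewrite /ip mxE; apply: eq_bigr => k _; rewrite mxE. Qed.

Lemma ipC u v : ip u v = ip v u.
Proof. by rewrite !ipE; apply: eq_bigr => k _; rewrite mulrC. Qed.

Lemma ipDl u v w : ip (u + v) w = ip u w + ip v w.
Proof. by rewrite /ip mulmxDl mxE. Qed.

Lemma ipNl u w : ip (- u) w = - ip u w.
Proof. by rewrite /ip mulNmx mxE. Qed.

Lemma ipZl a u w : ip (a *: u) w = a * ip u w.
Proof. by rewrite /ip -scalemxAl mxE. Qed.

Lemma ip0l w : ip 0 w = 0.
Proof. by rewrite /ip mul0mx mxE. Qed.

Lemma ip_suml (I : finType) (F : I -> 'rV[A]_n) w :
  ip (\sum_i F i) w = \sum_i ip (F i) w.
Proof. by rewrite /ip mulmx_suml summxE. Qed.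

Lemma ipBl u v w : ip (u - v) w = ip u w - ip v w.
Proof. by rewrite ipDl ipNl. Qed.

Lemma ipDr u v w : ip w (u + v) = ip w u + ip w v.
Proof. by rewrite !(ipC w) ipDl. Qed.

Lemma ipNr u w : ip w (- u) = - ip w u.
Proof. by rewrite !(ipC w) ipNl. Qed.

Lemma ipBr u v w : ip w (u - v) = ip w u - ip w v.
Proof. by rewrite !(ipC w) ipBl. Qed.

Lemma ipZr a u w : ip w (a *: u) = a * ip w u.
Proof. by rewrite !(ipC w) ipZl. Qed.

Lemma ip_sumr (I : finType) (F : I -> 'rV[A]_n) w :
  ip w (\sum_i F i) = \sum_i ip w (F i).
Proof. by rewrite ipC ip_suml; apply: eq_bigr => i _; rewrite ipC. Qed.

Lemma ip_leibniz (D : {additive A -> A})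
    (DM : forall a b, D (a * b) = D a * b + a * D b) u v :
  D (ip u v) = ip (map_mx D u) v + ip u (map_mx D v).
Proof.
rewrite !ipE raddf_sum -big_split /=; apply: eq_bigr => k _.
by rewrite DM !mxE.
Qed.

End InnerProduct.

(** * Tangential calculus of an immersion *)

Section Immersion.
Variables (A : comPzRingType) (m N : nat) (d : 'I_m -> {additive A -> A}).
Hypothesis dM : forall i a b, d i (a * b) = d i a * b + a * d i b.
Hypothesis dC : forall i j a, d i (d j a) = d j (d i a).
Hypothesis double_eq0 : forall a : A, a + a = 0 -> a = 0.
Variables (F : 'rV[A]_N) (G : 'M[A]_m).
Implicit Types (i j k l : 'I_m) (al be ga : 'I_N) (V W : 'rV[A]_N) (f : A).

Local Notation dv i V := (map_mx (d i) V).

Definition jac : 'M[A]_(m, N) := \matrix_(i, al) d i (F 0 al).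
Local Notation J := jac.
Hypothesis GJJ : G *m (J *m J^T) = 1%:M.

(** Row [k] is the ambient gradient of the k-th coordinate function; these rows are dual to those of
    [jac]. *)
Definition codiff : 'M[A]_(m, N) := G *m J.
Local Notation Q := codiff.
Definition tproj : 'M[A]_N := J^T *m Q.
Local Notation P := tproj.

(** The tangential part of the al-th ambient basis vector has the coordinates [Q i al]. *)
Definition tder al f : A := \sum_i Q i al * d i f.

Fact tder_zmod al : zmod_morphism (tder al).
Proof.
move=> f g; rewrite /tder -sumrB; apply: eq_bigr => i _.
by rewrite raddfB mulrBr.
Qed.

HB.instance Definition _ al := GRing.isZmodMorphism.Build A A (tder al) (tder_zmod al).

Lemma tderM al a b : tder al (a * b) = tder al a * b + a * tder al b.
Proof.
rewrite /tder big_distrl big_distrr -big_split /=.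
by apply: eq_bigr => i _; rewrite dM mulrDr mulrA mulrCA.
Qed.

Lemma cometric_sym : G^T = G.
Proof.
have gGT : (J *m J^T) *m G^T = 1%:M.
  by apply: trmx_inj; rewrite trmx_mul trmxK trmx1 trmx_mul trmxK.
by rewrite -[G^T]mul1mx -GJJ -mulmxA gGT mulmx1.
Qed.

Lemma jacK : J *m Q^T = 1%:M.
Proof.
apply: trmx_inj; rewrite trmx_mul trmxK trmx1 /codiff.
by rewrite -mulmxA GJJ.
Qed.

Lemma codiffK : Q *m J^T = 1%:M.
Proof. by apply: trmx_inj; rewrite trmx_mul trmxK jacK trmx1. Qed.

Lemma tproj_sym : P^T = P.
Proof.
by rewrite /tproj trmx_mul trmxK /codiff trmx_mul cometric_sym mulmxA.
Qed.

Lemma tprojE : P = Q^T *m J.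
Proof. by rewrite -tproj_sym /tproj trmx_mul trmxK. Qed.

Lemma jac_tproj : J *m P = J.
Proof. by rewrite tprojE mulmxA jacK mul1mx. Qed.

Lemma mxtrace_tproj : \tr P = m%:R.
Proof. by rewrite /tproj mxtrace_mulC codiffK mxtrace1. Qed.

Lemma tproj_idem : P *m P = P.
Proof. by rewrite {1}tprojE -mulmxA jac_tproj -tprojE. Qed.

Lemma jac_codiff i k : \sum_al J i al * Q k al = (i == k)%:R.
Proof.
transitivity ((J *m Q^T) i k); last by rewrite jacK mxE.
by rewrite mxE; apply: eq_bigr => al _; rewrite [Q^T _ _]mxE.
Qed.

Lemma jac_tder i f : \sum_al J i al * tder al f = d i f.
Proof.
transitivity (\sum_k (\sum_al J i al * Q k al) * d k f).
  under eq_bigr => al _ do rewrite big_distrr /=.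
  rewrite exchange_big /=; apply: eq_bigr => k _; rewrite big_distrl /=.
  by apply: eq_bigr => al _; rewrite mulrA.
under eq_bigr => k _ do rewrite jac_codiff.
rewrite (bigD1 i) //= eqxx mul1r big1 ?addr0 // => k /negPf.
by rewrite eq_sym => ->; rewrite mul0r.
Qed.

Lemma tproj_tder al f : \sum_ga P al ga * tder ga f = tder al f.
Proof.
rewrite tprojE.
under eq_bigr => ga _ do rewrite mxE big_distrl /=.
rewrite exchange_big /=; apply: eq_bigr => i _.
rewrite -jac_tder big_distrr /=; apply: eq_bigr => ga _.
by rewrite [Q^T _ _]mxE mulrA.
Qed.

Lemma tder_pos al be : tder al (F 0 be) = P al be.
Proof. by rewrite tprojE mxE; apply: eq_bigr => i _; rewrite !mxE. Qed.

(** The coefficients are those of the Lie bracket in ambient coordinates. All second derivatives, of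
    [f] and of the position, cancel by [dC]. *)
Lemma tder_comm al be f : tder al (tder be f) - tder be (tder al f) =
  \sum_ga (tder al (P be ga) - tder be (P al ga)) * tder ga f.
Proof.
have E1 x y : tder x (tder y f) =
    \sum_i tder x (Q i y) * d i f + \sum_i \sum_j Q i y * (Q j x * d j (d i f)).
  rewrite {2}/tder raddf_sum -big_split /=; apply: eq_bigr => i _.
  by rewrite tderM {2}/tder big_distrr.
have E2 x y : \sum_ga tder x (P y ga) * tder ga f =
    \sum_i tder x (Q i y) * d i f
    + \sum_ga \sum_i \sum_j Q i y * (Q j x * d j (d i (F 0 ga))) * tder ga f.
  transitivity (\sum_ga (\sum_i tder x (Q i y) * J i ga * tder ga f +
     \sum_i \sum_j Q i y * (Q j x * d j (d i (F 0 ga))) * tder ga f)).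
    apply: eq_bigr => ga _; rewrite -tder_pos {2}/tder raddf_sum big_distrl -big_split /=.
    apply: eq_bigr => i _; rewrite tderM mulrDl; congr (_ + _).
      by rewrite [J i ga]mxE.
    by rewrite [tder x (d i _)]/tder [X in X * _]big_distrr /= big_distrl.
  rewrite big_split /=; congr (_ + _); rewrite exchange_big /=.
  apply: eq_bigr => i _; rewrite -[in RHS]jac_tder big_distrr /=.
  by apply: eq_bigr => ga _; rewrite mulrA.
under [RHS]eq_bigr => ga _ do rewrite mulrBl.
rewrite sumrB !E1 !E2.
have sw u x y : \sum_i \sum_j Q i y * (Q j x * d j (d i u)) =
          \sum_i \sum_j Q i x * (Q j y * d j (d i u)).
  rewrite exchange_big /=; do 2!apply: eq_bigr => ? _.
  by rewrite dC mulrCA.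
rewrite (sw f al be).
have -> : \sum_ga \sum_i \sum_j Q i be * (Q j al * d j (d i (F 0 ga))) * tder ga f =
   \sum_ga \sum_i \sum_j Q i al * (Q j be * d j (d i (F 0 ga))) * tder ga f.
  apply: eq_bigr => ga _.
  have E3 x y : \sum_i \sum_j Q i y * (Q j x * d j (d i (F 0 ga))) * tder ga f =
     (\sum_i \sum_j Q i y * (Q j x * d j (d i (F 0 ga)))) * tder ga f.
    by rewrite big_distrl; apply: eq_bigr => i _; rewrite big_distrl.
  by rewrite !E3 sw.
have cancel (u v w : A) : u + w - (v + w) = u - v.
  by rewrite opprD addrACA subrr addr0.
by rewrite !cancel.
Qed.

(** Christoffel symbols as the coefficients of the tangential part of the second derivatives of the
    position; [christoffel_ev] identifies them with the formula in the metric. *)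
Definition gam k i j : A := \sum_al d i (J j al) * Q k al.

Definition hess i j V : 'rV[A]_N := dv i (dv j V) - \sum_k gam k i j *: dv k V.

Definition lap V : 'rV[A]_N := \sum_i \sum_j G i j *: hess i j V.

Local Notation tdv al V := (map_mx (tder al) V).

(** The sum of squares has the first order coefficients given by the sums of
    [Q i al * d i (Q k al)]; differentiating the duality [jac_codiff] shows that these are exactly
    the Christoffel terms of [lap]. *)
Lemma lap_tder V : lap V = \sum_al tdv al (tdv al V).
Proof.
apply/rowP => be; rewrite !summxE.
under [RHS]eq_bigr => al _ do rewrite !mxE.
under [LHS]eq_bigr => i _ do rewrite summxE.
set f := V 0 be.
transitivity (\sum_i \sum_j (G i j * d i (d j f)) - \sum_i \sum_j \sum_k G i j * gam k i j * d k f).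
  rewrite -sumrB; apply: eq_bigr => i _; rewrite -sumrB; apply: eq_bigr => j _.
  rewrite !mxE mulrBr summxE; congr (_ - _); rewrite big_distrr /=.
  by apply: eq_bigr => k _; rewrite !mxE mulrA.
have E1 al : tder al (tder al f) = \sum_i \sum_j Q i al * Q j al * d i (d j f)
    + \sum_k (\sum_i Q i al * d i (Q k al)) * d k f.
  rewrite {1}/tder [X in _ = _ + X](_ : _ = \sum_i \sum_k Q i al * d i (Q k al) * d k f).
    rewrite -big_split /=; apply: eq_bigr => i _.
    rewrite [tder al f]/tder raddf_sum [X in X = _]big_distrr -big_split /=.
    apply: eq_bigr => j _.
    by rewrite dM; ring.
  by rewrite exchange_big /=; apply: eq_bigr => k _; rewrite big_distrl.
rewrite (eq_bigr _ (fun al _ => E1 al)) big_split /=; congr (_ + _).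
  rewrite [RHS]exchange_big /=; apply: eq_bigr => i _.
  rewrite [RHS]exchange_big /=; apply: eq_bigr => j _.
  rewrite -big_distrl /=; congr (_ * _).
  transitivity ((Q *m Q^T) i j).
    by rewrite {1}/codiff -mulmxA jacK mulmx1.
  by rewrite mxE; apply: eq_bigr => al _; rewrite [Q^T _ _]mxE.
have dQ i j k : \sum_al J j al * d i (Q k al) = - gam k i j.
  apply/eqP; rewrite -addr_eq0 /gam -big_split /=.
  have := congr1 (d i) (jac_codiff j k).
  rewrite raddf_sum raddfMn /= => E.
  have d1 : d i 1 = 0.
    have := dM i 1 1; rewrite !mulr1 mul1r => /esym.
    by rewrite -[RHS]addr0 => /addrI.
  rewrite d1 mul0rn in E; apply/eqP; rewrite -[RHS]E; apply: eq_bigr => al _.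
  by rewrite dM addrC.
have QdQ i k : \sum_al Q i al * d i (Q k al) = - \sum_j G i j * gam k i j.
  transitivity (\sum_al \sum_j G i j * (J j al * d i (Q k al))).
    apply: eq_bigr => al _; rewrite {1}/codiff [(G *m J) i al]mxE big_distrl /=.
    by apply: eq_bigr => j _; rewrite mulrA.
  rewrite exchange_big -sumrN /=; apply: eq_bigr => j _.
  by rewrite -big_distrr /= dQ mulrN.
transitivity (\sum_k (\sum_i \sum_al Q i al * d i (Q k al)) * d k f).
  transitivity (\sum_k (\sum_i - \sum_j G i j * gam k i j) * d k f).
    under [RHS]eq_bigr => k _ do rewrite sumrN mulNr big_distrl /=.
    rewrite sumrN; congr (- _); rewrite [RHS]exchange_big /=.
    apply: eq_bigr => i _; rewrite exchange_big /=; apply: eq_bigr => k _.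
    by rewrite big_distrl.
  by apply: eq_bigr => k _; under [in RHS]eq_bigr => i _ do rewrite QdQ.
rewrite [RHS]exchange_big /=; apply: eq_bigr => k _.
by rewrite exchange_big /= big_distrl.
Qed.

Lemma tder_d0 f al : (forall i, d i f = 0) -> tder al f = 0.
Proof. by move=> df; rewrite /tder big1 // => i _; rewrite df mulr0. Qed.

Lemma lap_comb a b V W : (forall i, d i a = 0) -> (forall i, d i b = 0) ->
  lap (a *: V + b *: W) = a *: lap V + b *: lap W.
Proof.
move=> da db; rewrite !lap_tder !scaler_sumr -big_split; apply: eq_bigr => al _.
have E f g : tder al (a * f + b * g) = a * tder al f + b * tder al g.
  by rewrite [LHS]raddfD /= !tderM (tder_d0 al da) (tder_d0 al db) !mul0r !add0r.
by apply/rowP => be; rewrite !mxE !E.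
Qed.

Lemma dvC i j V : dv i (dv j V) = dv j (dv i V).
Proof. by apply/rowP => al; rewrite !mxE dC. Qed.

Lemma metricE i j : (J *m J^T) i j = ip (dv i F) (dv j F).
Proof. by rewrite mxE ipE; apply: eq_bigr => al _; rewrite !mxE. Qed.

Lemma gamE k i j : gam k i j = ip (dv i (dv j F)) (row k Q).
Proof. by rewrite ipE; apply: eq_bigr => al _; rewrite !mxE. Qed.

Lemma row_codiff k : row k Q = \sum_l G k l *: dv l F.
Proof.
apply/rowP => al; rewrite !mxE summxE; apply: eq_bigr => l _.
by rewrite !mxE.
Qed.

Lemma mul_jac_ip V i : (V *m J^T) 0 i = ip V (dv i F).
Proof. by rewrite mxE ipE; apply: eq_bigr => al _; rewrite !mxE. Qed.

Lemma hess_normal i j l : ip (hess i j F) (dv l F) = 0.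
Proof.
rewrite /hess ipBl ip_suml; apply/eqP; rewrite subr_eq0; apply/eqP.
set W := dv i (dv j F).
transitivity ((W *m Q^T *m (J *m J^T)) 0 l).
  by rewrite -mulmxA [Q^T *m _]mulmxA -tprojE -tproj_sym -trmx_mul jac_tproj mul_jac_ip.
rewrite mxE; apply: eq_bigr => k _; rewrite ipZl metricE gamE; congr (_ * _).
by rewrite ipE mxE; apply: eq_bigr => al _; rewrite !mxE.
Qed.

Lemma tangent_proj V :
  \sum_i \sum_j G i j *: (ip V (dv i F) *: dv j F) = V *m P.
Proof.
rewrite /tproj mulmxA; apply/rowP => be; rewrite summxE [RHS]mxE.
apply: eq_bigr => i _; rewrite mul_jac_ip [Q i be]mxE big_distrr summxE /=.
by apply: eq_bigr => j _; rewrite !mxE mulrCA.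
Qed.

Lemma lap_normal l : ip (lap F) (dv l F) = 0.
Proof.
rewrite /lap ip_suml big1 // => i _; rewrite ip_suml big1 // => j _.
by rewrite ipZl hess_normal mulr0.
Qed.

Let DI i V W : d i (ip V W) = ip (dv i V) W + ip V (dv i W).
Proof. exact: (ip_leibniz (@dM i)). Qed.

Let DT al V W : tder al (ip V W) = ip (tdv al V) W + ip V (tdv al W).
Proof. exact: (ip_leibniz (@tderM al)). Qed.

Lemma ip_tdv V W al : ip V (tdv al W) = \sum_i Q i al * ip V (dv i W).
Proof.
have -> : tdv al W = \sum_i Q i al *: dv i W.
  by apply/rowP => be; rewrite summxE !mxE; apply: eq_bigr => i _; rewrite !mxE.
by rewrite ip_sumr; apply: eq_bigr => i _; rewrite ipZr.
Qed.

Definition normal V := forall i, ip V (dv i F) = 0.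

Lemma normal_tdv V al : normal V -> ip V (tdv al F) = 0.
Proof. by move=> nV; rewrite ip_tdv big1 // => i _; rewrite nV mulr0. Qed.

Lemma normal_mul_tproj V : normal V -> V *m P = 0.
Proof.
move=> nV; rewrite /tproj mulmxA [V *m J^T](_ : _ = 0) ?mul0mx //.
by apply/rowP => i; rewrite mul_jac_ip nV mxE.
Qed.

(** Green's formula without integration: differentiating either orthogonality relation gives the
    same quantity, minus the product of the first derivatives. *)
Lemma green_normal V W : (forall al, ip (tdv al W) V = 0) ->
  (forall al, ip W (tdv al V) = 0) -> ip (lap W) V = ip W (lap V).
Proof.
move=> WV VW; rewrite !lap_tder ip_suml ip_sumr; apply: eq_bigr => al _.
have := congr1 (tder al) (WV al); have := congr1 (tder al) (VW al).
rewrite raddf0 !DT => /eqP; rewrite addrC addr_eq0 => /eqP ->.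
by move=> /eqP; rewrite addr_eq0 => /eqP.
Qed.

(** The squared radius of the sphere and its curvature. *)
Variables (rho c0 : A).
Hypothesis rhoE : ip F F = rho.
Hypothesis d_rho : forall i, d i rho = 0.
Hypothesis c0rho : c0 * rho = 1.

Lemma d_one i : d i 1 = 0.
Proof.
have := dM i 1 1; rewrite !mulr1 mul1r => /esym.
by rewrite -[RHS]addr0 => /addrI.
Qed.

Lemma d_c0 i : d i c0 = 0.
Proof.
have := congr1 (d i) c0rho; rewrite dM d_rho mulr0 addr0 d_one => E.
by rewrite -[d i c0]mulr1 -c0rho mulrCA E mulr0.
Qed.

Lemma pos_normal : normal F.
Proof.
move=> i; apply: double_eq0; rewrite -[RHS](d_rho i) -rhoE DI.
by rewrite (ipC _ F).
Qed.

Lemma ip_tdv_tdv : \sum_al ip (tdv al F) (tdv al F) = m%:R.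
Proof.
rewrite -mxtrace_tproj -tproj_idem; apply: eq_bigr => al _.
rewrite ipE mxE; apply: eq_bigr => be _; rewrite ![map_mx _ _ _ _]mxE !tder_pos.
by congr (_ * _); rewrite -{1}tproj_sym mxE.
Qed.

Lemma lap_pos : ip (lap F) F = - m%:R.
Proof.
rewrite lap_tder ip_suml -ip_tdv_tdv -sumrN; apply: eq_bigr => al _.
have := congr1 (tder al) (normal_tdv al pos_normal).
rewrite raddf0 DT => /eqP; rewrite addrC addr_eq0 ipC => /eqP ->.
by [].
Qed.

(** The tension field in the sphere: the ambient Laplacian of the position has radial part
    [- (m%:R * c0) *: F], which is removed. *)
Definition tau : 'rV[A]_N := lap F + (m%:R * c0) *: F.

Lemma lap_tau : lap F = tau - (m%:R * c0) *: F.
Proof. by rewrite /tau addrK. Qed.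

Lemma tau_normal : normal tau.
Proof. by move=> i; rewrite /tau ipDl lap_normal ipZl pos_normal mulr0 addr0. Qed.

Lemma tau_pos : ip tau F = 0.
Proof. by rewrite /tau ipDl lap_pos ipZl rhoE -mulrA c0rho mulr1 addNr. Qed.

Section NormalField.
Variable V : 'rV[A]_N.
Hypothesis V_normal : normal V.
Hypothesis V_pos : ip V F = 0.

Lemma der_normal_pos i : ip (dv i V) F = 0.
Proof.
have := congr1 (d i) V_pos.
by rewrite raddf0 DI V_normal addr0.
Qed.

Lemma tder_normal_pos al : ip (tdv al V) F = 0.
Proof. by rewrite ipC ip_tdv big1 // => i _; rewrite ipC der_normal_pos mulr0. Qed.

Lemma lap_normal_pos : ip (lap V) F = ip V (lap F).
Proof. by apply: green_normal => al; [exact: tder_normal_pos|exact: normal_tdv]. Qed.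

Lemma lap_tau_pos : ip (lap V) F = ip V tau.
Proof. by rewrite lap_normal_pos lap_tau ipBr ipZr V_pos mulr0 subr0. Qed.

(** The pulled back Levi-Civita connection of the sphere: the derivative without its radial part. *)
Definition nabla i W : 'rV[A]_N := dv i W - (c0 * ip (dv i W) F) *: F.

Lemma nabla_normal i : nabla i V = dv i V.
Proof. by rewrite /nabla der_normal_pos mulr0 scale0r subr0. Qed.

(** First derivatives of [V] are already tangent to the sphere, so only the second differentiation
    has to be projected; by [lap_tau_pos] the radial part lost is that of [ip V tau]. *)
Lemma trace_nabla2 :
  \sum_i \sum_j G i j *: (nabla i (nabla j V) - \sum_k gam k i j *: nabla k V) =
  lap V - (c0 * ip V tau) *: F.
Proof.
rewrite -lap_tau_pos {2}/lap ip_suml big_distrr /= scaler_suml -sumrB.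
apply: eq_bigr => i _; rewrite ip_suml big_distrr /= scaler_suml -sumrB.
apply: eq_bigr => j _; rewrite nabla_normal ipZl mulrCA -scalerA -scalerBr.
congr (_ *: _); rewrite /nabla /hess.
under eq_bigr => k _ do rewrite -/(nabla k V) nabla_normal.
rewrite addrAC; congr (_ - (_ * _) *: _).
rewrite ipBl ip_suml [X in _ = _ - X]big1 ?subr0 // => k _.
by rewrite ipZl der_normal_pos mulr0.
Qed.

End NormalField.


(** * Parallel mean curvature *)

Section ParallelMeanCurvature.
Variables (H : 'rV[A]_N) (kap : A).
Hypothesis tauH : tau = m%:R *: H.
Hypothesis H_normal : normal H.
Hypothesis H_pos : ip H F = 0.
Hypothesis H_parallel : forall i, dv i H *m P = dv i H.
Hypothesis d_kap : forall i, d i kap = 0.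

Local Notation h := (ip H H).
Local Notation th := (m%:R * c0 * h).
Hypothesis lapH : lap H = - kap *: H + th *: F.

(** Weingarten's formula: for parallel [H] this is the shape operator, extended by zero to normal
    vectors. *)
Definition shape_ext : 'M[A]_N := - \matrix_(al, be) tder al (H 0 be).
Local Notation S := shape_ext.
Definition second_form_H : 'M[A]_m := \matrix_(i, j) ip (dv i (dv j F)) H.
Local Notation K := second_form_H.

Lemma shape_extE al be : S al be = - tder al (H 0 be).
Proof. by rewrite !mxE. Qed.

Lemma shape_extK : S = Q^T *m K *m Q.
Proof.
pose B : 'M[A]_(m, N) := \matrix_(i, be) d i (H 0 be).
have SE : S = - (Q^T *m B).
  congr (- _); apply/matrixP => al be; rewrite !mxE.
  by apply: eq_bigr => i _; rewrite !mxE.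
have BP : B *m P = B.
  apply/row_matrixP => i; rewrite row_mul.
  have -> : row i B = dv i H by apply/rowP => be; rewrite !mxE.
  by rewrite H_parallel.
have BJ : B *m J^T = - K.
  apply/matrixP => i j; rewrite !mxE.
  have := congr1 (d i) (H_normal j); rewrite raddf0 DI => /eqP.
  rewrite addr_eq0 (ipC H) => /eqP <-; rewrite ipE.
  by apply: eq_bigr => al _; rewrite !mxE.
rewrite SE -BP /tproj [B *m _]mulmxA BJ.
by rewrite mulNmx mulmxN opprK mulmxA.
Qed.

Lemma second_form_H_sym : K^T = K.
Proof. by apply/matrixP => i j; rewrite !mxE dvC. Qed.

Lemma shape_ext_sym : S^T = S.
Proof.
rewrite shape_extK [(_ *m Q)^T]trmx_mul [(_ *m K)^T]trmx_mul trmxK.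
by rewrite second_form_H_sym mulmxA.
Qed.

Lemma shape_ext_tproj : S *m P = S.
Proof.
have QP : Q *m P = Q by rewrite /tproj mulmxA codiffK mul1mx.
by rewrite shape_extK -mulmxA QP.
Qed.

Lemma jac_shape_ext : J *m S *m J^T = K.
Proof.
rewrite shape_extK [J *m _]mulmxA -mulmxA codiffK mulmx1.
by rewrite mulmxA jacK mul1mx.
Qed.

Lemma ip_tder_H al V : ip (tdv al H) V = - (V *m S) 0 al.
Proof.
rewrite ipE mxE -sumrN; apply: eq_bigr => be _.
by rewrite [tdv al H 0 be]mxE -[in RHS]shape_ext_sym [S^T _ _]mxE shape_extE mulrN opprK mulrC.
Qed.

Lemma H_shape_ext : H *m S = 0.
Proof.
rewrite -shape_ext_sym -[S^T]mulmx1 -{1}shape_ext_tproj trmx_mul tproj_sym.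
by rewrite mulmx1 mulmxA normal_mul_tproj // mul0mx.
Qed.

(** The derivative of a parallel field is tangential, hence orthogonal to [H]. *)
Lemma tder_sqnorm_H al : tder al h = 0.
Proof.
by rewrite DT (ipC H) ip_tder_H H_shape_ext mxE oppr0 addr0.
Qed.

Lemma mxtrace_shape_ext : \tr S = m%:R * h.
Proof.
have <- : ip H (lap F) = m%:R * h.
  by rewrite lap_tau tauH ipBr !ipZr H_pos mulr0 subr0.
rewrite -shape_ext_tproj lap_tder ip_sumr; apply: eq_bigr => al _.
have := congr1 (tder al) (normal_tdv al H_normal).
rewrite raddf0 DT => /eqP; rewrite addrC addr_eq0 => /eqP ->.
rewrite ipE mxE -sumrN; apply: eq_bigr => be _.
by rewrite [tdv al H 0 be]mxE [tdv al F 0 be]mxE tder_pos shape_extE mulNr -{1}tproj_sym [P^T _ _]mxE.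
Qed.

(** The trace is the squared norm of the derivative of [H], which is [- ip (lap H) H] because the
    length of [H] is constant. *)
Lemma mxtrace_shape_ext2 : \tr (S *m S) = kap * h.
Proof.
have -> : kap * h = - ip (lap H) H.
  by rewrite lapH ipDl !ipZl [ip F H]ipC H_pos mulr0 addr0 mulNr opprK.
rewrite lap_tder ip_suml -sumrN; apply: eq_bigr => al _.
have Hal : ip (tdv al H) H = 0 by rewrite ip_tder_H H_shape_ext mxE oppr0.
have := congr1 (tder al) Hal.
rewrite raddf0 DT => /eqP; rewrite addr_eq0 => /eqP ->; rewrite opprK.
rewrite ipE mxE; apply: eq_bigr => be _.
by rewrite -{2}shape_ext_sym [S^T _ _]mxE shape_extE [tdv al H 0 be]mxE mulrNN.
Qed.

(** The symmetry of [E al] is what makes the left side a sum of squares after evaluation at a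
    point. *)
Lemma shape_ext_simons :
  let E al := P *m map_mx (tder al) S *m P in
  (forall al, (E al)^T = E al) /\
  \sum_al \tr (E al *m E al) =
    kap * \tr (S *m S) + th * \tr S
    - m%:R * \tr (S *m S *m S) - m%:R * c0 * \tr (S *m S).
Proof.
move=> E; split.
  move=> al; rewrite /E [(_ *m P)^T]trmx_mul [(P *m _)^T]trmx_mul tproj_sym.
  by rewrite map_trmx shape_ext_sym mulmxA.
have d_m i : d i m%:R = 0 by rewrite raddfMn /= d_one mul0rn.
have t_m al : tder al m%:R = 0 by exact: tder_d0.
have t_c0 al : tder al c0 = 0 by apply: tder_d0 => i; exact: d_c0.
have t_kap al : tder al kap = 0 by exact: tder_d0.
have t_th al : tder al th = 0.
  by rewrite !tderM t_m t_c0 tder_sqnorm_H; ring.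
have t_c al : tder al (m%:R * c0) = 0 by rewrite tderM t_m t_c0; ring.
have DH al be : tder al (H 0 be) = - S al be by rewrite shape_extE opprK.
have divS be : \sum_ga tder ga (S ga be) = kap * H 0 be - th * F 0 be.
  transitivity (- lap H 0 be).
    rewrite lap_tder summxE -sumrN; apply: eq_bigr => al _.
    by rewrite shape_extE raddfN ![map_mx _ _ _ _]mxE.
  by rewrite lapH !mxE; ring.
have divP be : \sum_ga tder ga (P ga be) = m%:R * H 0 be - m%:R * c0 * F 0 be.
  transitivity (lap F 0 be).
    rewrite lap_tder summxE; apply: eq_bigr => al _.
    by rewrite -tder_pos ![map_mx _ _ _ _]mxE.
  by rewrite lap_tau tauH !mxE.
have trS al : \tr (S *m map_mx (tder al) S) = 0.
  apply: double_eq0; rewrite -[RHS](_ : tder al (\tr (S *m S)) = 0); last first.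
    by rewrite mxtrace_shape_ext2 tderM t_kap tder_sqnorm_H; ring.
  rewrite {1}mxtrace_mulC -linearD -(map_mx_leibniz (@tderM al)) /mxtrace raddf_sum.
  by apply: eq_bigr => i _; rewrite [LHS]mxE.
exact: (@simons_identity _ _ (fun al => tder al) tderM P S F H kap th m%:R
  (m%:R * c0) tproj_sym tproj_idem tproj_tder tder_comm tder_pos DH
  shape_ext_sym shape_ext_tproj t_kap t_th t_m t_c divS divP trS).
Qed.

End ParallelMeanCurvature.

End Immersion.

(** * Trace inequalities *)

Section Pinching.
Variables (R : realFieldType) (N : nat).
Implicit Types (P L S B : 'M[R]_N) (v : 'rV[R]_N).

Lemma ip_ge0 v : 0 <= ip v v.
Proof. by rewrite ipE sumr_ge0 // => k _; rewrite -expr2 sqr_ge0. Qed.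

Lemma ip_eq0 v : ip v v = 0 -> v = 0.
Proof.
rewrite ipE => /eqP; rewrite psumr_eq0 => [/allP v0|k _]; last first.
  by rewrite -expr2 sqr_ge0.
apply/rowP => k; rewrite mxE; apply/eqP.
by have := v0 k (mem_index_enum k); rewrite mulf_eq0 orbb.
Qed.

Lemma mxtraceN B : \tr (- B) = - \tr B.
Proof. by rewrite raddfN. Qed.

Lemma mxtrace_sym_mul B C : B^T = B ->
  \tr (B *m C *m B) = \sum_i ip (row i B *m C) (row i B).
Proof.
move=> B_sym; rewrite /mxtrace; apply: eq_bigr => i _.
rewrite -row_mul ipE mxE; apply: eq_bigr => j _.
by rewrite -{2}B_sym !mxE.
Qed.

Lemma mxtrace_sym_ge0 B : B^T = B -> 0 <= \tr (B *m B).
Proof.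
move=> B_sym; rewrite -[B in B *m _]mulmx1 mxtrace_sym_mul // sumr_ge0 // => i _.
by rewrite mulmx1 ip_ge0.
Qed.

Lemma mxtrace_sym_eq0 B : B^T = B -> \tr (B *m B) = 0 -> B = 0.
Proof.
move=> B_sym; rewrite -[B in B *m _]mulmx1 mxtrace_sym_mul // => /eqP.
rewrite psumr_eq0 => [/allP B0|i _]; last by rewrite mulmx1 ip_ge0.
apply/row_matrixP => i; rewrite row0; apply: ip_eq0; apply/eqP.
by have := B0 i (mem_index_enum i); rewrite mulmx1.
Qed.

Lemma mxtrace_rank1 (B : 'M[R]_N) v : \tr (v^T *m v *m B) = ip (v *m B) v.
Proof. by rewrite -mulmxA mxtrace_mulC /mxtrace big_ord1 /ip. Qed.

(* With [l] the Rayleigh quotient of [L] at [v], so that [l <= -1], and [W] the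
   orthogonal projection onto [v], expand [|L - P + (1 - l) W|^2 >= 0]. *)
Lemma trace_gap_vector P L v : P^T = P -> P *m P = P -> L^T = L -> L *m P = L ->
  \tr (L *m L) = \tr P -> v != 0 -> v *m P = v -> ip (v *m (L + P)) v <= 0 ->
  \tr L <= \tr P - 2.
Proof.
move=> P_sym P_idem L_sym LP trL2 v0 vP vneg.
have PL : P *m L = L by apply: trmx_inj; rewrite trmx_mul P_sym L_sym LP.
have n0 : 0 < ip v v.
  by rewrite lt_def ip_ge0 andbT; apply: contra v0 => /eqP/ip_eq0 ->.
pose W := (ip v v)^-1 *: (v^T *m v).
have W_sym : W^T = W by rewrite /W linearZ /= trmx_mul trmxK.
have trWB B : \tr (W *m B) = (ip v v)^-1 * ip (v *m B) v.
  by rewrite /W -scalemxAl linearZ /= mxtrace_rank1.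
have trWW : \tr (W *m W) = 1.
  rewrite trWB /W -scalemxAr mulmxA [v *m v^T]mx11_scalar -/(ip v v).
  by rewrite mul_scalar_mx scalerA mulVf ?gt_eqF// scale1r mulVf ?gt_eqF.
have trWP : \tr (W *m P) = 1 by rewrite trWB vP mulVf ?gt_eqF.
clearbody W; set l := \tr (W *m L).
have l1 : l <= -1.
  have : \tr (W *m (L + P)) <= 0.
    by rewrite trWB mulr_ge0_le0 // invr_ge0 ltW.
  by rewrite mulmxDr linearD /= trWP -/l; lra.
pose C := L - P + (1 - l) *: W.
have C_sym : C^T = C.
  by rewrite /C !linearD linearN linearZ /= L_sym P_sym W_sym.
have := mxtrace_sym_ge0 C_sym.
have -> : \tr (C *m C) = 2 * \tr P - 2 * \tr L - (1 - l) ^+ 2.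
  rewrite /C !(mulmxDl, mulmxDr, mulNmx, mulmxN, =^~ scalemxAl, =^~ scalemxAr).
  rewrite LP PL P_idem !(mxtraceD, mxtraceN, mxtraceZ) trL2 trWW.
  rewrite (mxtrace_mulC L W) (mxtrace_mulC P W) trWP -/l; ring.
(* [1 - l >= 2], so the squared norm of [C] leaves 2 tr L <= 2 tr P - 4. *)
nra.
Qed.

(* If [L <> P], then [L + P] is not positive definite on the image of [P],
   since [tr ((L - P) (L + P) (L - P)) <= 0]. *)
Lemma trace_gap P L : P^T = P -> P *m P = P -> L^T = L -> L *m P = L ->
  \tr (L *m L) = \tr P -> \tr (L *m L *m L) <= \tr L ->
  L = P \/ \tr L <= \tr P - 2.
Proof.
move=> P_sym P_idem L_sym LP trL2 trL3.
have PL : P *m L = L by apply: trmx_inj; rewrite trmx_mul P_sym L_sym LP.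
pose B := L - P; have B_sym : B^T = B by rewrite /B linearB /= L_sym P_sym.
have BP : B *m P = B by rewrite mulmxBl LP P_idem.
case: (pickP (fun i => (row i B != 0) && (ip (row i B *m (L + P)) (row i B) <= 0))).
  move=> i /andP[Bi0 Bineg]; right.
  by apply: (trace_gap_vector P_sym P_idem L_sym LP trL2 Bi0 _ Bineg); rewrite -row_mul BP.
move=> pos; left; apply/eqP; rewrite -subr_eq0 -/B.
have B_pos i : row i B != 0 -> 0 < ip (row i B *m (L + P)) (row i B).
  by move=> Bi0; have := pos i; rewrite /= Bi0 /= ltNge => ->.
have B_ge0 i : 0 <= ip (row i B *m (L + P)) (row i B).
  have [->|/B_pos/ltW //] := eqVneq (row i B) 0.
  by rewrite mul0mx ip0l.
(* Expanded, the sum is tr L^3 - tr L^2 - tr L + tr P, that is tr L^3 - tr L. *)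
have : \sum_i ip (row i B *m (L + P)) (row i B) == 0.
  rewrite eq_le sumr_ge0 ?andbT // -mxtrace_sym_mul //.
  rewrite /B !(mulmxDl, mulmxDr, mulNmx, mulmxN) LP PL P_idem LP.
  rewrite -[L *m L *m P]mulmxA LP P_idem PL !(mxtraceD, mxtraceN) trL2; lra.
rewrite psumr_eq0 // => /allP B0; apply/eqP/row_matrixP => i; rewrite row0.
apply/eqP; apply: contraT => /B_pos.
by have /= /eqP -> := B0 i (mem_index_enum i); rewrite ltxx.
Qed.

(* The affine change [L = (m S - a P) / q] turns the Simons inequality into
   [tr L^3 <= tr L]. *)
Lemma factor_gap (P S : 'M[R]_N) (k M a c h T q : R) :
  0 < k -> 0 < h -> 0 < q -> c != 0 -> c = M - a -> T = q ^+ 2 ->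
  T = a ^+ 2 + k * c * h ->
  P^T = P -> P *m P = P -> \tr P = k -> S^T = S -> S *m P = S ->
  \tr S = k * h -> \tr (S *m S) = (a + M) * h ->
  k * \tr (S *m S *m S) <=
    (a + M) * \tr (S *m S) + c * h * \tr S - c * \tr (S *m S) ->
  T = M ^+ 2 \/ (k ^+ 2 * h - a * k) / q <= k - 2.
Proof.
move=> k0 h0 q0 c0 cE Tq TE P_sym P_idem trP S_sym SP trS trS2 simons.
have PS : P *m S = S by apply: trmx_inj; rewrite trmx_mul P_sym S_sym SP.
pose B := k *: S - a *: P; pose L := q^-1 *: B.
have L_sym : L^T = L.
  by rewrite /L linearZ /= /B linearB /= !linearZ /= S_sym P_sym.
have LP : L *m P = L by rewrite /L /B -scalemxAl mulmxBl -!scalemxAl SP P_idem.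
have trB : \tr B = k ^+ 2 * h - a * k.
  by rewrite /B linearB /= !mxtraceZ trS trP; ring.
have trL : \tr L = (k ^+ 2 * h - a * k) / q by rewrite linearZ /= trB mulrC.
have B2 : B *m B = k ^+ 2 *: (S *m S) - (2 * a * k) *: S + a ^+ 2 *: P.
  rewrite /B !(mulmxDl, mulmxDr, mulNmx, mulmxN, =^~ scalemxAl, =^~ scalemxAr).
  by rewrite SP PS P_idem; apply/matrixP => i j; rewrite !mxE; ring.
have B3 : B *m B *m B = k ^+ 3 *: (S *m S *m S) - (3 * a * k ^+ 2) *: (S *m S)
    + (3 * a ^+ 2 * k) *: S - a ^+ 3 *: P.
  rewrite B2 /B !(mulmxDl, mulmxDr, mulNmx, mulmxN, =^~ scalemxAl, =^~ scalemxAr).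
  rewrite -[S *m S *m P]mulmxA SP PS P_idem.
  by apply/matrixP => i j; rewrite !mxE; ring.
have q_neq0 : q != 0 by rewrite gt_eqF.
have trL2 : \tr (L *m L) = \tr P.
  rewrite /L -scalemxAl -scalemxAr !mxtraceZ B2 !(mxtraceD, mxtraceN, mxtraceZ).
  rewrite trS trS2 trP.
  have -> : k ^+ 2 * ((a + M) * h) - 2 * a * k * (k * h) + a ^+ 2 * k = k * q ^+ 2.
    by rewrite -Tq TE cE; ring.
  by field.
have trL3 : \tr (L *m L *m L) <= \tr L.
  rewrite /L -!(scalemxAl, scalemxAr) !mxtraceZ trB B3 !(mxtraceD, mxtraceN, mxtraceZ).
  rewrite trS trS2 trP.
  rewrite ler_pM2l ?invr_gt0 // mulrA -invfM -expr2 -Tq.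
  rewrite ler_pdivrMl; last by rewrite Tq exprn_gt0.
  (* Without denominators the claim is [k ^+ 2] times the Simons inequality. *)
  rewrite -subr_le0 [X in X <= 0](_ : _ = k ^+ 2 * (k * \tr (S *m S *m S) -
    ((a + M) * ((a + M) * h) + c * h * (k * h) - c * ((a + M) * h)))); last first.
    by rewrite TE cE; ring.
  by rewrite mulr_ge0_le0 ?sqr_ge0 // subr_le0 -trS2 -trS.
have [LE|] := trace_gap P_sym P_idem L_sym LP trL2 trL3; last first.
  by rewrite trL trP; right.
left.
(* If [L = P] then [S = h *: P]; its two traces give k h = a + M, so T = a^2 + (M - a)(a + M). *)
have BE : B = q *: P by rewrite -LE /L scalerA mulfV // scale1r.
have kS : k *: S = (q + a) *: P by rewrite scalerDl -BE /B subrK.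
have k_neq0 : k != 0 by rewrite gt_eqF.
have qa : q + a = k * h.
  apply: (mulIf k_neq0); rewrite -[in LHS]trP -!mxtraceZ -kS mxtraceZ trS.
  by rewrite mulrC.
have SE : S = h *: P.
  by apply: (scalerI k_neq0); rewrite kS qa scalerA.
have kh : k * h = a + M.
  have h_neq0 : h != 0 by rewrite gt_eqF.
  apply: (mulIf h_neq0); rewrite -trS2 SE -scalemxAl -scalemxAr P_idem !mxtraceZ trP.
  by ring.
by rewrite TE [k * c]mulrC -mulrA kh cE; ring.
Qed.

(** The squared norm of [S - h *: P] is kap h - k h^2. *)
Lemma umbilic_eq (P S : 'M[R]_N) (k kap h : R) :
  P^T = P -> P *m P = P -> \tr P = k -> S^T = S -> S *m P = S ->
  \tr S = k * h -> \tr (S *m S) = kap * h -> kap = k * h -> S = h *: P.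
Proof.
move=> P_sym P_idem trP S_sym SP trS trS2 kapE.
have PS : P *m S = S by apply: trmx_inj; rewrite trmx_mul P_sym S_sym SP.
apply/eqP; rewrite -subr_eq0; apply/eqP/mxtrace_sym_eq0.
  by rewrite linearB linearZ /= S_sym P_sym.
rewrite !(mulmxDl, mulmxDr, mulNmx, mulmxN, =^~ scalemxAl, =^~ scalemxAr).
rewrite SP PS P_idem !(mxtraceD, mxtraceN, mxtraceZ) trS trS2 trP kapE; ring.
Qed.

End Pinching.

(** * Coordinate expressions *)

Section RowDerivatives.
Variables (R : realType) (V : normedModType R) (N : nat).
Implicit Types (a b : V -> R) (h k : V -> 'rV[R]_N) (p v : V).

Lemma is_derive_rowP h p v (dh : 'rV[R]_N) :
  (forall j, is_derive p v (fun y => h y 0 j) (dh 0 j)) <-> is_derive p v h dh.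
Proof.
split=> [H|[dv <-] j].
  have dhv : derivable h p v.
    by apply/derivable_mxP => i j; rewrite ord1; have [] := H j.
  split=> //; rewrite derive_mx //; apply/rowP => j; rewrite mxE.
  by have [_] := H j.
split; first exact: (derivable_mxP _ _ _).1 dv 0 j.
by rewrite (derive_mx dv) mxE.
Qed.

Lemma is_derive_scaled a h p v (da : R) (dh : 'rV[R]_N) :
  is_derive p v a da -> is_derive p v h dh ->
  is_derive p v (fun y => a y *: h y) (da *: h p + a p *: dh).
Proof.
move=> Da Dh; apply/is_derive_rowP => j.
have Dj := (is_derive_rowP h p v dh).2 Dh j.
rewrite (_ : (fun y => _) = a * (fun y => h y 0 j)); last first.
  by apply/funext => y; rewrite mxE.
apply: (is_derive_eq (is_deriveM Da Dj)).
by rewrite !mxE addrC [h p 0 j *: _]mulrC.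
Qed.

Lemma is_derive_dot h k p v (dh dk : 'rV[R]_N) :
  is_derive p v h dh -> is_derive p v k dk ->
  is_derive p v (fun y => dot (h y) (k y)) (dot dh (k p) + dot (h p) dk).
Proof.
move=> Dh Dk.
have Dhj j := (is_derive_rowP h p v dh).2 Dh j.
have Dkj j := (is_derive_rowP k p v dk).2 Dk j.
rewrite (_ : (fun y => _) = \sum_j (fun y => h y 0 j) * (fun y => k y 0 j)); last first.
  by apply/funext => y; rewrite fct_sumE -[LHS]/(ip _ _) ipE.
apply: (is_derive_eq (is_derive_sum (fun j => is_deriveM (Dhj j) (Dkj j)))).
rewrite -![dot _ _]/(ip _ _) !ipE -big_split; apply: eq_bigr => j _ /=.
by rewrite addrC [k p 0 j *: _]mulrC.
Qed.

End RowDerivatives.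

(** * Curvature of the unit sphere *)

Section SphereCurvature.
Variables (R : realType) (N : nat).
Implicit Types (p q u v w : 'rV[R]_N).

Let dotE u v : dot u v = ip u v. Proof. by []. Qed.

Lemma is_derive_dotr w p v : is_derive p v (dot w) (dot w v).
Proof.
have D := is_derive_dot (is_derive_cst w p v) (is_derive_id p v).
by apply: (is_derive_eq D); rewrite dotE ip0l add0r.
Qed.

Lemma sphere_proj1 p v : sphere_proj 1 p v = v - dot v p *: p.
Proof. by rewrite /sphere_proj expr1n divr1. Qed.

Lemma derive_sphere_proj w p v :
  'D_v (sphere_proj 1 ^~ w) p = - (dot w v *: p + dot w p *: v).
Proof.
rewrite (_ : sphere_proj 1 ^~ w = cst w - (fun y => dot w y *: y)); last first.
  by apply/funext => y; rewrite sphere_proj1.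
have D := is_deriveB (is_derive_cst w p v)
  (is_derive_scaled (is_derive_dotr w p v) (is_derive_id p v)).
by rewrite (@derive_val _ _ _ _ _ _ _ D) sub0r.
Qed.

(** The connection of two projected constant fields, also at points [q] off the sphere, since it is
    differentiated once more. The factor [1 - dot q q] vanishes on the sphere, but not outside
    it. *)
Definition proj_connection v w q : 'rV[R]_N :=
  ((1 - dot q q) * (2 * (dot v q * dot w q) - dot w v) + dot v q * dot w q) *: q
  - dot w q *: v.

Lemma sphere_connection_proj v w :
  sphere_connection 1 (sphere_proj 1 ^~ v) (sphere_proj 1 ^~ w) =
  proj_connection v w.
Proof.
apply/funext => q; rewrite /sphere_connection derive_sphere_proj !sphere_proj1.
rewrite /proj_connection !dotE !(ipDl, ipDr, ipNl, ipNr, ipZl, ipZr).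
rewrite -!dotE; apply/rowP => j; rewrite !mxE; ring.
Qed.

(** At [p] the coefficient of [q] vanishes together with its derivative, so only the last term
    contributes. *)
Lemma derive_proj_connection p u v w : dot p p = 1 ->
  dot u p = 0 -> dot v p = 0 -> dot w p = 0 ->
  'D_u (proj_connection v w) p = - dot w u *: v.
Proof.
move=> pp up vp wp.
have Dn : is_derive p u (fun q => 1 - dot q q) 0.
  have D := is_deriveB (is_derive_cst (1 : R) p u)
     (is_derive_dot (is_derive_id p u) (is_derive_id p u)).
  by apply: (is_derive_eq D); rewrite /= (ipC p u : dot p u = dot u p) up addr0 subr0.
have Dvw : is_derive p u (fun q => dot v q * dot w q) 0.
  apply: (is_derive_eq (is_deriveM (is_derive_dotr v p u) (is_derive_dotr w p u))).
  by rewrite vp wp !scale0r addr0.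
have D2 : is_derive p u (fun q => 2 * (dot v q * dot w q) - dot w v) 0.
  have D := is_deriveB (is_deriveM (is_derive_cst (2 : R) p u) Dvw)
     (is_derive_cst (dot w v) p u).
  by apply: (is_derive_eq D); rewrite /= !scaler0 addr0 subr0.
have Dc := is_deriveD (is_deriveM Dn D2) Dvw.
have D := is_deriveB (is_derive_scaled Dc (is_derive_id p u))
  (is_derive_scaled (is_derive_dotr w p u) (is_derive_cst v p u)).
have E := @derive_val _ _ _ _ _ _ _ D.
transitivity (- (dot w u *: v)); last by rewrite scaleNr.
apply: etrans; first exact: E.
rewrite /= !scaler0 !addr0 scale0r add0r.
rewrite -[X in X *: u]/((1 - dot p p) * _ + dot v p * dot w p).
by rewrite pp subrr mul0r vp mul0r addr0 scale0r sub0r.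
Qed.

(** The extended fields commute at [p], both derivatives being the same multiple of [p], so the
    bracket term drops out. *)
Lemma sphere_curvatureE p u v w : dot p p = 1 ->
  dot u p = 0 -> dot v p = 0 -> dot w p = 0 ->
  sphere_curvature 1 p u v w = dot w v *: u - dot w u *: v.
Proof.
move=> pp up vp wp; rewrite /sphere_curvature /sphere_curvature_fields.
rewrite !sphere_connection_proj.
have projE x : dot x p = 0 -> sphere_proj 1 p x = x.
  by move=> xp; rewrite sphere_proj1 xp scale0r subr0.
have E x y : dot x p = 0 -> dot y p = 0 ->
    sphere_connection 1 (sphere_proj 1 ^~ x) (proj_connection y w) p =
    - dot w x *: y.
  move=> xp yp; rewrite /sphere_connection (projE x xp).
  rewrite (derive_proj_connection pp xp yp wp) projE //.
  by rewrite dotE ipZl -dotE yp mulr0.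
rewrite (E u v up vp) (E v u vp up) {E}.
have -> : sphere_connection 1 (lie_bracket (sphere_proj 1 ^~ u) (sphere_proj 1 ^~ v))
    (sphere_proj 1 ^~ w) p = 0.
  rewrite /sphere_connection /lie_bracket (projE u up) (projE v vp).
  rewrite (derive_sphere_proj v p u) (derive_sphere_proj u p v) up vp !scale0r !addr0.
  rewrite [dot v u](ipC v u : dot v u = dot u v) subrr derive0.
  by rewrite sphere_proj1 dotE ip0l scale0r subr0.
by rewrite subr0 !scaleNr opprK addrC.
Qed.

End SphereCurvature.

(** * Coordinate functions as elements of the ring *)

Section Representation.
Variables (R : realType) (m : nat) (U : set 'rV[R]_m) (openU : open U).
Local Notation A := (smfun openU).

Lemma partial_coord (p q : nat) (V : 'rV[R]_m -> 'M[R]_(p, q)) i x a b :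
  derivable V x (delta_mx 0 i) ->
  partial i V x a b = partial i (fun y => V y a b) x.
Proof. by move=> dV; rewrite /partial (derive_mx dV) mxE. Qed.

Lemma smooth_upto_coord (p q k : nat) (V : 'rV[R]_m -> 'M[R]_(p, q)) a b :
  smooth_upto k U V -> smooth_upto k U (fun x => V x a b).
Proof.
have V0 (W : 'rV[R]_m -> 'M[R]_(p, q)) x :
    smooth_upto 0 U W -> U x -> C1_at (fun x => W x a b) x.
  move=> [W0 _] Ux; have [cW dW] := W0 x Ux; split.
    apply: (@continuous_comp _ _ _ W (fun M : 'M[R]_(p, q) => M a b)) => //.
    exact: coord_continuous.
  by move=> i; exact: (derivable_mxP _ _ _).1 (dW i) a b.
elim: k V => [|k IH] V sV; move: (sV) => [sV0 sVS]; split;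
  [by move=> x; exact: V0|exact: I|by move=> x; exact: V0|].
move=> i; apply: (eq_on_smooth_upto openU _ (IH _ (sVS i))) => x /[1!inE] Ux.
by have [_ /(_ i)] := sV0 x Ux; exact: partial_coord.
Qed.

Lemma smooth_coord (p q : nat) (V : 'rV[R]_m -> 'M[R]_(p, q)) a b :
  smooth_on U V -> smooth_on U (fun x => V x a b).
Proof.
move=> /smooth_uptoP sV; apply/smooth_uptoP => k; exact: smooth_upto_coord.
Qed.

(** The bridge between the two languages: [V] comes from the geometric definitions and is arbitrary
    off [U], [v] is its counterpart over the ring. *)
Definition rep (n : nat) (V : 'rV[R]_m -> 'rV[R]_n) (v : 'rV[A]_n) : Prop :=
  forall x (Ux : U x), V x = map_mx (ev Ux) v.

Lemma rep_smooth (n : nat) (V : 'rV[R]_m -> 'rV[R]_n) (sV : smooth_on U V) :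
  rep V (\row_k smfun_of openU (smooth_coord 0 k sV)).
Proof. by move=> x Ux; apply/rowP => k; rewrite !mxE /ev smfun_ofE. Qed.

Lemma rep_partial (n : nat) (V : 'rV[R]_m -> 'rV[R]_n) (v : 'rV[A]_n) i :
  rep V v -> rep (partial i V) (map_mx (sder i) v).
Proof.
move=> Vv x Ux.
pose W y := \row_k (v 0 k : A) y.
have dW : derivable W x (delta_mx 0 i).
  apply/derivable_mxP => a k.
  rewrite (_ : (fun y => W y a k) = (v 0 k : 'rV[R]_m -> R)); last first.
    by apply/funext => y; rewrite mxE.
  exact: smooth_derivable (smfun_smooth (v 0 k)) Ux.
transitivity (partial i W x).
  apply: (eq_on_partial openU); last by rewrite inE.
  by move=> y /[1!inE] Uy; rewrite (Vv y Uy); apply/rowP => k; rewrite !mxE.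
apply/rowP => k; rewrite (partial_coord _ _ dW) !mxE.
transitivity (partial i (v 0 k : 'rV[R]_m -> R) x).
  congr (partial i _ x).
  by apply/funext => y; rewrite mxE.
exact: (esym (sderE i (v 0 k) Ux)).
Qed.

Lemma dot_ev (n : nat) (u v : 'rV[A]_n) x (Ux : U x) :
  dot (map_mx (ev Ux) u) (map_mx (ev Ux) v) = ev Ux (ip u v).
Proof. by rewrite /dot map_trmx -map_mxM mxE. Qed.

Lemma partial_ev (f : 'rV[R]_m -> R) (a : A) i x (Ux : U x) :
  (forall y (Uy : U y), f y = ev Uy a) -> partial i f x = ev Ux (sder i a).
Proof.
move=> fa; apply: etrans (esym (sderE i a Ux)); apply: (eq_on_partial openU).
  by move=> y /[1!inE] Uy; rewrite (fa y Uy).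
by rewrite inE.
Qed.

End Representation.

(** Pairing the equation with [Fx] isolates [T]; inserting this value leaves [k] times the formula
    for [L]. *)
Lemma factor_equation_solve (R : realType) (n : nat) (X Y L Hx Fx : 'rV[R]_n)
    (k r a M T h : R) : k != 0 -> r != 0 ->
  ip L Fx = k * h -> ip Hx Fx = 0 -> ip Fx Fx = r ^+ 2 -> a = M - k * r ^- 2 ->
  X = k *: L + a *: (k *: Hx - (k * r ^- 2) *: Fx) -> Y = k *: Hx + a *: Fx ->
  X - T *: Fx + M *: Y = 0 ->
  T = a ^+ 2 + k ^+ 2 * r ^- 2 * h /\
  L = - (a + M) *: Hx + (k * r ^- 2 * h) *: Fx.
Proof.
move=> k0 r0 LF HF FF aE -> -> E.
have r2 : r ^+ 2 != 0 by rewrite expf_neq0.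
have ET : T = a ^+ 2 + k ^+ 2 * r ^- 2 * h.
  have := congr1 (fun y => ip y Fx) E.
  rewrite !(ipDl, ipNl, ipZl) ip0l LF HF FF => E2.
  by apply: (mulIf r2); rewrite -[LHS]addr0 -E2 aE; field.
split=> //; apply/eqP; rewrite -subr_eq0.
have : k *: (L - (- (a + M) *: Hx + (k * r ^- 2 * h) *: Fx)) = 0.
  by rewrite -[RHS]E ET; apply/rowP => j; rewrite !mxE aE; field.
by move=> /eqP; rewrite scaler_eq0 (negPf k0).
Qed.

(** * The geometry of an immersion, translated into the ring *)

Section LocalGeometry.
Variables (R : realType) (m N : nat) (r : R).
Variables (U : set 'rV[R]_m) (openU : open U).
Variables (g : 'rV[R]_m -> 'M[R]_m) (f : 'rV[R]_m -> 'rV[R]_N).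
Hypothesis r_neq0 : r != 0.
Hypothesis m_gt0 : (0 < m)%N.
Hypothesis f_sphere : forall x, U x -> dot (f x) (f x) = r ^+ 2.
Hypothesis gE : forall x, U x -> forall i j,
  g x i j = dot (partial i f x) (partial j f x).
Hypothesis g_unit : forall x, U x -> g x \in unitmx.
Local Notation A := (smfun openU).
Variable F : 'rV[A]_N.
Hypothesis rep_pos : rep f F.

Let d (i : 'I_m) : {additive A -> A} := @sder R m U openU i.

Let dM i (a b : A) : d i (a * b) = d i a * b + a * d i b.
Proof. exact: sderM. Qed.

Let dC i j (a : A) : d i (d j a) = d j (d i a).
Proof. exact: sderC. Qed.

Local Notation gA := (jac d F *m (jac d F)^T).

Lemma ev_metric x (Ux : U x) : map_mx (ev Ux) gA = g x.
Proof.
apply/matrixP => i j; rewrite mxE metricE gE//.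
by rewrite !(rep_partial _ rep_pos Ux) dot_ev.
Qed.

Lemma det_neq0 x : U x -> (\det gA : A) x != 0.
Proof.
move=> Ux; rewrite -[_ x]/(ev Ux _) -det_map_mx ev_metric.
by have := g_unit Ux; rewrite unitmxE unitfE.
Qed.

(** Cramer's formula: the Gram determinant has no zero on [U], so the inverse metric has smooth
    entries. *)
Definition cometric : 'M[A]_m := smfun_of openU (smooth_inv det_neq0) *: \adj gA.
Local Notation G := cometric.

Lemma cometricK : G *m gA = 1%:M.
Proof.
rewrite -scalemxAl mul_adj_mx scale_scalar_mx; congr _%:M.
apply: smfunP => x Ux.
have E := smfun_ofE openU (smooth_inv det_neq0) Ux.
rewrite -[LHS]/(smfun_of openU (smooth_inv det_neq0) x * (\det gA : A) x) E.
rewrite mulVf ?det_neq0 //; exact: (esym (scstE openU 1 Ux)).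
Qed.

Lemma ev_cometric x (Ux : U x) : invmx (g x) = map_mx (ev Ux) G.
Proof.
have E : map_mx (ev Ux) G *m g x = 1%:M.
  by rewrite -(ev_metric Ux) -map_mxM cometricK map_mx1.
by rewrite -[RHS]mulmx1 -(mulmxV (g_unit Ux)) mulmxA E mul1mx.
Qed.

Definition inv_sqradius : A := scst openU (r ^- 2).
Local Notation c0 := inv_sqradius.

Lemma pos_sqnorm : ip F F = scst openU (r ^+ 2).
Proof.
by apply: evP => x Ux; rewrite -dot_ev -rep_pos f_sphere // ev_scst.
Qed.

Lemma inv_sqradiusK : c0 * scst openU (r ^+ 2) = 1.
Proof. by rewrite -rmorphM /= mulVf ?rmorph1 // expf_neq0. Qed.

Let d_rho i : d i (scst openU (r ^+ 2)) = 0.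
Proof. exact: sder_scst. Qed.

(** With the metric written as inner products of first derivatives, the alternating sum reduces by
    [dC] to twice the product of the second derivative of [F] with a first one. *)
Lemma christoffel_ev k i j x (Ux : U x) :
  christoffel g k i j x = ev Ux (gam d F G k i j).
Proof.
have dg a b c : partial a (fun y => g y b c) x =
    ev Ux (ip (map_mx (d a) (map_mx (d b) F)) (map_mx (d c) F) +
           ip (map_mx (d a) (map_mx (d c) F)) (map_mx (d b) F)).
  rewrite (partial_ev (a := ip (map_mx (d b) F) (map_mx (d c) F))).
    by congr (ev Ux _); rewrite (ip_leibniz (@dM a)) [X in _ + X]ipC.
  by move=> y Uy; rewrite -(ev_metric Uy) mxE metricE.
rewrite /christoffel; under eq_bigr => l _ do rewrite !dg (ev_cometric Ux) mxE.
rewrite gamE row_codiff ip_sumr rmorph_sum big_distrr /=; apply: eq_bigr => l _.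
have X i1 i2 i3 : ip (map_mx (d i1) (map_mx (d i2) F)) (map_mx (d i3) F) =
  ip (map_mx (d i2) (map_mx (d i1) F)) (map_mx (d i3) F) by rewrite (dvC dC).
rewrite ipZr rmorphM !rmorphD /= (X j i) (X l i) (X l j).
by field.
Qed.

Local Notation dv i V := (map_mx (d i) V).
Local Notation nab i V := (nabla d F c0 i V).

Lemma sphere_proj_ev x (Ux : U x) (w : 'rV[A]_N) :
  sphere_proj r (f x) (map_mx (ev Ux) w) = map_mx (ev Ux) (w - (c0 * ip w F) *: F).
Proof.
rewrite /sphere_proj (rep_pos Ux) dot_ev map_mxB map_mxZ rmorphM /= ev_scst.
by rewrite [_ / _]mulrC.
Qed.

Lemma rep_pullback i (V : 'rV[R]_m -> 'rV[R]_N) (v : 'rV[A]_N) :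
  rep V v -> rep (pullback_connection r f i V) (nab i v).
Proof.
by move=> Vv x Ux; rewrite /pullback_connection (rep_partial i Vv Ux) sphere_proj_ev.
Qed.

Lemma sum_gam_ev (V : 'I_m -> 'rV[A]_N) i j x (Ux : U x) :
  \sum_k christoffel g k i j x *: map_mx (ev Ux) (V k) =
  map_mx (ev Ux) (\sum_k gam d F G k i j *: V k).
Proof.
rewrite map_mx_sum; apply: eq_bigr => k _.
by rewrite (christoffel_ev _ _ _ Ux) map_mxZ.
Qed.

Lemma metric_trace_ev (B : 'I_m -> 'I_m -> 'rV[A]_N) x (Ux : U x) b :
  (forall i j, b i j = map_mx (ev Ux) (B i j)) ->
  metric_trace g b x = map_mx (ev Ux) (\sum_i \sum_j G i j *: B i j).
Proof.
move=> bB; rewrite /metric_trace map_mx_sum; apply: eq_bigr => i _.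
rewrite map_mx_sum; apply: eq_bigr => j _.
by rewrite bB (ev_cometric Ux) [map_mx _ G i j]mxE [RHS]map_mxZ.
Qed.

Let pos_normal' : normal d F F.
Proof. exact: (pos_normal dM (@smfun_double_eq0 _ _ _ openU) pos_sqnorm d_rho). Qed.

(** Differentiating the orthogonality of [F] and its derivatives shows that the radial part of the
    second derivative is minus the metric coefficient times [c0 *: F]; the sphere projection removes
    it. *)
Lemma second_fundamental_formE i j x (Ux : U x) :
  second_fundamental_form r g f i j x =
  map_mx (ev Ux) (hess d F G i j F + (c0 * gA i j) *: F).
Proof.
rewrite /second_fundamental_form (rep_pullback i (rep_partial j rep_pos) Ux).
under eq_bigr => k _ do rewrite (rep_partial k rep_pos Ux).
rewrite sum_gam_ev -map_mxB; congr map_mx.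
rewrite /nabla /hess addrAC; congr (_ + _); rewrite -scaleNr; congr (_ *: _).
rewrite -mulrN metricE; congr (_ * _).
have := congr1 (d i) (pos_normal' j).
rewrite raddf0 (ip_leibniz (@dM i)) => /eqP; rewrite addrC addr_eq0 => /eqP E.
by rewrite ipC E opprK.
Qed.

Local Notation tau := (tau d F G c0).

Lemma trace_second_form :
  \sum_i \sum_j G i j *: (hess d F G i j F + (c0 * gA i j) *: F) = tau.
Proof.
rewrite /tau /lap.
have -> : m%:R * c0 = \sum_i \sum_j G i j * (c0 * gA i j).
  transitivity (c0 * \tr (G *m gA)).
    by rewrite cometricK mxtrace1 mulrC.
  rewrite /mxtrace big_distrr; apply: eq_bigr => i _; rewrite mxE big_distrr /=.
  apply: eq_bigr => j _; rewrite mulrCA; congr (_ * (_ * _)).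
  by rewrite !metricE ipC.
rewrite scaler_suml -big_split; apply: eq_bigr => i _.
rewrite scaler_suml -big_split; apply: eq_bigr => j _.
by rewrite scalerDr scalerA.
Qed.

Lemma mean_curvatureE :
  rep (mean_curvature r g f) (scst openU m%:R^-1 *: tau).
Proof.
move=> x Ux; rewrite /mean_curvature.
rewrite (metric_trace_ev (fun i j => second_fundamental_formE i j Ux)).
by rewrite trace_second_form map_mxZ /= ev_scst.
Qed.

Lemma tensionE : rep (tension r g f) tau.
Proof.
move=> x Ux; rewrite /tension (mean_curvatureE Ux) map_mxZ scalerA /= ev_scst.
by rewrite mulfV ?scale1r // pnatr_eq0 -lt0n.
Qed.

Let dbl := @smfun_double_eq0 R m U openU.

Lemma tau_normalE : normal d F tau.
Proof. exact: (tau_normal dM dbl cometricK c0 pos_sqnorm d_rho). Qed.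

Lemma tau_posE : ip tau F = 0.
Proof.
exact: (tau_pos dM dbl cometricK pos_sqnorm d_rho inv_sqradiusK).
Qed.

(** [tau] is orthogonal to the immersion and to the position, so each curvature term is minus a
    metric coefficient times [tau], with trace [- m%:R *: tau]. *)
Lemma bitensionE x (Ux : U x) : r = 1 ->
  bitension r g f x =
  map_mx (ev Ux) (lap d F G tau - ip tau tau *: F + m%:R *: tau).
Proof.
move=> r1; rewrite /bitension /rough_laplacian.
have c01 : c0 = 1 by rewrite /inv_sqradius r1 expr1n invr1 rmorph1.
rewrite (metric_trace_ev (Ux := Ux) (B := fun i j => nab i (nab j tau)
    - \sum_k gam d F G k i j *: nab k tau)); last first.
  move=> i j; rewrite (rep_pullback i (rep_pullback j tensionE) Ux) [RHS]map_mxB.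
  congr (_ - _); rewrite -sum_gam_ev; apply: eq_bigr => k _.
  by rewrite (rep_pullback k tensionE Ux).
rewrite (trace_nabla2 dM cometricK c0 tau_normalE tau_posE) opprK.
have -> : c0 * ip tau tau = ip tau tau.
  by rewrite -[RHS]mul1r; congr (_ * _).
rewrite [RHS]map_mxD; congr (_ + _).
rewrite (metric_trace_ev (Ux := Ux) (B := fun i j => - gA i j *: tau)); last first.
  move=> i j; rewrite (tensionE Ux) !(rep_partial _ rep_pos Ux) r1.
  rewrite (rep_pos Ux) sphere_curvatureE !dot_ev.
  - rewrite [ip _ tau]ipC tau_normalE rmorph0 scale0r sub0r.
    by rewrite map_mxZ rmorphN /= metricE ipC scaleNr.
  - by rewrite pos_sqnorm r1 expr1n ev_scst.
  - by rewrite ipC pos_normal' rmorph0.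
  - by rewrite tau_posE rmorph0.
  - by rewrite ipC pos_normal' rmorph0.
rewrite -map_mxN; congr map_mx.
rewrite -sumrN; under eq_bigr => i _ do rewrite -sumrN.
transitivity (\tr (G *m gA) *: tau); last by rewrite cometricK mxtrace1.
rewrite /mxtrace scaler_suml; apply: eq_bigr => i _; rewrite mxE scaler_suml.
apply: eq_bigr => j _.
by rewrite scaleNr scalerN opprK scalerA !metricE ipC.
Qed.

Definition mean_curv : 'rV[A]_N := scst openU m%:R^-1 *: tau.
Local Notation H := mean_curv.

Lemma tau_mean_curv : tau = m%:R *: H.
Proof.
rewrite scalerA -[m%:R](rmorph_nat (scst openU)) -rmorphM /=.
by rewrite mulfV ?rmorph1 ?scale1r // pnatr_eq0 -lt0n.
Qed.

Lemma mean_curv_normal : normal d F H.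
Proof. by move=> i; rewrite ipZl tau_normalE mulr0. Qed.

Lemma mean_curv_pos : ip H F = 0.
Proof. by rewrite ipZl tau_posE mulr0. Qed.

(** The derivative of [H] has no radial part, so the vanishing of its normal part makes it
    tangential in the ambient space. *)
Lemma mean_curv_parallel :
  (forall x, U x -> forall i,
     normal_connection r g f i (mean_curvature r g f) x = 0) ->
  forall i, dv i H *m tproj d F G = dv i H.
Proof.
move=> pmc i.
rewrite -(tangent_proj d F G); apply/rowP => k; apply: evP => x Ux.
have := pmc x Ux i.
have E : pullback_connection r f i (mean_curvature r g f) x = map_mx (ev Ux) (dv i H).
  by rewrite (rep_pullback i mean_curvatureE Ux)
    (nabla_normal dM c0 mean_curv_normal mean_curv_pos).
rewrite /normal_connection /tangent_part E.
rewrite (metric_trace_ev (Ux := Ux)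
  (B := fun i0 j => ip (dv i H) (dv i0 F) *: dv j F)).
  by move=> /eqP; rewrite subr_eq0 => /eqP/rowP/(_ k); rewrite !mxE => ->.
move=> i0 j; rewrite !(rep_partial _ rep_pos Ux) dot_ev map_mxZ.
by [].
Qed.

Lemma shape_operatorE x (Ux : U x) :
  shape_operator r g f x (mean_curvature r g f x) =
  map_mx (ev Ux) (second_form_H d F H *m G).
Proof.
rewrite /shape_operator map_mxM (ev_cometric Ux); congr (_ *m _).
apply/matrixP => i j; rewrite !mxE (second_fundamental_formE _ _ Ux).
rewrite (mean_curvatureE Ux) dot_ev; congr (ev Ux _).
rewrite ipDl ipZl [ip F _]ipC mean_curv_pos mulr0 addr0 /hess ipBl ip_suml.
by rewrite [X in _ - X]big1 ?subr0 // => k _; rewrite ipZl ipC mean_curv_normal mulr0.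
Qed.

(* [M] is the dimension of the product of which this factor is a part and [T]
   is the squared norm of its tension field. *)
Lemma biharmonic_factor (M T : R) x (Ux : U x) :
  let a := M - m%:R * r ^- 2 in
  let v := tau + scst openU a *: F in
  let h := dot (mean_curvature r g f x) (mean_curvature r g f x) in
  map_mx (ev Ux) (lap d F G v) - T *: f x + M *: map_mx (ev Ux) v = 0 ->
  T = a ^+ 2 + m%:R ^+ 2 * r ^- 2 * h /\
  map_mx (ev Ux) (lap d F G H) =
    - (a + M) *: mean_curvature r g f x + (m%:R * r ^- 2 * h) *: f x.
Proof.
move=> a v h.
have m0 : m%:R != 0 :> R by rewrite pnatr_eq0 -lt0n.
have d0 (c : R) i : d i (scst openU c) = 0 by exact: sder_scst.
have mE : m%:R = scst openU m%:R by rewrite rmorph_nat.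
have HxE := mean_curvatureE Ux.
have FxE := rep_pos Ux.
have Ev : map_mx (ev Ux) v = m%:R *: mean_curvature r g f x + a *: f x.
  rewrite /v tau_mean_curv mE map_mxD [X in X + _]map_mxZ [X in _ + X]map_mxZ /=.
  by rewrite !ev_scst HxE FxE.
have El : map_mx (ev Ux) (lap d F G v) =
    m%:R *: map_mx (ev Ux) (lap d F G H)
    + a *: (m%:R *: mean_curvature r g f x - (m%:R * r ^- 2) *: f x).
  rewrite /v tau_mean_curv mE (lap_comb dM cometricK _ _ (d0 _) (d0 _)).
  rewrite (lap_tau d F G c0) tau_mean_curv mE map_mxD.
  rewrite [X in X + _]map_mxZ [X in _ + X]map_mxZ map_mxB.
  rewrite [X in _ + _ *: (X - _)]map_mxZ [X in _ + _ *: (_ - X)]map_mxZ /=.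
  by rewrite rmorphM /= !ev_scst HxE FxE.
have LF : ip (map_mx (ev Ux) (lap d F G H)) (f x) = m%:R * h.
  rewrite FxE -[LHS]/(dot _ _) dot_ev.
  rewrite (lap_tau_pos dM cometricK c0 mean_curv_normal mean_curv_pos).
  by rewrite tau_mean_curv mE ipZr rmorphM /= ev_scst /h HxE dot_ev.
have HF : ip (mean_curvature r g f x) (f x) = 0.
  by rewrite HxE FxE -[LHS]/(dot _ _) dot_ev mean_curv_pos rmorph0.
exact: (factor_equation_solve m0 r_neq0 LF HF (f_sphere Ux) (erefl a) El Ev).
Qed.

(** The passage to linear algebra: at one point only two real matrices and their traces survive. The
    lapse from equality to inequality is the evaluated sum of squares. The formula for [lap] is
    assumed at all points because it must hold as an identity in the ring, where it can be
    differentiated. *)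
Lemma simons_at (kap : R) :
  (forall i, dv i H *m tproj d F G = dv i H) ->
  (forall x (Ux : U x),
     let h := dot (mean_curvature r g f x) (mean_curvature r g f x) in
     map_mx (ev Ux) (lap d F G H) =
     - kap *: mean_curvature r g f x + (m%:R * r ^- 2 * h) *: f x) ->
  forall x, U x ->
  let h := dot (mean_curvature r g f x) (mean_curvature r g f x) in
  exists P S : 'M[R]_N,
  [/\ P^T = P, P *m P = P, \tr P = m%:R, S^T = S & S *m P = S] /\
  [/\ \tr S = m%:R * h, \tr (S *m S) = kap * h,
    m%:R * \tr (S *m S *m S) <= kap * \tr (S *m S) + m%:R * r ^- 2 * h * \tr S
       - m%:R * r ^- 2 * \tr (S *m S)
  & S = h *: P -> shape_operator r g f x (mean_curvature r g f x) = h%:M].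
Proof.
move=> H_par H_lap x Ux h.
have mE : m%:R = scst openU m%:R by rewrite rmorph_nat.
have hE : h = ev Ux (ip H H) by rewrite /h (mean_curvatureE Ux) dot_ev.
have lapH : lap d F G H = - scst openU kap *: H + (m%:R * c0 * ip H H) *: F.
  apply/rowP => k; apply: evP => y Uy.
  have := H_lap y Uy; rewrite (rep_pos Uy) (mean_curvatureE Uy) dot_ev => /rowP/(_ k).
  rewrite mxE => ->; rewrite !mxE mE !(rmorphD, rmorphM, rmorphN) /=.
  by rewrite !ev_scst.
have d_kap i : d i (scst openU kap) = 0 by exact: sder_scst.
pose P := tproj d F G; pose S := shape_ext d F G H.
have P_sym : P^T = P := tproj_sym cometricK.
have P_idem : P *m P = P := tproj_idem cometricK.
have S_sym : S^T = S := shape_ext_sym dM dC mean_curv_normal H_par.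
have SP : S *m P = S := shape_ext_tproj dM cometricK mean_curv_normal H_par.
have trS : \tr S = m%:R * ip H H :=
  mxtrace_shape_ext dM cometricK tau_mean_curv mean_curv_normal mean_curv_pos H_par.
have trS2 : \tr (S *m S) = scst openU kap * ip H H :=
  mxtrace_shape_ext2 dM dC cometricK mean_curv_normal mean_curv_pos H_par lapH.
have JSJ : jac d F *m S *m (jac d F)^T = second_form_H d F H :=
  jac_shape_ext dM cometricK mean_curv_normal H_par.
pose E al := P *m map_mx (tder d F G al) S *m P.
have [E_sym simons] : (forall al, (E al)^T = E al) /\
    \sum_al \tr (E al *m E al) =
    scst openU kap * \tr (S *m S) + m%:R * c0 * ip H H * \tr S
    - m%:R * \tr (S *m S *m S) - m%:R * c0 * \tr (S *m S) :=
  shape_ext_simons dM dC dbl cometricK d_rho inv_sqradiusK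
    tau_mean_curv mean_curv_normal mean_curv_pos H_par d_kap lapH.
have JP : jac d F *m P = jac d F := jac_tproj cometricK.
have trP : \tr P = m%:R := mxtrace_tproj cometricK.
clearbody E S P.
have tr_ev (B : 'M[A]_N) : \tr (map_mx (ev Ux) B) = ev Ux (\tr B).
  by rewrite /mxtrace rmorph_sum; apply: eq_bigr => i _; rewrite mxE.
exists (map_mx (ev Ux) P), (map_mx (ev Ux) S).
rewrite -!map_mxM !tr_ev !map_trmx P_sym P_idem S_sym SP trS trS2.
split; first by split=> //; rewrite trP rmorph_nat.
split.
- by rewrite rmorphM /= rmorph_nat hE.
- by rewrite rmorphM /= ev_scst hE.
- have := congr1 (ev Ux) simons; rewrite rmorph_sum => simons_x.
  have : 0 <= \sum_al ev Ux (\tr (E al *m E al)).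
    apply: sumr_ge0 => al _; rewrite -{2}(E_sym al) /mxtrace rmorph_sum.
    apply: sumr_ge0 => i _; rewrite mxE rmorph_sum; apply: sumr_ge0 => j _.
    by rewrite rmorphM /= [(E al)^T _ _]mxE -expr2 sqr_ge0.
  rewrite simons_x trS trS2 mE !(rmorphB, rmorphD, rmorphM) /= !ev_scst -hE.
  lra.
- move=> SE; rewrite (shape_operatorE Ux) -JSJ !map_mxM SE.
  rewrite -scalemxAr -!scalemxAl -!map_mxM JP.
  by rewrite (mulmx1C cometricK) map_mx1 scalemx1.
Qed.

End LocalGeometry.

(** * Products *)

Section LinearPullback.
Variables (R : realType) (m k : nat).
Variables (U : set 'rV[R]_m) (openU : open U).
Variables (U1 : set 'rV[R]_k) (openU1 : open U1).
(** [s j] is the coordinate direction onto which [pr] sends the j-th one, [None] if [pr] kills it;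
    this covers both projections of a product. *)
Variables (pr : {linear 'rV[R]_m -> 'rV[R]_k}) (s : 'I_m -> option 'I_k).
Hypothesis pr_continuous : continuous pr.
Hypothesis prU : forall x, U x -> U1 (pr x).
Hypothesis pr_delta : forall j : 'I_m,
  pr (delta_mx 0 j) = if s j is Some i then delta_mx 0 i else 0.
Implicit Types f : 'rV[R]_k -> R.

Let quotient_comp f x v :
  (fun h : R => h^-1 *: (((f \o pr) \o shift x) (h *: v) - (f \o pr) x)) =
  (fun h : R => h^-1 *: ((f \o shift (pr x)) (h *: pr v) - f (pr x))).
Proof.
apply/funext => h /=.
by have -> : pr (h *: v + x) = h *: pr v + pr x := linearP pr h v x.
Qed.

Lemma derivable_comp_linear f x v :
  derivable f (pr x) (pr v) -> derivable (f \o pr) x v.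
Proof. by rewrite /derivable quotient_comp. Qed.

Lemma derive_comp_linear f x v : 'D_v (f \o pr) x = 'D_(pr v) f (pr x).
Proof. by rewrite /derive quotient_comp. Qed.

Lemma partial_comp_linear f j x : partial j (f \o pr) x =
  if s j is Some i then partial i f (pr x) else 0.
Proof.
rewrite /partial derive_comp_linear pr_delta; case: (s j) => // .
by rewrite derive0.
Qed.

Lemma smooth_upto_comp_linear n f :
  smooth_upto n U1 f -> smooth_upto n U (f \o pr).
Proof.
have C1 f' x : smooth_upto 0 U1 f' -> U x -> C1_at (f' \o pr) x.
  move=> [f0 _] Ux; have [cf df] := f0 _ (prU Ux); split.
    apply: (@continuous_comp _ _ _ pr f'); [exact: pr_continuous|exact: cf].
  move=> j; apply: derivable_comp_linear; rewrite pr_delta.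
  by case: (s j) => [i|]; [exact: df|exact: derivable0].
elim: n f => [|n IH] f sf; move: (sf) => [f0 fS]; split;
  [by move=> x; exact: C1|exact: I|by move=> x; exact: C1|].
move=> j; rewrite (_ : partial j _ =
    if s j is Some i then partial i f \o pr else cst 0); last first.
  by apply/funext => x; rewrite partial_comp_linear; case: (s j).
by case: (s j) => [i|]; [exact: (IH _ (fS i))|exact: smooth_upto_cst].
Qed.

Lemma smooth_comp_linear f : smooth_on U1 f -> smooth_on U (f \o pr).
Proof.
move=> /smooth_uptoP sf; apply/smooth_uptoP => n; exact: smooth_upto_comp_linear.
Qed.

Definition spull (a : smfun openU1) : smfun openU :=
  smfun_of openU (smooth_comp_linear (smfun_smooth a)).

Lemma spullE a x : U x -> spull a x = a (pr x).
Proof. exact: smfun_ofE. Qed.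

Fact spull_zmod : zmod_morphism spull.
Proof.
move=> a b; apply: smfunP => x Ux.
by rewrite -[RHS]/(spull a x - spull b x) !(spullE _ Ux).
Qed.

Fact spull_monoid : monoid_morphism spull.
Proof.
split=> [|a b]; apply: smfunP => x Ux; last first.
  by rewrite -[RHS]/(spull a x * spull b x) !(spullE _ Ux).
by rewrite (spullE _ Ux) (scstE openU1 1 (prU Ux)) (scstE openU 1 Ux).
Qed.

HB.instance Definition _ :=
  GRing.isZmodMorphism.Build (smfun openU1) (smfun openU) spull spull_zmod.
HB.instance Definition _ :=
  GRing.isMonoidMorphism.Build (smfun openU1) (smfun openU) spull spull_monoid.

Lemma sder_spull j a :
  sder j (spull a) = if s j is Some i then spull (sder i a) else 0.
Proof.
apply: smfunP => x Ux; rewrite (sderE j _ Ux) /spull (partial_smfun_of openU _ j Ux).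
rewrite partial_comp_linear; case: (s j) => [i|] //.
by rewrite (spullE _ Ux) (sderE i _ (prU Ux)).
Qed.

Lemma ev_spull a x (Ux : U x) : ev Ux (spull a) = ev (prU Ux) a.
Proof. exact: spullE. Qed.

Lemma spull_scst c : spull (scst openU1 c) = scst openU c.
Proof.
by apply: smfunP => x Ux; rewrite (spullE _ Ux) !scstE //; exact: prU.
Qed.

End LinearPullback.

(* The algebraic geometry of a product immersion [row_mx F1 F2]: [i1] and [i2]
   embed the functions on the factors into the functions on the product. *)
Section ProductImmersion.
Variables (A A1 A2 : comPzRingType) (m1 m2 N1 N2 : nat).
Variables (i1 : {rmorphism A1 -> A}) (i2 : {rmorphism A2 -> A}).
Variables (d : 'I_(m1 + m2) -> {additive A -> A}).
Variables (d1 : 'I_m1 -> {additive A1 -> A1}) (d2 : 'I_m2 -> {additive A2 -> A2}).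
Hypothesis dM : forall i a b, d i (a * b) = d i a * b + a * d i b.
Hypothesis d1M : forall i a b, d1 i (a * b) = d1 i a * b + a * d1 i b.
Hypothesis d2M : forall i a b, d2 i (a * b) = d2 i a * b + a * d2 i b.
Hypothesis d_i1l : forall i a, d (lshift m2 i) (i1 a) = i1 (d1 i a).
Hypothesis d_i1r : forall i a, d (rshift m1 i) (i1 a) = 0.
Hypothesis d_i2l : forall i a, d (lshift m2 i) (i2 a) = 0.
Hypothesis d_i2r : forall i a, d (rshift m1 i) (i2 a) = i2 (d2 i a).
Variables (F1 : 'rV[A1]_N1) (F2 : 'rV[A2]_N2) (G1 : 'M[A1]_m1) (G2 : 'M[A2]_m2).
Variable G : 'M[A]_(m1 + m2).

Definition prod_row (n1 n2 : nat) (v1 : 'rV[A1]_n1) (v2 : 'rV[A2]_n2) :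
  'rV[A]_(n1 + n2) := row_mx (map_mx i1 v1) (map_mx i2 v2).
Local Notation F := (prod_row F1 F2).

Hypothesis GK1 : G1 *m (jac d1 F1 *m (jac d1 F1)^T) = 1%:M.
Hypothesis GK2 : G2 *m (jac d2 F2 *m (jac d2 F2)^T) = 1%:M.
Hypothesis GK : G *m (jac d F *m (jac d F)^T) = 1%:M.

Lemma jac_prod : jac d F =
  block_mx (map_mx i1 (jac d1 F1)) 0 0 (map_mx i2 (jac d2 F2)).
Proof.
apply/matrixP => i al; rewrite mxE.
case: (split_ordP i) => i' ->; case: (split_ordP al) => al' ->.
- by rewrite block_mxEul row_mxEl !mxE d_i1l.
- by rewrite block_mxEur row_mxEr !mxE d_i2l.
- by rewrite block_mxEdl row_mxEl !mxE d_i1r.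
- by rewrite block_mxEdr row_mxEr !mxE d_i2r.
Qed.

Lemma metric_prod : jac d F *m (jac d F)^T =
  block_mx (map_mx i1 (jac d1 F1 *m (jac d1 F1)^T)) 0
           0 (map_mx i2 (jac d2 F2 *m (jac d2 F2)^T)).
Proof.
rewrite jac_prod tr_block_mx mulmx_block !trmx0 !mulmx0 !mul0mx !addr0 !add0r.
by rewrite !map_mxM !map_trmx.
Qed.

(** The block matrix is also an inverse of the metric, and inverses are unique. *)
Lemma cometric_prod : G = block_mx (map_mx i1 G1) 0 0 (map_mx i2 G2).
Proof.
set G' := block_mx _ _ _ _.
have G'K : G' *m (jac d F *m (jac d F)^T) = 1%:M.
  rewrite metric_prod mulmx_block !mulmx0 !mul0mx !addr0 !add0r -!map_mxM GK1 GK2.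
  by rewrite !map_mx1 -scalar_mx_block.
by rewrite -[G']mulmx1 -(mulmx1C GK) mulmxA G'K mul1mx.
Qed.

Lemma codiff_prod : codiff d F G =
  block_mx (map_mx i1 (codiff d1 F1 G1)) 0 0 (map_mx i2 (codiff d2 F2 G2)).
Proof.
rewrite /codiff jac_prod cometric_prod mulmx_block.
by rewrite !mulmx0 !mul0mx !addr0 !add0r -!map_mxM.
Qed.

Lemma tder_prod_ll al a : tder d F G (lshift N2 al) (i1 a) = i1 (tder d1 F1 G1 al a).
Proof.
rewrite /tder codiff_prod big_split_ord /= [X in _ + X]big1 => [|i _].
  rewrite addr0 rmorph_sum; apply: eq_bigr => i _.
  by rewrite block_mxEul mxE d_i1l rmorphM.
by rewrite d_i1r mulr0.
Qed.

Lemma tder_prod_rl al a : tder d F G (rshift N1 al) (i1 a) = 0.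
Proof.
rewrite /tder codiff_prod big_split_ord /= !big1 ?addr0 // => i _.
  by rewrite d_i1r mulr0.
by rewrite block_mxEur mxE mul0r.
Qed.

Lemma tder_prod_lr al a : tder d F G (lshift N2 al) (i2 a) = 0.
Proof.
rewrite /tder codiff_prod big_split_ord /= !big1 ?addr0 // => i _.
  by rewrite block_mxEdl mxE mul0r.
by rewrite d_i2l mulr0.
Qed.

Lemma tder_prod_rr al a : tder d F G (rshift N1 al) (i2 a) = i2 (tder d2 F2 G2 al a).
Proof.
rewrite /tder codiff_prod big_split_ord /= big1 => [|i _].
  rewrite add0r rmorph_sum; apply: eq_bigr => i _.
  by rewrite block_mxEdr mxE d_i2r rmorphM.
by rewrite d_i2l mulr0.
Qed.

Lemma tdv_prod_l n1 n2 (v1 : 'rV[A1]_n1) (v2 : 'rV[A2]_n2) al :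
  map_mx (tder d F G (lshift N2 al)) (prod_row v1 v2) =
  prod_row (map_mx (tder d1 F1 G1 al) v1) 0.
Proof.
rewrite /prod_row map_row_mx map_mx0; congr row_mx; apply/rowP => k; rewrite !mxE.
  exact: tder_prod_ll.
exact: tder_prod_lr.
Qed.

Lemma tdv_prod_r n1 n2 (v1 : 'rV[A1]_n1) (v2 : 'rV[A2]_n2) al :
  map_mx (tder d F G (rshift N1 al)) (prod_row v1 v2) =
  prod_row 0 (map_mx (tder d2 F2 G2 al) v2).
Proof.
rewrite /prod_row map_row_mx map_mx0; congr row_mx; apply/rowP => k; rewrite !mxE.
  exact: tder_prod_rl.
exact: tder_prod_rr.
Qed.

Lemma prod_rowD n1 n2 (v1 w1 : 'rV[A1]_n1) (v2 w2 : 'rV[A2]_n2) :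
  prod_row (v1 + w1) (v2 + w2) = prod_row v1 v2 + prod_row w1 w2.
Proof. by rewrite /prod_row !map_mxD add_row_mx. Qed.

Lemma lap_prod (v1 : 'rV[A1]_N1) (v2 : 'rV[A2]_N2) :
  lap d F G (prod_row v1 v2) = prod_row (lap d1 F1 G1 v1) (lap d2 F2 G2 v2).
Proof.
rewrite (lap_tder dM GK) (lap_tder d1M GK1) (lap_tder d2M GK2) big_split_ord /=.
have split_row w1 w2 : @prod_row N1 N2 w1 w2 = prod_row w1 0 + prod_row 0 w2.
  by rewrite -prod_rowD addr0 add0r.
rewrite [RHS]split_row.
congr (_ + _).
  rewrite (big_morph (fun w => @prod_row N1 N2 w 0) (id1 := 0) (op1 := +%R)).
  - by apply: eq_bigr => al _; rewrite !tdv_prod_l.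
  - by move=> w w'; rewrite -prod_rowD addr0.
  - by rewrite /prod_row !map_mx0 row_mx0.
rewrite (big_morph (fun w => @prod_row N1 N2 0 w) (id1 := 0) (op1 := +%R)).
- by apply: eq_bigr => al _; rewrite !tdv_prod_r.
- by move=> w w'; rewrite -prod_rowD addr0.
- by rewrite /prod_row !map_mx0 row_mx0.
Qed.

End ProductImmersion.

(** [umbilic] is an opaque proposition here, so that the statement about the shape operator passes
    through unchanged. *)
Lemma factor_conclusion (R : realType) (N : nat) (k r M h : R) (umbilic : Prop) :
  let a := M - k * r ^- 2 in
  let T := a ^+ 2 + k ^+ 2 * r ^- 2 * h in
  0 < k -> r != 0 -> 0 < h ->
  (exists P S : 'M[R]_N,
    [/\ P^T = P, P *m P = P, \tr P = k, S^T = S & S *m P = S] /\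
    [/\ \tr S = k * h, \tr (S *m S) = (a + M) * h,
      k * \tr (S *m S *m S) <= (a + M) * \tr (S *m S) + k * r ^- 2 * h * \tr S
         - k * r ^- 2 * \tr (S *m S)
    & S = h *: P -> umbilic]) ->
  (T = M ^+ 2 \/ (k ^+ 2 * h - a * k) / Num.sqrt T <= k - 2) /\
  (T = M ^+ 2 -> umbilic).
Proof.
move=> a T k0 r0 h0 [P [S [[P_sym P_idem trP S_sym SP] [trS trS2 simons umb]]]].
have r2 : 0 < r ^- 2 by rewrite invr_gt0 exprn_even_gt0.
have c0 : 0 < k * r ^- 2 by rewrite mulr_gt0.
have cE : k * r ^- 2 = M - a by rewrite /a subKr.
have TE : T = a ^+ 2 + k * (k * r ^- 2) * h by rewrite /T expr2 mulrA.
have T0 : 0 < T by rewrite TE ltr_wpDl ?sqr_ge0 // !mulr_gt0.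
split.
  apply: (@factor_gap _ _ P S k M a (k * r ^- 2) h T (Num.sqrt T)) => //.
  - by rewrite sqrtr_gt0.
  - by rewrite gt_eqF.
  - by rewrite sqr_sqrtr // ltW.
move=> TM; apply: umb; apply: (@umbilic_eq _ _ P S k (a + M) h) => //.
(* [T = M ^+ 2] says c k h = M^2 - a^2 with c = M - a; cancelling c gives the hypothesis of
   [umbilic_eq]. *)
have : (k * r ^- 2) * (k * h) = (k * r ^- 2) * (a + M).
  have -> : k * r ^- 2 * (k * h) = T - a ^+ 2 by rewrite TE; ring.
  by rewrite TM cE; ring.
by move/(mulfI (lt0r_neq0 c0)).
Qed.

(** * The product immersion and its biharmonic equation *)

Section LocalProduct.
Variables (R : realType) (m1 m2 N1 N2 : nat) (r1 r2 : R).
Variables (U1 : set 'rV[R]_m1) (openU1 : open U1).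
Variables (U2 : set 'rV[R]_m2) (openU2 : open U2).
Variables (g1 : 'rV[R]_m1 -> 'M[R]_m1) (f1 : 'rV[R]_m1 -> 'rV[R]_N1).
Variables (g2 : 'rV[R]_m2 -> 'M[R]_m2) (f2 : 'rV[R]_m2 -> 'rV[R]_N2).
Hypothesis r1_neq0 : r1 != 0.
Hypothesis r2_neq0 : r2 != 0.
Hypothesis r_sum : r1 ^+ 2 + r2 ^+ 2 = 1.
Hypothesis m1_gt0 : (0 < m1)%N.
Hypothesis m2_gt0 : (0 < m2)%N.
Hypothesis f1_smooth : smooth_on U1 f1.
Hypothesis f2_smooth : smooth_on U2 f2.
Hypothesis f1_sphere : forall x, U1 x -> dot (f1 x) (f1 x) = r1 ^+ 2.
Hypothesis f2_sphere : forall x, U2 x -> dot (f2 x) (f2 x) = r2 ^+ 2.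
Hypothesis g1E : forall x, U1 x -> forall i j,
  g1 x i j = dot (partial i f1 x) (partial j f1 x).
Hypothesis g2E : forall x, U2 x -> forall i j,
  g2 x i j = dot (partial i f2 x) (partial j f2 x).
Hypothesis g1_unit : forall x, U1 x -> g1 x \in unitmx.
Hypothesis g2_unit : forall x, U2 x -> g2 x \in unitmx.

Definition prod_domain : set 'rV[R]_(m1 + m2) :=
  [set x | U1 (lsubmx x) /\ U2 (rsubmx x)].
Local Notation U := prod_domain.

Definition prod_metric (x : 'rV[R]_(m1 + m2)) : 'M[R]_(m1 + m2) :=
  block_mx (g1 (lsubmx x)) 0 0 (g2 (rsubmx x)).
Local Notation g := prod_metric.

Definition prod_immersion (x : 'rV[R]_(m1 + m2)) : 'rV[R]_(N1 + N2) :=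
  row_mx (f1 (lsubmx x)) (f2 (rsubmx x)).
Local Notation f := prod_immersion.

Lemma lsubmx_continuous : continuous (lsubmx : 'rV[R]_(m1 + m2) -> 'rV[R]_m1).
Proof. by move=> x; apply: differentiable_continuous; exact: differentiable_lsubmx. Qed.

Lemma rsubmx_continuous : continuous (rsubmx : 'rV[R]_(m1 + m2) -> 'rV[R]_m2).
Proof. by move=> x; apply: differentiable_continuous; exact: differentiable_rsubmx. Qed.

Lemma prod_domain_open : open U.
Proof.
rewrite (_ : U = lsubmx @^-1` U1 `&` rsubmx @^-1` U2) //.
by apply: openI; apply: open_comp => // x _;
  [exact: lsubmx_continuous|exact: rsubmx_continuous].
Qed.
Local Notation openU := prod_domain_open.

Definition lindex (j : 'I_(m1 + m2)) : option 'I_m1 :=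
  if fintype.split j is inl i then Some i else None.
Definition rindex (j : 'I_(m1 + m2)) : option 'I_m2 :=
  if fintype.split j is inr i then Some i else None.

Lemma lsubmx_delta j : lsubmx (delta_mx 0 j : 'rV[R]_(m1 + m2)) =
  if lindex j is Some i then delta_mx 0 i else 0.
Proof.
rewrite /lindex; case: split_ordP => i ->; apply/rowP => k; rewrite !mxE eqxx /=.
  by rewrite eq_lshift.
by rewrite eq_lrshift.
Qed.

Lemma rsubmx_delta j : rsubmx (delta_mx 0 j : 'rV[R]_(m1 + m2)) =
  if rindex j is Some i then delta_mx 0 i else 0.
Proof.
rewrite /rindex; case: split_ordP => i ->; apply/rowP => k; rewrite !mxE eqxx /=.
  by rewrite eq_rlshift.
by rewrite eq_rshift.
Qed.

Let lU x : U x -> U1 (lsubmx x). Proof. by case. Qed.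
Let rU x : U x -> U2 (rsubmx x). Proof. by case. Qed.

Let i1 : {rmorphism smfun openU1 -> smfun openU} :=
  spull openU (openU1 := openU1) lsubmx_continuous lU lsubmx_delta.
Let i2 : {rmorphism smfun openU2 -> smfun openU} :=
  spull openU (openU1 := openU2) rsubmx_continuous rU rsubmx_delta.

Let F1 : 'rV[smfun openU1]_N1 :=
  \row_k smfun_of openU1 (smooth_coord openU1 0 k f1_smooth).
Let F2 : 'rV[smfun openU2]_N2 :=
  \row_k smfun_of openU2 (smooth_coord openU2 0 k f2_smooth).
Let F : 'rV[smfun openU]_(N1 + N2) := prod_row i1 i2 F1 F2.

Let rep1 : rep f1 F1. Proof. exact: rep_smooth. Qed.
Let rep2 : rep f2 F2. Proof. exact: rep_smooth. Qed.

Lemma ev_prod_row n1 n2 (v1 : 'rV[smfun openU1]_n1) (v2 : 'rV[smfun openU2]_n2)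
    x (Ux : U x) :
  map_mx (ev (openU := openU) Ux) (prod_row i1 i2 v1 v2) =
  row_mx (map_mx (ev (lU Ux)) v1) (map_mx (ev (rU Ux)) v2).
Proof.
rewrite /prod_row map_row_mx; congr row_mx; apply/rowP => k; rewrite !mxE.
  exact: ev_spull.
exact: ev_spull.
Qed.

Let repF : rep f F.
Proof. by move=> x Ux; rewrite ev_prod_row -rep1 -rep2. Qed.

Let d (i : 'I_(m1 + m2)) : {additive smfun openU -> smfun openU} :=
  @sder R _ U openU i.
Let d1 (i : 'I_m1) : {additive smfun openU1 -> smfun openU1} :=
  @sder R m1 U1 openU1 i.
Let d2 (i : 'I_m2) : {additive smfun openU2 -> smfun openU2} :=
  @sder R m2 U2 openU2 i.

Let lindexl i : lindex (lshift m2 i) = Some i.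
Proof. by rewrite /lindex (unsplitK (inl i)). Qed.
Let lindexr i : lindex (rshift m1 i) = None.
Proof. by rewrite /lindex (unsplitK (inr i)). Qed.
Let rindexl i : rindex (lshift m2 i) = None.
Proof. by rewrite /rindex (unsplitK (inl i)). Qed.
Let rindexr i : rindex (rshift m1 i) = Some i.
Proof. by rewrite /rindex (unsplitK (inr i)). Qed.

Let d_i1l i a : d (lshift m2 i) (i1 a) = i1 (d1 i a).
Proof. by rewrite /d /i1 /= sder_spull lindexl. Qed.
Let d_i1r i a : d (rshift m1 i) (i1 a) = 0.
Proof. by rewrite /d /i1 /= sder_spull lindexr. Qed.
Let d_i2l i a : d (lshift m2 i) (i2 a) = 0.
Proof. by rewrite /d /i2 /= sder_spull rindexl. Qed.
Let d_i2r i a : d (rshift m1 i) (i2 a) = i2 (d2 i a).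
Proof. by rewrite /d /i2 /= sder_spull rindexr. Qed.

Lemma prod_sphere x : U x -> dot (f x) (f x) = 1 ^+ 2.
Proof.
move=> [Ux1 Ux2]; rewrite /dot /prod_immersion tr_row_mx mul_row_col mxE.
by rewrite -![(_ *m _) 0 0]/(dot _ _) f1_sphere // f2_sphere // r_sum expr1n.
Qed.

Let metricF x (Ux : U x) :
  map_mx (ev (openU := openU) Ux) (jac d F *m (jac d F)^T) = g x.
Proof.
rewrite (metric_prod d_i1l d_i1r d_i2l d_i2r) map_block_mx !map_mx0.
rewrite /prod_metric -(ev_metric g1E rep1 (lU Ux)) -(ev_metric g2E rep2 (rU Ux)).
congr block_mx; apply/matrixP => i j; rewrite !mxE; exact: ev_spull.
Qed.

Lemma prod_metricE x : U x -> forall i j,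
  g x i j = dot (partial i f x) (partial j f x).
Proof.
move=> Ux i j; rewrite -(metricF Ux) mxE metricE.
by rewrite !(rep_partial _ repF Ux) dot_ev.
Qed.

Lemma prod_metric_unit x : U x -> g x \in unitmx.
Proof.
move=> [Ux1 Ux2]; rewrite unitmxE /prod_metric det_ublock unitrM -!unitmxE.
by rewrite g1_unit // g2_unit.
Qed.

Let m_gt0 : (0 < m1 + m2)%N. Proof. by rewrite addn_gt0 m1_gt0. Qed.
Let one_neq0 : 1 != 0 :> R. Proof. exact: oner_neq0. Qed.

Let G1 := cometric g1E g1_unit rep1.
Let G2 := cometric g2E g2_unit rep2.
Let G := cometric prod_metricE prod_metric_unit repF.
Let H1 := mean_curv r1 g1E g1_unit rep1.
Let H2 := mean_curv r2 g2E g2_unit rep2.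
Let c1 := inv_sqradius r1 openU1.
Let c2 := inv_sqradius r2 openU2.
Let c := inv_sqradius 1 openU.
Let M : R := (m1 + m2)%:R.
Let a1 := M - m1%:R * r1 ^- 2.
Let a2 := M - m2%:R * r2 ^- 2.
Let v1 := tau d1 F1 G1 c1 + scst openU1 a1 *: F1.
Let v2 := tau d2 F2 G2 c2 + scst openU2 a2 *: F2.

Let scst_nat (k : nat) (V : set 'rV[R]_k) (openV : open V) n :
  n%:R = scst openV n%:R.
Proof. by rewrite rmorph_nat. Qed.

(** The radial correction for radius [r1] and the coefficient [a1] add up to the correction [M] for
    the unit sphere. *)
Let v1E : v1 = lap d1 F1 G1 F1 + scst openU1 M *: F1.
Proof.
rewrite /v1 /tau -addrA -scalerDl scst_nat -rmorphM -rmorphD /=.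
by congr (_ + scst _ _ *: _); rewrite /a1 addrC subrK.
Qed.

Let v2E : v2 = lap d2 F2 G2 F2 + scst openU2 M *: F2.
Proof.
rewrite /v2 /tau -addrA -scalerDl scst_nat -rmorphM -rmorphD /=.
by congr (_ + scst _ _ *: _); rewrite /a2 addrC subrK.
Qed.

Let lap_prodE w1 w2 :
  lap d F G (prod_row i1 i2 w1 w2) = prod_row i1 i2 (lap d1 F1 G1 w1) (lap d2 F2 G2 w2).
Proof.
exact: (lap_prod (@sderM _ _ _ openU) (@sderM _ _ _ openU1) (@sderM _ _ _ openU2)
  d_i1l d_i1r d_i2l d_i2r (cometricK g1E g1_unit rep1) (cometricK g2E g2_unit rep2)
  (cometricK prod_metricE prod_metric_unit repF)).
Qed.

Let prod_rowZ n1 n2 k (w1 : 'rV_n1) (w2 : 'rV_n2) :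
  scst openU k *: prod_row i1 i2 w1 w2 =
  prod_row i1 i2 (scst openU1 k *: w1) (scst openU2 k *: w2).
Proof.
by rewrite /prod_row scale_row_mx !map_mxZ /i1 /i2 /= !spull_scst.
Qed.

Let tauE : tau d F G c = prod_row i1 i2 v1 v2.
Proof.
rewrite v1E v2E prod_rowD /tau lap_prodE; congr (_ + _).
by rewrite -prod_rowZ; congr (_ *: _); rewrite scst_nat -rmorphM /= expr1n invr1 mulr1.
Qed.

Lemma prod_bitension x (Ux : U x) :
  let T := dot (tension 1 g f x) (tension 1 g f x) in
  bitension 1 g f x = 0 ->
  map_mx (ev (lU Ux)) (lap d1 F1 G1 v1) - T *: f1 (lsubmx x)
    + M *: map_mx (ev (lU Ux)) v1 = 0 /\
  map_mx (ev (rU Ux)) (lap d2 F2 G2 v2) - T *: f2 (rsubmx x)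
    + M *: map_mx (ev (rU Ux)) v2 = 0.
Proof.
move=> T.
have TE : T = ev Ux (ip (tau d F G c) (tau d F G c)).
  by rewrite /T (tensionE m_gt0 prod_sphere prod_metricE prod_metric_unit repF Ux) dot_ev.
rewrite (bitensionE one_neq0 m_gt0 prod_sphere prod_metricE prod_metric_unit repF Ux (erefl 1)).
rewrite -/G -/d -/c.
have ev_comb (X W Y : 'rV_(N1 + N2)) b :
    map_mx (ev Ux) (X - b *: W + (m1 + m2)%:R *: Y) =
    map_mx (ev Ux) X - ev Ux b *: map_mx (ev Ux) W + M *: map_mx (ev Ux) Y.
  by rewrite map_mxD map_mxB !map_mxZ /= rmorph_nat.
rewrite ev_comb -TE.
rewrite tauE lap_prodE /F !ev_prod_row !scale_row_mx opp_row_mx !add_row_mx.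
rewrite -row_mx0 => /eq_row_mx[E1 E2].
by rewrite -rep1 -rep2 in E1 E2 *.
Qed.

Hypothesis pmc1 : forall x, U1 x -> forall i,
  normal_connection r1 g1 f1 i (mean_curvature r1 g1 f1) x = 0.
Hypothesis pmc2 : forall x, U2 x -> forall i,
  normal_connection r2 g2 f2 i (mean_curvature r2 g2 f2) x = 0.
Hypothesis biharm : forall x, U x -> bitension 1 g f x = 0.

Local Notation sqH1 x := (dot (mean_curvature r1 g1 f1 x) (mean_curvature r1 g1 f1 x)).
Local Notation sqH2 x := (dot (mean_curvature r2 g2 f2 x) (mean_curvature r2 g2 f2 x)).

Let rowU x1 x2 : U1 x1 -> U2 x2 -> U (row_mx x1 x2).
Proof. by move=> Ux1 Ux2; rewrite /prod_domain /= row_mxKl row_mxKr. Qed.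

Lemma sqtension_prod x : U x ->
  dot (tension 1 g f x) (tension 1 g f x) =
    a1 ^+ 2 + m1%:R ^+ 2 * r1 ^- 2 * sqH1 (lsubmx x) /\
  dot (tension 1 g f x) (tension 1 g f x) =
    a2 ^+ 2 + m2%:R ^+ 2 * r2 ^- 2 * sqH2 (rsubmx x).
Proof.
move=> Ux; have [E1 E2] := prod_bitension Ux (biharm Ux).
split.
  exact: (biharmonic_factor r1_neq0 m1_gt0 f1_sphere E1).1.
exact: (biharmonic_factor r2_neq0 m2_gt0 f2_sphere E2).1.
Qed.

(** The point of the second factor completes [x] to a point of the product, where biharmonicity can
    be used. *)
Lemma lap_mean_curv1 x2 : U2 x2 -> forall x (Ux : U1 x),
  map_mx (ev Ux) (lap d1 F1 G1 H1) =
  - (a1 + M) *: mean_curvature r1 g1 f1 x + (m1%:R * r1 ^- 2 * sqH1 x) *: f1 x.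
Proof.
move=> Ux2 x Ux.
have UX := rowU Ux Ux2; have [E1 _] := prod_bitension UX (biharm UX).
have [_] := biharmonic_factor r1_neq0 m1_gt0 f1_sphere E1.
have -> : map_mx (ev (lU UX)) (lap d1 F1 G1 H1) = map_mx (ev Ux) (lap d1 F1 G1 H1).
  by apply/rowP => k; rewrite !mxE /ev row_mxKl.
by rewrite row_mxKl.
Qed.

Lemma lap_mean_curv2 x1 : U1 x1 -> forall x (Ux : U2 x),
  map_mx (ev Ux) (lap d2 F2 G2 H2) =
  - (a2 + M) *: mean_curvature r2 g2 f2 x + (m2%:R * r2 ^- 2 * sqH2 x) *: f2 x.
Proof.
move=> Ux1 x Ux.
have UX := rowU Ux1 Ux; have [_ E2] := prod_bitension UX (biharm UX).
have [_] := biharmonic_factor r2_neq0 m2_gt0 f2_sphere E2.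
have -> : map_mx (ev (rU UX)) (lap d2 F2 G2 H2) = map_mx (ev Ux) (lap d2 F2 G2 H2).
  by apply/rowP => k; rewrite !mxE /ev row_mxKr.
by rewrite row_mxKr.
Qed.

Lemma factor1_conclusion x1 x2 : U1 x1 -> U2 x2 -> 0 < sqH1 x1 ->
  let T := a1 ^+ 2 + m1%:R ^+ 2 * r1 ^- 2 * sqH1 x1 in
  (T = M ^+ 2 \/ (m1%:R ^+ 2 * sqH1 x1 - a1 * m1%:R) / Num.sqrt T <= m1%:R - 2) /\
  (T = M ^+ 2 ->
   shape_operator r1 g1 f1 x1 (mean_curvature r1 g1 f1 x1) = (sqH1 x1)%:M).
Proof.
move=> Ux1 Ux2 h0; apply: (factor_conclusion (N := N1)) => //; first by rewrite ltr0n.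
apply: (simons_at r1_neq0 m1_gt0 f1_sphere _ (lap_mean_curv1 Ux2) Ux1).
exact: (mean_curv_parallel r1_neq0 f1_sphere g1E g1_unit rep1 pmc1).
Qed.

Lemma factor2_conclusion x1 x2 : U1 x1 -> U2 x2 -> 0 < sqH2 x2 ->
  let T := a2 ^+ 2 + m2%:R ^+ 2 * r2 ^- 2 * sqH2 x2 in
  (T = M ^+ 2 \/ (m2%:R ^+ 2 * sqH2 x2 - a2 * m2%:R) / Num.sqrt T <= m2%:R - 2) /\
  (T = M ^+ 2 ->
   shape_operator r2 g2 f2 x2 (mean_curvature r2 g2 f2 x2) = (sqH2 x2)%:M).
Proof.
move=> Ux1 Ux2 h0; apply: (factor_conclusion (N := N2)) => //; first by rewrite ltr0n.
apply: (simons_at r2_neq0 m2_gt0 f2_sphere _ (lap_mean_curv2 Ux1) Ux2).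
exact: (mean_curv_parallel r2_neq0 f2_sphere g2E g2_unit rep2 pmc2).
Qed.

End LocalProduct.

(** * Passage from charts to the manifolds, and conclusion *)

Lemma posdef_unitmx (R : realType) (m : nat) (g : 'M[R]_m) :
  (forall v : 'rV[R]_m, v != 0 -> 0 < (v *m g *m v^T) 0 0) -> g \in unitmx.
Proof.
move=> pos; rewrite unitmxE unitfE; apply/negP => /det0P[v v0 vg].
by have := pos v v0; rewrite vg mul0mx mxE ltxx.
Qed.

Lemma dot_ge0 (R : realType) (n : nat) (u : 'rV[R]_n) : 0 <= dot u u.
Proof. exact: ip_ge0. Qed.

Lemma sqr_enorm (R : realType) (n : nat) (u : 'rV[R]_n) :
  enorm u ^+ 2 = dot u u.
Proof. by rewrite /enorm sqr_sqrtr // dot_ge0. Qed.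

Lemma enorm_scaled (R : realType) (n : nat) (k q : R) (u : 'rV[R]_n) :
  0 < k -> 0 <= q -> dot (k *: u) (k *: u) = q ^+ 2 -> enorm u = q / k.
Proof.
move=> k0 q0; rewrite -[dot _ _]/(ip _ _) ipZl ipZr mulrA -expr2 => E.
have kq0 : 0 <= q / k by rewrite divr_ge0 // ltW.
rewrite -[RHS]ger0_norm // -sqrtr_sqr; congr Num.sqrt.
have k2 : k ^+ 2 != 0 by rewrite expf_neq0 // gt_eqF.
by apply: (mulfI k2); rewrite [LHS]E expr_div_n mulrC divfK.
Qed.

Lemma nonminimal_point (R : realType) (m N : nat) (r : R) (M : rmanifold_data R m)
    (phi : M -> 'rV[R]_N) : ~ minimal r phi ->
  exists a x, target a x /\
    0 < dot (mean_curvature_in r phi a x) (mean_curvature_in r phi a x).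
Proof.
move=> nmin; apply: contrapT => none; apply: nmin => a x ax.
apply: contrapT => Hx; apply: none; exists a, x; split=> //.
by rewrite lt_def dot_ge0 andbT; apply/negP => /eqP/ip_eq0.
Qed.

(** This is q (tr L_1 + tr L_2) = q^2. As s a1 + m1 = s M and t a2 + m2 = t M, the left side differs
    from T by M (s a1 + t a2), and s a1 + t a2 = M - m1 - m2 = 0. *)
Lemma tension_split (R : realFieldType) (m1 m2 M s t a1 a2 h1 h2 T : R) :
  0 < s -> 0 < t -> s + t = 1 -> M = m1 + m2 ->
  a1 = M - m1 * s^-1 -> a2 = M - m2 * t^-1 ->
  T = a1 ^+ 2 + m1 ^+ 2 * s^-1 * h1 -> T = a2 ^+ 2 + m2 ^+ 2 * t^-1 * h2 ->
  (m1 ^+ 2 * h1 - a1 * m1) + (m2 ^+ 2 * h2 - a2 * m2) = T.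
Proof.
move=> s0 t0 st ME a1E a2E T1 T2.
have s_neq0 : s != 0 by rewrite gt_eqF.
have t_neq0 : t != 0 by rewrite gt_eqF.
have E1 : m1 ^+ 2 * h1 = s * (T - a1 ^+ 2) by rewrite T1; field.
have E2 : m2 ^+ 2 * h2 = t * (T - a2 ^+ 2) by rewrite T2; field.
have F1 : s * a1 + m1 = s * M by rewrite a1E; field.
have F2 : t * a2 + m2 = t * M by rewrite a2E; field.
have -> : m1 ^+ 2 * h1 - a1 * m1 + (m2 ^+ 2 * h2 - a2 * m2) =
    (s + t) * T - a1 * (s * a1 + m1) - a2 * (t * a2 + m2).
  by rewrite E1 E2; ring.
rewrite F1 F2 st.
have -> : 1 * T - a1 * (s * M) - a2 * (t * M) =
    T - M * ((s * a1 + m1) + (t * a2 + m2) - (m1 + m2)) by ring.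
by rewrite F1 F2 -mulrDl st ME; ring.
Qed.

Theorem theorem4p9 (R : realType) (m1 m2 n1 n2 : nat) (r1 r2 : R)
    (M1 : rmanifold_data R m1) (M2 : rmanifold_data R m2)
    (phi1 : M1 -> 'rV[R]_n1.+1) (phi2 : M2 -> 'rV[R]_n2.+1)
    (hm1 : (2 <= m1)%N) (hm2 : (2 <= m2)%N)
    (hr1 : 0 < r1) (hr2 : 0 < r2) (hr : r1 ^+ 2 + r2 ^+ 2 = 1)
    (hM1 : is_riemannian_manifold M1) (hM2 : is_riemannian_manifold M2)
    (hphi1 : is_submanifold r1 phi1) (hphi2 : is_submanifold r2 phi2)
    (hnonmin1 : ~ minimal r1 phi1) (hnonmin2 : ~ minimal r2 phi2)
    (hpmc1 : PMC r1 phi1) (hpmc2 : PMC r2 phi2) :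
  let M : rmanifold_data R (m1 + m2) := prod_manifold M1 M2 in
  let psi : M -> 'rV[R]_(n1.+1 + n2.+1) :=
    @sphere_prod_incl R n1 n2 \o prod_map phi1 phi2 in
  proper_biharmonic 1 psi ->
  ((2 < m1)%N \/ (2 < m2)%N ->
     exists2 h : R, mean_curvature_norm_eq 1 psi h &
       h \in `]0, ((m1 + m2)%:R - 4) / (m1 + m2)%:R] \/ h = 1) /\
  (m1 = 2%N -> m2 = 2%N ->
     [/\ pseudo_umbilical r1 phi1, pseudo_umbilical r2 phi2 &
         mean_curvature_norm_eq 1 psi 1]).
Proof.
move=> M psi [biharm _].
have [[smooth1 metric1] [smooth2 metric2]] := (hM1, hM2).
have g1_unit (a : chart_index M1) x : target a x -> metric a x \in unitmx.
  by move=> ax; apply: posdef_unitmx => v; exact: (metric_pos metric1).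
have g2_unit (a : chart_index M2) x : target a x -> metric a x \in unitmx.
  by move=> ax; apply: posdef_unitmx => v; exact: (metric_pos metric2).
have m1_gt0 : (0 < m1)%N by exact: ltn_trans hm1.
have m2_gt0 : (0 < m2)%N by exact: ltn_trans hm2.
have r1_neq0 : r1 != 0 by rewrite gt_eqF.
have r2_neq0 : r2 != 0 by rewrite gt_eqF.
pose k : R := (m1 + m2)%:R.
pose c1 := k - m1%:R * r1 ^- 2; pose c2 := k - m2%:R * r2 ^- 2.
pose h1 a x := dot (mean_curvature_in r1 phi1 a x) (mean_curvature_in r1 phi1 a x).
pose h2 a x := dot (mean_curvature_in r2 phi2 a x) (mean_curvature_in r2 phi2 a x).
pose T1 a x := c1 ^+ 2 + m1%:R ^+ 2 * r1 ^- 2 * h1 a x.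
pose T2 a x := c2 ^+ 2 + m2%:R ^+ 2 * r2 ^- 2 * h2 a x.
pose tens (a : chart_index M) x := tension 1 (metric a) (local_rep psi a) x.
have sqtension (a : chart_index M) x : target a x ->
    dot (tens a x) (tens a x) = T1 a.1 (lsubmx x) /\
    dot (tens a x) (tens a x) = T2 a.2 (rsubmx x).
  case: a => a1 a2 ax.
  exact: (sqtension_prod (target_open smooth1 (a := a1)) (target_open smooth2 (a := a2))
    r1_neq0 r2_neq0 hr m1_gt0 m2_gt0
    (submanifold_smooth hphi1 (a := a1)) (submanifold_smooth hphi2 (a := a2))
    (fun x _ => submanifold_sphere hphi1 (param a1 x))
    (fun x _ => submanifold_sphere hphi2 (param a2 x))
    (submanifold_isometric hphi1 (a := a1)) (submanifold_isometric hphi2 (a := a2))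
    (g1_unit a1) (g2_unit a2) (fun x ax => biharm (a1, a2) x ax) ax).
have rowT (a1 : chart_index M1) (a2 : chart_index M2) x1 x2 :
    target a1 x1 -> target a2 x2 -> target ((a1, a2) : chart_index M) (row_mx x1 x2).
  by move=> ax1 ax2; split; rewrite /= ?row_mxKl ?row_mxKr.
(* Separation of variables: a function of the first point equals a function of the second, so both
   are constant, across all charts. *)
have T12 (a1 : chart_index M1) (a2 : chart_index M2) x1 x2 :
    target a1 x1 -> target a2 x2 -> T1 a1 x1 = T2 a2 x2.
  move=> ax1 ax2; have [/= E1 E2] := sqtension _ _ (rowT _ _ _ _ ax1 ax2).
  by move: (etrans (esym E1) E2); rewrite row_mxKl row_mxKr.
have [b1 [y1 [by1 hy1]]] := nonminimal_point hnonmin1.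
have [b2 [y2 [by2 hy2]]] := nonminimal_point hnonmin2.
pose T := T1 b1 y1; pose q := Num.sqrt T.
have T1E (a : chart_index M1) x : target a x -> T1 a x = T.
  by move=> ax; rewrite (T12 _ _ _ _ ax by2) -(T12 _ _ _ _ by1 by2).
have T2E (a : chart_index M2) x : target a x -> T2 a x = T.
  by move=> ax; rewrite -(T12 _ _ _ _ by1 ax).
have k_pos (n : nat) (r : R) : (0 < n)%N -> r != 0 -> 0 < n%:R ^+ 2 * r ^- 2.
  move=> n0 r0; rewrite mulr_gt0 ?exprn_gt0 ?ltr0n //.
  by rewrite invr_gt0 exprn_even_gt0.
(* Non-minimality gives one point where the mean curvature is nonzero; since [T1] is constant, so is
   its squared length, and positivity spreads to all points. *)
have h1_gt0 (a : chart_index M1) x : target a x -> 0 < h1 a x.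
  move=> ax; have := T1E a x ax; rewrite /T /T1 => /addrI.
  by move=> /(mulfI (lt0r_neq0 (k_pos _ _ m1_gt0 r1_neq0))) ->.
have h2_gt0 (a : chart_index M2) x : target a x -> 0 < h2 a x.
  move=> ax; have := T2E a x ax; rewrite -(T2E b2 y2 by2) /T2 => /addrI.
  by move=> /(mulfI (lt0r_neq0 (k_pos _ _ m2_gt0 r2_neq0))) ->.
have T_gt0 : 0 < T.
  by rewrite /T /T1 ltr_wpDl ?sqr_ge0 // mulr_gt0 ?k_pos.
have q_gt0 : 0 < q by rewrite sqrtr_gt0.
have q2 : q ^+ 2 = T by rewrite sqr_sqrtr // ltW.
have k_gt0 : 0 < k by rewrite ltr0n addn_gt0 m1_gt0.
have normH : mean_curvature_norm_eq 1 psi (q / k).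
  move=> a x ax; have [E _] := sqtension a x ax.
  have Ta : T1 a.1 (lsubmx x) = T by apply: T1E; case: ax.
  apply: (enorm_scaled k_gt0 (ltW q_gt0)).
  exact: etrans E (etrans Ta (esym q2)).
have concl1 (a : chart_index M1) x (ax : target a x) :
    (T = k ^+ 2 \/ (m1%:R ^+ 2 * h1 a x - c1 * m1%:R) / q <= m1%:R - 2) /\
    (T = k ^+ 2 -> shape_operator r1 (metric a) (local_rep phi1 a) x
       (mean_curvature_in r1 phi1 a x) = (h1 a x)%:M).
  have := factor1_conclusion (target_open smooth1 (a := a)) (target_open smooth2 (a := b2))
    r1_neq0 hr m1_gt0
    (submanifold_smooth hphi1 (a := a)) (submanifold_smooth hphi2 (a := b2))
    (fun x _ => submanifold_sphere hphi1 (param a x))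
    (fun x _ => submanifold_sphere hphi2 (param b2 x))
    (submanifold_isometric hphi1 (a := a)) (submanifold_isometric hphi2 (a := b2))
    (g1_unit a) (g2_unit b2) (hpmc1 a) (fun x ax => biharm (a, b2) x ax)
    ax by2 (h1_gt0 a x ax).
  by rewrite -/(T1 a x) (T1E a x ax).
have concl2 (a : chart_index M2) x (ax : target a x) :
    (T = k ^+ 2 \/ (m2%:R ^+ 2 * h2 a x - c2 * m2%:R) / q <= m2%:R - 2) /\
    (T = k ^+ 2 -> shape_operator r2 (metric a) (local_rep phi2 a) x
       (mean_curvature_in r2 phi2 a x) = (h2 a x)%:M).
  have := factor2_conclusion (target_open smooth1 (a := b1)) (target_open smooth2 (a := a))
    r2_neq0 hr m1_gt0 m2_gt0
    (submanifold_smooth hphi1 (a := b1)) (submanifold_smooth hphi2 (a := a))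
    (fun x _ => submanifold_sphere hphi1 (param b1 x))
    (fun x _ => submanifold_sphere hphi2 (param a x))
    (submanifold_isometric hphi1 (a := b1)) (submanifold_isometric hphi2 (a := a))
    (g1_unit b1) (g2_unit a) (hpmc2 a) (fun x ax => biharm (b1, a) x ax)
    by1 ax (h2_gt0 a x ax).
  by rewrite -/(T2 a x) (T2E a x ax).
have norm1 : T = k ^+ 2 -> q / k = 1.
  by move=> Tk; rewrite /q Tk sqrtr_sqr gtr0_norm // divff // gt_eqF.
(* If both factors are in the second alternative, the bounds [m1%:R - 2] and [m2%:R - 2] add up to
   [k - 4], and by [tension_split] the quotients add up to [q]. *)
have gap : T = k ^+ 2 \/ q <= k - 4.
  have [[->|l1] _] := concl1 _ _ by1; first by left.
  have [[->|l2] _] := concl2 _ _ by2; first by left.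
  right; have kE : k = m1%:R + m2%:R by rewrite /k natrD.
  have := tension_split (exprn_gt0 2 hr1) (exprn_gt0 2 hr2) hr kE (erefl c1) (erefl c2)
    (erefl T) (esym (T2E _ _ by2)).
  move=> split_T; have : (q ^+ 2) / q <= k - 4.
    by rewrite q2 -split_T mulrDl; lra.
  by rewrite expr2 mulfK // gt_eqF.
split=> [_|m1E m2E].
  exists (q / k) => //; case: gap => [/norm1 ->|qk]; first by right.
  left; rewrite in_itv /= divr_gt0 //= ler_pM2r ?invr_gt0 //.
(* Here [k - 4 = 0], which the positive number [q] exceeds. *)
have Tk : T = k ^+ 2.
  case: gap => // qk; have : q <= 0 by rewrite (le_trans qk) // /k m1E m2E; lra.
  by rewrite leNgt q_gt0.
split.
- by move=> a x ax; rewrite sqr_enorm; exact: (concl1 a x ax).2 Tk.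
- by move=> a x ax; rewrite sqr_enorm; exact: (concl2 a x ax).2 Tk.
- by move: normH; rewrite (norm1 Tk).
Qed.
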